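(* Let $(T_{\boldsymbol s})_{\boldsymbol s\succeq\boldsymbol 0}$ be a $k$-parameter strongly continuous semigroup on $\mathfrak B_b(\mathbb R^d)$ associated to a $k$-parameter homogeneous Markov process $\boldsymbol X(\boldsymbol s)$, with marginal generators $\mathcal G^{(1)},\dots,\mathcal G^{(k)}$. Let $\boldsymbol S(t)$ be a $k$-dimensional additive subordinator independent of $\boldsymbol X$, whose characteristic function at time $t$ is $$\mathbb E\big[e^{i\boldsymbol\xi\cdot\boldsymbol S(t)}\big]=\exp\Big\{i\boldsymbol c(t)\cdot\boldsymbol\xi+\int_{\mathbb R^k_+\setminus\{\boldsymbol 0\}}\big(e^{i\boldsymbol s\cdot\boldsymbol\xi}-1\big)\,\nu(t,d\boldsymbol s)\Big\},\qquad\boldsymbol\xi\in\mathbb R^k,$$ where $\boldsymbol c(t)=(c_1(t),\dots,c_k(t))\in\mathbb R^k_+$ is the time-dependent drift and $\nu(t,d\boldsymbol s)$ is a time-dependent Lévy measure. Let $\pi_{t_1,t_2}$ be the law of $\boldsymbol S(t_2)-\boldsymbol S(t_1)$ and define the evolution system $$T_{t_1,t_2}f=\int_{\mathbb R^k_+}T_{\boldsymbol s}f\,\pi_{t_1,t_2}(d\boldsymbol s),\qquad f\in\mathfrak B_b(\mathbb R^d),\ 0\le t_1\le t_2,$$ with right generators $\mathcal G_t$. Define the finite measure $\nu_F(t,A)=\int_A(\|\boldsymbol s\|\wedge1)\,\nu(t,d\boldsymbol s)$ for Borel sets $A\subseteq\mathbb R^k_+$. Assume that: (i) the left and right limits of $c_j(t)$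 exist and are finite for every $t\ge0$ and $j=1,\dots,k$; (ii) for every $t\ge0$ the left and right limits of $\nu_F(t,\cdot)$ converge weakly to a finite measure; (iii) $c_j(t)$, $j=1,\dots,k$, and $\nu_F(t,\cdot)$ are right continuous and have only a finite number of points of discontinuity. Then the evolution system $(T_{t_1,t_2})_{t_1<t_2}$ is a strongly continuous backward as well as forward propagator; $\bigcap_{j=1}^kD(\mathcal G^{(j)})\subseteq D(\mathcal G_t)$ for each $t\ge0$; and $$\mathcal G_tf=\sum_{j=1}^kc_j(t)\,\mathcal G^{(j)}f+\int_{\mathbb R^k_+\setminus\{\boldsymbol 0\}}(T_{\boldsymbol s}f-f)\,\nu(t,d\boldsymbol s),\qquad f\in\bigcap_{j=1}^kD(\mathcal G^{(j)}).$$ Moreover, for $0\le t_1<t_2$ and such $f$, $$\lim_{h\to0+}h^{-1}\big(T_{t_1,t_2+h}f-T_{t_1,t_2}f\big)=T_{t_1,t_2}\mathcal G_{t_2}f=\mathcal G_{t_2}T_{t_1,t_2}f.$$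
   Context: $\mathfrak B_b(\mathbb R^d)$ is the Banach space of bounded Borel functions $\mathbb R^d\to\mathbb R$ with the supremum norm; limits of functions are in this norm. On $\mathbb R^k$, $\boldsymbol s\preceq\boldsymbol t$ means $s_j\le t_j$ for all $j$; $\boldsymbol e_1,\dots,\boldsymbol e_k$ is the canonical basis of $\mathbb R^k$. A $k$-parameter filtration is a family $(\mathcal F_{\boldsymbol s})_{\boldsymbol s\in\mathbb R^k_+}$ of sub-$\sigma$-algebras with $\mathcal F_{\boldsymbol s}\subseteq\mathcal F_{\boldsymbol t}$ for $\boldsymbol s\preceq\boldsymbol t$; it is commuting (w.r.t. $P$) if for all $\boldsymbol s,\boldsymbol t$ and bounded $\mathcal F_{\boldsymbol t}$-measurable $Z$, $E[Z\mid\mathcal F_{\boldsymbol s}]=E[Z\mid\mathcal F_{\boldsymbol s\wedge\boldsymbol t}]$ a.s. A $k$-parameter $\mathbb R^d$-valued process $(\boldsymbol X(\boldsymbol s))_{\boldsymbol s\in\mathbb R^k_+}$ is a homogeneous Markov process if there are a $k$-parameter filtration $(\mathcal F_{\boldsymbol s})$ and operators $(T_{\boldsymbol s})_{\boldsymbol s\succeq\boldsymbol 0}$ such that for every $\boldsymbol x\in\mathbb R^d$ there is a probability measure $\mathbb P_{\boldsymbol x}$ with: (a) $\boldsymbol X$ is adapted; (b) trajectories are $\mathbb P_{\boldsymbol x}$-a.s. càdlàg in the partial order; (c) each $\mathcal F_{\boldsymbol s}$ is $\mathbb P_{\boldsymbol x}$-complete and the filtration is commuting w.r.t. all $\mathbb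 P_{\boldsymbol x}$; (d) $\mathbb E_{\boldsymbol x}[f(\boldsymbol X(\boldsymbol s+\boldsymbol t))\mid\mathcal F_{\boldsymbol s}]=T_{\boldsymbol t}f(\boldsymbol X(\boldsymbol s))$ for $f\in\mathfrak B_b(\mathbb R^d)$; (e) $\mathbb P_{\boldsymbol x}(\boldsymbol X(\boldsymbol 0)=\boldsymbol x)=1$. The associated semigroup is $T_{\boldsymbol s}f(\boldsymbol x)=\mathbb E_{\boldsymbol x}[f(\boldsymbol X(\boldsymbol s))]$; it satisfies $T_{\boldsymbol 0}=\mathrm{Id}$, $T_{\boldsymbol s+\boldsymbol t}=T_{\boldsymbol s}T_{\boldsymbol t}$. The marginal semigroups $T^{(j)}_s=T_{s\boldsymbol e_j}$ are commuting strongly continuous one-parameter semigroups with $T_{\boldsymbol s}=T^{(1)}_{s_1}\cdots T^{(k)}_{s_k}$; $\mathcal G^{(j)}$, with domain $D(\mathcal G^{(j)})$, is the infinitesimal generator of $(T^{(j)}_s)_{s\ge0}$. A $k$-dimensional additive subordinator is an $\mathbb R^k_+$-valued process started at $\boldsymbol 0$, increasing in each component, with independent (not necessarily stationary) increments and continuous in probability. The right generator is $\mathcal G_tf=\lim_{h\to0+}h^{-1}(T_{t,t+h}f-f)$, with domain $D(\mathcal G_t)$ the set of $f$ for which the limit exists. A family of bounded operators $(T_{t_1,t_2})_{t_1\le t_2}$ with $T_{t,t}=\mathrm{Id}$ is a backward propagator if $T_{t_1,t_2}T_{t_2,t_3}=T_{t_1,t_3}$ and a forward propagator if $T_{t_2,t_3}T_{t_1,t_2}=T_{t_1,t_3}$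 for $t_1\le t_2\le t_3$; it is strongly continuous if $(t_1,t_2)\mapsto T_{t_1,t_2}f$ is norm continuous on $\{t_1\le t_2\}$ for each $f$.
   Formalization: The exponent of S(t) is read as the integral over u in [0,t] of i c(u)·ξ+∫(e^{is·ξ}-1)ν(u,ds); as printed the generator formula fails (unit Poisson, ν(t,·)=tδ_1). Completeness of F_s is required only with respect to the family (P_x) jointly. *)

(* Defs.v *)
From HB Require Import structures.
From mathcomp Require Import all_boot all_order all_algebra.
From mathcomp.real_closed Require Import complex.
From mathcomp Require Import all_classical all_reals all_analysis.
From mathcomp Require Import measurable_realfun.

Set Implicit Arguments.
Unset Strict Implicit.
Unset Printing Implicit Defensive.
Import Order.TTheory GRing.Theory Num.Theory numFieldNormedType.Exports.
Local Open Scope classical_set_scope.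
Local Open Scope ring_scope.

(* R^n with its Borel sigma-algebra; the carrier is convertible to 'rV[R]_n. *)
Notation borel_rV R n := (g_sigma_algebraType (@open 'rV[R]_n)).

Section euclidean_space.
Context {R : realType} {n : nat}.
Implicit Types s t : 'rV[R]_n.

Definition vle s t := forall j, s 0 j <= t 0 j.
Definition vlt s t := forall j, s 0 j < t 0 j.
Definition vmin s t : 'rV[R]_n := \row_j Num.min (s 0 j) (t 0 j).
Definition orthant : set 'rV[R]_n := [set s | vle 0 s].
Definition orthant0 : set 'rV[R]_n := orthant `\ 0.
Definition dot s t : R := \sum_j s 0 j * t 0 j.
(* The norm that the library puts on 'rV[R]_n is the maximum norm. *)
Definition enorm s : R := Num.sqrt (dot s s).
Definition basis_vec (j : 'I_n) : 'rV[R]_n := delta_mx 0 j.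

End euclidean_space.

Section complex_valued.
Context {R : realType}.
Local Open Scope complex_scope.

Definition cexp (z : R[i]) : R[i] :=
  (expR (complex.Re z) * cos (complex.Im z)) +i*
  (expR (complex.Re z) * sin (complex.Im z)).

Definition cintegral {d} {T : measurableType d}
    (mu : {measure set T -> \bar R}) (D : set T) (f : T -> R[i]) : R[i] :=
  (\int[mu]_(x in D) complex.Re (f x)) +i* (\int[mu]_(x in D) complex.Im (f x)).

Definition char_fun {d} {T : measurableType d} {n : nat}
    (P : probability T R) (Y : T -> 'rV[R]_n) (xi : 'rV[R]_n) : R[i] :=
  cintegral P setT (fun w => cexp (0 +i* dot xi (Y w))).

Definition levy_exponent {k : nat} (c : 'rV[R]_k)
    (m : {measure set (borel_rV R k) -> \bar R}) (xi : 'rV[R]_k) : R[i] :=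
  (0 +i* dot c xi) +
  cintegral m orthant0 (fun s => cexp (0 +i* dot s xi) - 1).

(* c(u) and nu(u, .) are the characteristics at time u, i.e. densities in time,
   so the exponent of S(t) is their integral over [0, t]. With cumulative
   characteristics (no time integral) the formula for the right generators would
   be false: a Poisson process would have nu(t, .) = t delta_1, but its generator
   does not depend on t. *)
Definition additive_exponent {k : nat} (c : R -> 'rV[R]_k)
    (nu : R -> {measure set (borel_rV R k) -> \bar R}) (t : R)
    (xi : 'rV[R]_k) : R[i] :=
  cintegral lebesgue_measure `[0, t]
    (fun u : R => levy_exponent (c u) (nu u) xi).

End complex_valued.

Section bounded_borel.
Context {R : realType} {d : nat}.
Local Notation V := 'rV[R]_d.

Definition Bb (f : V -> R) : Prop :=
  measurable_fun [set: borel_rV R d] (f : borel_rV R d -> R) /\ bounded_fun f.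

Definition supnorm (f : V -> R) : R := sup (range (fun x => `|f x|)).

(* Convergence in the supremum norm. *)
Definition norm_cvg (H : set_system (V -> R)) (g : V -> R) : Prop :=
  {uniform, H --> g}.

(* Operators act on all functions but are only constrained on Bb. *)
Definition bounded_operator (A : (V -> R) -> (V -> R)) : Prop :=
  [/\ forall f, Bb f -> Bb (A f),
      forall a f g, Bb f -> Bb g ->
        A (fun x => a * f x + g x) = (fun x => a * A f x + A g x) &
      exists M, forall f, Bb f -> supnorm (A f) <= M * supnorm f].

(* g is the limit of (A_h f - f) / h in the Banach space Bb, as h -> 0+. *)
Definition is_generator (A : R -> (V -> R) -> (V -> R)) (f g : V -> R) : Prop :=
  [/\ Bb f, Bb g &
      norm_cvg ((fun h : R => fun x => h^-1 * (A h f x - f x)) @ 0^'+) g].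

Definition gen_domain (A : R -> (V -> R) -> (V -> R)) : set (V -> R) :=
  [set f | exists g, is_generator A f g].

Definition generator (A : R -> (V -> R) -> (V -> R)) (f : V -> R) : V -> R :=
  xget (cst 0) [set g | is_generator A f g].

Definition propagator (U : R -> R -> (V -> R) -> (V -> R)) : Prop :=
  (forall t1 t2 : R, 0 <= t1 -> t1 <= t2 -> bounded_operator (U t1 t2)) /\
  (forall (t : R) f, 0 <= t -> Bb f -> U t t f = f).

Definition backward_propagator U : Prop := propagator U /\
  forall (t1 t2 t3 : R) f, 0 <= t1 -> t1 <= t2 -> t2 <= t3 -> Bb f ->
    U t1 t2 (U t2 t3 f) = U t1 t3 f.

Definition forward_propagator U : Prop := propagator U /\
  forall (t1 t2 t3 : R) f, 0 <= t1 -> t1 <= t2 -> t2 <= t3 -> Bb f ->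
    U t2 t3 (U t1 t2 f) = U t1 t3 f.

Definition strongly_continuous (U : R -> R -> (V -> R) -> (V -> R)) : Prop :=
  let D := [set p : R * R | 0 <= p.1 /\ p.1 <= p.2] in
  forall p f, D p -> Bb f ->
    norm_cvg ((fun q : R * R => U q.1 q.2 f) @ within D (nbhs p)) (U p.1 p.2 f).

Context {k : nat}.

Definition sc_semigroup (T : 'rV[R]_k -> (V -> R) -> (V -> R)) : Prop :=
  [/\ forall s, orthant s -> bounded_operator (T s),
      forall f, Bb f -> T 0 f = f,
      forall s t f, orthant s -> orthant t -> Bb f ->
        T (s + t) f = T s (T t f) &
      forall f, Bb f ->
        norm_cvg ((fun s => T s f) @ within orthant (nbhs (0 : 'rV[R]_k))) f].

Definition marginal (T : 'rV[R]_k -> (V -> R) -> (V -> R)) (j : 'I_k) :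
    R -> (V -> R) -> (V -> R) :=
  fun s => T (s *: basis_vec j).

(* The Bb-valued integral is evaluated pointwise. *)
Definition evolution (T : 'rV[R]_k -> (V -> R) -> (V -> R))
    (pi : R -> R -> probability (borel_rV R k) R) :
    R -> R -> (V -> R) -> (V -> R) :=
  fun t1 t2 f x => \int[pi t1 t2]_(s in orthant) T s f x.

Definition right_increments (U : R -> R -> (V -> R) -> (V -> R)) (t : R) :
    R -> (V -> R) -> (V -> R) :=
  fun h => U t (t + h).

End bounded_borel.

Section processes.
Context {R : realType} {dO : measure_display} {Omega : measurableType dO}.
Implicit Types (P : probability Omega R) (G : set (set Omega)).

Definition sub_measurable {d} {E : measurableType d} G (Y : Omega -> E) : Prop :=
  forall B, measurable B -> G (Y @^-1` B).

(* Y is a version of E[Z | G]. *)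
Definition is_cond_exp P G (Z Y : Omega -> R) : Prop :=
  [/\ sub_measurable G Y, P.-integrable setT (EFin \o Y) &
      forall A, G A -> \int[P]_(w in A) Y w = \int[P]_(w in A) Z w].

Context {k d : nat}.

Definition filtration (F : 'rV[R]_k -> set (set Omega)) : Prop :=
  [/\ forall s, orthant s -> sigma_algebra setT (F s),
      forall s, orthant s -> F s `<=` measurable &
      forall s t, orthant s -> vle s t -> F s `<=` F t].

Definition commuting (F : 'rV[R]_k -> set (set Omega)) P : Prop :=
  forall s t (Z : Omega -> R), orthant s -> orthant t ->
    sub_measurable (F t) Z -> bounded_fun Z ->
    forall Y Y', is_cond_exp P (F s) Z Y -> is_cond_exp P (F (vmin s t)) Z Y' ->
      {ae P, forall w, Y w = Y' w}.

(* N belongs to the completion of G with respect to P. *)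
Definition in_completion P G (N : set Omega) : Prop :=
  exists A B, [/\ G A, G B, P B = 0%E & (N `\` A) `|` (A `\` N) `<=` B].

(* Completeness with respect to a family of laws: G is the intersection of its
   P_x-completions. This is weaker than completeness for every single P_x, which
   would be degenerate: when X(0) = x holds P_x-a.s., it puts every subset of
   Omega into F_0 (split the subset along the event X(0) = x), so that the Markov
   property makes X deterministic. *)
Definition complete_for {I : Type} (P : I -> probability Omega R) G : Prop :=
  forall N, (forall x, in_completion (P x) G N) -> G N.

(* The limit from below is along points that are smaller in every coordinate. *)
Definition cadlag (y : 'rV[R]_k -> 'rV[R]_d) : Prop :=
  forall s, orthant s ->
    (y u @[u --> within [set u | vle s u] (nbhs s)] --> y s) /\
    (exists l : 'rV[R]_d,
      y u @[u --> within [set u | orthant u /\ vlt u s] (nbhs s)] --> l).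

Record markov_process (F : 'rV[R]_k -> set (set Omega))
    (T : 'rV[R]_k -> ('rV[R]_d -> R) -> ('rV[R]_d -> R))
    (P : 'rV[R]_d -> probability Omega R)
    (X : 'rV[R]_k -> Omega -> 'rV[R]_d) : Prop := {
  markov_filtration : filtration F ;
  markov_adapted : forall s, orthant s ->
    sub_measurable (F s) (X s : Omega -> borel_rV R d) ;
  markov_cadlag : forall x, {ae P x, forall w, cadlag (X ^~ w)} ;
  markov_complete : forall s, orthant s -> complete_for P (F s) ;
  markov_commuting : forall x, commuting F (P x) ;
  markov_property : forall x s t f, orthant s -> orthant t -> Bb f ->
    is_cond_exp (P x) (F s) (fun w => f (X (s + t) w)) (fun w => T t f (X s w)) ;
  markov_start : forall x, P x [set w | X 0 w = x] = 1%E }.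

Definition associated_semigroup (P : 'rV[R]_d -> probability Omega R)
    (X : 'rV[R]_k -> Omega -> 'rV[R]_d)
    (T : 'rV[R]_k -> ('rV[R]_d -> R) -> ('rV[R]_d -> R)) : Prop :=
  forall s f x, orthant s -> Bb f -> T s f x = \int[P x]_w f (X s w).

Definition generated_sigma {I : Type} {n : nat} (D : set I)
    (Y : I -> Omega -> 'rV[R]_n) : set (set Omega) :=
  <<s [set A | exists i (B : set (borel_rV R n)),
         [/\ D i, measurable B & A = Y i @^-1` B]] >>.

Definition independent_sigma P G1 G2 : Prop :=
  forall A B, G1 A -> G2 B -> P (A `&` B) = (P A * P B)%E.

Definition independent_increments P (S : R -> Omega -> 'rV[R]_k) : Prop :=
  forall (n : nat) (t : nat -> R) (B : 'I_n -> set (borel_rV R k)),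
    0 <= t 0%N -> (forall i, t i <= t i.+1) -> (forall i, measurable (B i)) ->
    P (\bigcap_(i in [set: 'I_n]) [set w | B i (S (t i.+1) w - S (t i) w)]) =
    (\prod_(i < n) P [set w | B i (S (t i.+1) w - S (t i) w)%R])%E.

Record additive_subordinator P (S : R -> Omega -> 'rV[R]_k) : Prop := {
  subordinator_measurable : forall t : R, 0 <= t ->
    measurable_fun [set: Omega] (S t : Omega -> borel_rV R k) ;
  subordinator_ge0 : forall (t : R) w, 0 <= t -> orthant (S t w) ;
  subordinator_start : {ae P, forall w, S 0 w = 0} ;
  subordinator_increasing : {ae P, forall w, forall t1 t2 : R,
    0 <= t1 -> t1 <= t2 -> vle (S t1 w) (S t2 w)} ;
  subordinator_increments : independent_increments P S ;
  subordinator_continuous : forall t e : R, 0 <= t -> 0 < e ->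
    P [set w | e < enorm (S u w - S t w)]
      @[u --> within [set u : R | 0 <= u] (nbhs t)] --> 0%E }.

End processes.

Section levy_measures.
Context {R : realType} {k : nat}.
Local Notation E := (borel_rV R k).
Local Open Scope ereal_scope.

Definition truncated_norm (s : 'rV[R]_k) : \bar R := (Num.min (enorm s) 1)%:E.

Lemma truncated_norm_ge0 s : 0 <= truncated_norm s.
Proof. by rewrite lee_fin le_min sqrtr_ge0 ler01. Qed.

Lemma measurable_continuous_rV (f : 'rV[R]_k -> R) :
  continuous f -> measurable_fun [set: E] (f : E -> R).
Proof.
move=> /continuousP cf; apply: (measurability _ (RGenOpens.measurableE R)).
move=> _ [_ [a [b ->] <-]]; rewrite setTI; apply: sub_sigma_algebra.
exact/cf/interval_open.
Qed.

Lemma measurable_truncated_norm :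
  measurable_fun [set: E] (truncated_norm : E -> \bar R).
Proof.
apply/measurable_EFinP; apply: measurable_minr => //.
have cdot : continuous (fun s : 'rV[R]_k => dot s s).
  apply: continuous_big => [|j _ s]; first exact: add_continuous.
  by apply: (@cvgM _ _ (nbhs s)); exact: coord_continuous.
apply: measurable_continuous_rV => s.
by apply: continuous_comp; [exact: cdot|exact: sqrt_continuous].
Qed.

(* The measure A |-> int_A (|s| /\ 1) m(ds). *)
Definition truncated (m : {measure set E -> \bar R}) (A : set E) : \bar R :=
  \int[m]_(s in A) truncated_norm s.

Section truncated.
Context (m : {measure set E -> \bar R}).

Let truncated0 : truncated m set0 = 0.
Proof. exact: integral_set0. Qed.

Let truncated_ge0 A : 0 <= truncated m A.
Proof. by apply: integral_ge0 => s _; exact: truncated_norm_ge0. Qed.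

Let truncated_sigma_additive : semi_sigma_additive (truncated m).
Proof.
move=> /= F mF tF mUF; rewrite /truncated; apply: cvg_toP.
  apply: ereal_nondecreasing_is_cvgn => i j ij.
  apply: lee_sum_nneg_natr => // l _ _; apply: integral_ge0 => s _.
  exact: truncated_norm_ge0.
rewrite ge0_integral_bigcup//=.
- by apply: measurable_funTS; exact: measurable_truncated_norm.
- by move=> s _; exact: truncated_norm_ge0.
Qed.

HB.instance Definition _ := isMeasure.Build _ _ _ (truncated m)
  truncated0 truncated_ge0 truncated_sigma_additive.

Definition truncated_measure : {measure set E -> \bar R} := truncated m.

End truncated.

Definition levy_measure (m : {measure set E -> \bar R}) : Prop :=
  m (~` orthant0) = 0 /\ \int[m]_(s in orthant0) truncated_norm s < +oo.

(* Weak convergence of measures on the orthant, as u -> G. *)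
Definition weak_cvg (mu : R -> {measure set E -> \bar R}) (G : set_system R)
    (m : {measure set E -> \bar R}) : Prop :=
  forall g : 'rV[R]_k -> R, {within orthant, continuous g} ->
    (exists C : R, forall s, orthant s -> (`|g s| <= C)%R) ->
    (\int[mu u]_(s in orthant) g s)%R @[u --> G] --> (\int[m]_(s in orthant) g s)%R.

End levy_measures.

(* Main.v *)
Require Import Defs.
From HB Require Import structures.
From mathcomp Require Import all_boot all_order all_algebra.
From mathcomp.real_closed Require Import complex.
From mathcomp Require Import all_classical all_reals all_analysis.
From mathcomp Require Import measurable_realfun ring lra.

Set Implicit Arguments.
Unset Strict Implicit.
Unset Printing Implicit Defensive.
Import Order.TTheory GRing.Theory Num.Theory numFieldNormedType.Exports.
Local Open Scope classical_set_scope.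
Local Open Scope ring_scope.

(** The transition operators satisfy |T_s f - f - sum_j s_j G_j f| = o(|s|) in sup
    norm for f in the domain of all the marginal generators G_j, so the generator
    formula asserts that pi_{t,t+h} / h converges, as h -> 0+, to nu(t, .) plus the
    drift at 0, against functions that are bounded, uniformly continuous and
    differentiable at 0, uniformly over equicontinuous families. Dividing the
    characteristic functions of pi_{t,t+h} shows this for the functions
    cos(xi.s) - 1 and sin(xi.s). The characteristic functions also bound
    pi_{t,t+h} / h on {s_j >= 1} and show that it is tight, while s_j is dominated by
    2 sin s_j for s_j <= 1; hence the integrals of sum_j min(s_j, 1) stay bounded. It
    remains to approximate: after subtracting multiples of sin s_j, the test function
    is o(|s|), and a Bernstein polynomial in the variables 1 - cos(eta s_j)
    approximates it up to e * sum_j min(s_j, 1) on a large box. The propagator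
    identities come from the independence of the increments, and strong continuity
    from the uniform continuity of s -> T_s f and continuity in probability. *)

(** * Measurability on the orthant *)

(** The measure pi_{t,t+h} / h has total mass 1 / h, concentrating at 0, so its convergence makes
    sense only relative to the weight |s| /\ 1. A test function that is differentiable at 0 sees the
    mass near 0 through its gradient, which is where the drift comes from; a function that is o(|s|)
    does not see it. Moreover a generator is a limit in the sup norm, so the functions s -> T_s f(x)
    - f(x) must be treated for all x at once, whereas weak convergence handles one test function at
    a time. This calls for an explicit approximation: finitely many trigonometric polynomials are
    chosen independently of x and only their bounded coefficients depend on x, so that convergence
    on each polynomial is automatically uniform in x. Bernstein polynomials supply such
    coefficients, namely values at nodes. The function approximated is a remainder r divided by w =
    sum_j (1 - cos(eta s_j)). Near 0, w is of order |s|^2 while r is only o(|s|), so r / w may blow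
    up there; this forces the regularisation r / (w + tau). *)

Section row_vectors.
Context {R : realType} {k : nat}.
Local Notation V := 'rV[R]_k.
Local Notation E := (borel_rV R k).

Lemma orthantD (s t : V) : orthant s -> orthant t -> orthant (s + t).
Proof.
by move=> s0 t0 j; move: (s0 j) (t0 j); rewrite !mxE => ? ?; exact: addr_ge0.
Qed.

Lemma orthant_ge0 (s : V) j : orthant s -> 0 <= s 0 j.
Proof. by move=> /(_ j); rewrite mxE. Qed.

Lemma orthant_0 : orthant (0 : V).
Proof. by move=> j. Qed.

Lemma ball_rV (s t : V) e : 0 < e ->
  (forall j, `|s 0 j - t 0 j| < e) -> ball s e t.
Proof. by move=> e0 st; split=> // i j; rewrite ord1; exact: st. Qed.

Lemma rV_ball (s t : V) e : ball s e t -> forall j, `|s 0 j - t 0 j| < e.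
Proof. by move=> [_ st] j; exact: st. Qed.

Lemma within_continuousP (A : set V) (f : V -> R) :
  {within A, continuous f} <->
  forall s, A s -> forall e, 0 < e -> exists2 d, 0 < d &
    forall t, A t -> (forall j, `|s 0 j - t 0 j| < d) -> `|f s - f t| < e.
Proof.
rewrite subspace_continuousP; split => cf s As.
  move=> e e0; have /cvgrPdist_lt /(_ e e0) := cf s As.
  rewrite near_withinE => /nbhs_ballP[d /= d0 dA]; exists d => // t At st.
  by apply: dA => //; exact: ball_rV.
apply/cvgrPdist_lt => e e0; have [d d0 dA] := cf s As e e0.
rewrite near_withinE; apply/nbhs_ballP; exists d => //= t st At.
by apply: dA => // j; exact: rV_ball.
Qed.

(** Integer rows form a countable type, so preimages split into countably many cells. Rounding down
    keeps points of the orthant in the orthant, the only place where the integrands are known to be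
    continuous. *)
Definition grid (n : nat) (s : V) : 'rV[int]_k :=
  \row_j Num.floor (n.+1%:R * s 0 j).
Definition of_grid (n : nat) (m : 'rV[int]_k) : V :=
  \row_j ((m 0 j)%:~R / n.+1%:R).

Lemma of_gridK n (s : V) j : `|s 0 j - of_grid n (grid n s) 0 j| <= n.+1%:R^-1.
Proof.
rewrite !mxE; set x := s 0 j; have n0 : 0 < n.+1%:R :> R by rewrite ltr0n.
have /andP[fx xf] := floor_itv (n.+1%:R * x); rewrite intrD in xf.
have -> : x - (Num.floor (n.+1%:R * x))%:~R / n.+1%:R =
    (n.+1%:R * x - (Num.floor (n.+1%:R * x))%:~R) / n.+1%:R.
  by rewrite mulrBl [_ * x]mulrC mulfK// gt_eqF.
rewrite ger0_norm; last by apply: divr_ge0; rewrite ?subr_ge0// ltW.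
by rewrite ler_pdivrMr// mulVf ?gt_eqF//; lra.
Qed.

Lemma of_grid_orthant n (s : V) : orthant s -> orthant (of_grid n (grid n s)).
Proof.
move=> s0 j; rewrite !mxE divr_ge0// ler0z floor_ge0 mulr_ge0//.
exact: orthant_ge0.
Qed.

Lemma of_grid_near (s : V) d : 0 < d ->
  \forall n \near \oo, forall j, `|s 0 j - of_grid n (grid n s) 0 j| < d.
Proof.
move=> d0; near=> n => j; apply: (le_lt_trans (of_gridK _ _ _)).
by near: n; exact: near_infty_natSinv_lt (PosNum d0).
Unshelve. all: by end_near. Qed.

Lemma measurable_coord j : measurable_fun [set: E] (fun s : E => (s : V) 0 j).
Proof. by apply: measurable_continuous_rV; exact: coord_continuous. Qed.

Lemma measurable_grid d (Y : measurableType d) (g : Y -> V) n m :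
  (forall j, measurable_fun setT (fun y => g y 0 j)) ->
  measurable [set y | grid n (g y) = m].
Proof.
move=> mg; have -> : [set y | grid n (g y) = m] =
    \big[setI/setT]_(j <- enum 'I_k) [set y | (m 0 j)%:~R <= n.+1%:R * g y 0 j]
      `&` \big[setI/setT]_(j <- enum 'I_k)
        [set y | n.+1%:R * g y 0 j < (m 0 j + 1)%:~R].
  apply/seteqP; split => [y /= <-|y /=].
    rewrite -!bigcap_seq; split=> j _ /=; rewrite mxE.
      by have /andP[] := floor_itv (n.+1%:R * g y 0 j).
    by have /andP[] := floor_itv (n.+1%:R * g y 0 j).
  rewrite -!bigcap_seq => -[h1 h2]; apply/rowP => j; rewrite mxE.
  apply/eqP; rewrite floor_eq; have := h1 j; have := h2 j => /=.
  by rewrite mem_enum => /(_ isT) -> /(_ isT) ->.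
have mf j : measurable_fun setT (fun y => n.+1%:R * g y 0 j).
  by apply: measurable_funM => //; exact: measurable_cst.
apply: measurableI; apply: bigsetI_measurable => j _.
  rewrite -[X in measurable X]setTI; rewrite (_ : [set _ | _] =
    (fun y => n.+1%:R * g y 0 j) @^-1` `[(m 0 j)%:~R, +oo[); first exact: mf.
  by apply/seteqP; split => y /=; rewrite in_itv/= andbT.
rewrite -[X in measurable X]setTI; rewrite (_ : [set _ | _] =
  (fun y => n.+1%:R * g y 0 j) @^-1` `]-oo, (m 0 j + 1)%:~R[); first exact: mf.
by apply/seteqP; split => y /=; rewrite in_itv.
Qed.

(** An open set is the countable union of the lattice cells for which the closed cube of radius
    1/(n+1) about the corner lies inside it, and membership in a cell only involves coordinates. *)
Lemma measurable_rV d (Y : measurableType d) (g : Y -> V) :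
  (forall j, measurable_fun setT (fun y => g y 0 j)) ->
  measurable_fun setT (g : Y -> E).
Proof.
move=> mg; apply: (@measurability _ _ _ E _ _ (@open V)) => // _ [U oU <-].
rewrite setTI.
have -> : g @^-1` U = \bigcup_n \bigcup_(m in [set m : 'rV[int]_k |
    forall t : V, (forall j, `|of_grid n m 0 j - t 0 j| <= n.+1%:R^-1) -> U t])
    [set y | grid n (g y) = m].
  apply/seteqP; split => [y /= Uy|y [n _ [m /= Um ym]]].
    have /nbhs_ballP[e /= e0 eU] := open_nbhs_nbhs (conj oU Uy).
    have e20 : 0 < e / 2 by rewrite divr_gt0.
    have [n _ /(_ n (leqnn n)) nP] := near_infty_natSinv_lt (PosNum e20).
    exists n => //; exists (grid n (g y)) => //= t tP.
    apply: eU; apply: ball_rV => // j; have := tP j; have := of_gridK n (g y) j.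
    rewrite !ler_norml !ltr_norml; move: nP => /=; set c := _^-1; lra.
  by apply: Um => j; rewrite -ym distrC; exact: of_gridK.
apply: bigcup_measurable => n _.
rewrite bigcup_mkcond; apply: countable_bigcupT_measurable => // m.
by case: ifP => // _; exact: measurable_grid.
Qed.

Lemma measurable_orthant : measurable (orthant : set E).
Proof.
rewrite (_ : orthant = \big[setI/setT]_(j <- enum 'I_k)
    [set s : E | 0 <= (s : V) 0 j]).
  apply: bigsetI_measurable => j _; rewrite -[X in measurable X]setTI.
  rewrite (_ : [set _ | _] = (fun s : E => (s : V) 0 j) @^-1` `[0, +oo[).
    exact: measurable_coord.
  by apply/seteqP; split => y /=; rewrite in_itv/= andbT.
rewrite -bigcap_seq; apply/seteqP; split=> [s s0 j _ /=|s s0 j].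
  exact: orthant_ge0.
by rewrite mxE; apply: s0; rewrite /= mem_enum.
Qed.

Lemma measurable_orthant0 : measurable (orthant0 : set E).
Proof.
apply: measurableD; first exact: measurable_orthant.
rewrite (_ : [set 0] = \big[setI/setT]_(j <- enum 'I_k)
    [set s : E | (s : V) 0 j = 0]).
  apply: bigsetI_measurable => j _; rewrite -[X in measurable X]setTI.
  rewrite (_ : [set _ | _] = (fun s : E => (s : V) 0 j) @^-1` [set 0])//.
  exact: measurable_coord.
rewrite -bigcap_seq; apply/seteqP; split=> [s -> j _ /=|s s0].
  by rewrite mxE.
by apply/rowP => j; rewrite mxE; apply: s0; rewrite /= mem_enum.
Qed.

(** Replacing s by its lattice corner gives functions that are measurable cell by cell; continuity
    in s makes them converge pointwise. The indicator cuts [h] off outside the orthant, where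
    nothing is known about it. *)
Lemma measurable_caratheodory d (Y : measurableType d) (h : V -> Y -> R) :
  (forall s, orthant s -> measurable_fun setT (h s)) ->
  (forall y, {within orthant, continuous (h ^~ y)}) ->
  measurable_fun [set: E * Y]
    (fun z : E * Y => h z.1 z.2 * \1_orthant (z.1 : V)).
Proof.
move=> mh ch.
pose a n (z : E * Y) := h (of_grid n (grid n z.1)) z.2 * \1_orthant (z.1 : V).
apply: (@measurable_fun_cvg _ _ _ _ a) => [n|z _]; last first.
  rewrite /a indicE; have [|_] := boolP (_ \in orthant); last first.
    by rewrite !mulr0; under eq_fun do rewrite mulr0; exact: cvg_cst.
  rewrite inE => z0; rewrite mulr1; under eq_fun do rewrite mulr1.
  apply/cvgrPdist_lt => e e0.
  have /within_continuousP/(_ _ z0 _ e0)[dd dd0 ddP] := ch z.2.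
  near=> n; apply: ddP; first exact: of_grid_orthant.
  by near: n; exact: of_grid_near.
move=> _ B mB; rewrite setTI.
have mfst j : measurable_fun setT (fun z : E * Y => (z.1 : V) 0 j).
  exact: (measurableT_comp (measurable_coord j) measurable_fst).
have -> : a n @^-1` B = (\bigcup_(m in [set m | orthant (of_grid n m)])
    ([set z : E * Y | grid n z.1 = m] `&` (orthant `*` setT) `&`
     (setT `*` (h (of_grid n m) @^-1` B)))) `|`
   ((~` orthant `*` setT) `&` (fun=> 0 : R) @^-1` B).
  apply/seteqP; split => [[s y]|[s y]]; rewrite /a /=.
    rewrite indicE; have [|] := boolP (_ \in orthant); rewrite ?notin_setE ?inE.
      rewrite mulr1 => s0 Bs; left; exists (grid n s) => //=.
      exact: of_grid_orthant.
    by rewrite mulr0; right; split.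
  rewrite indicE => -[[m /= m0 [[<- [s0 _]] [_ Bs]]]|[[s0 _] B0]].
    by rewrite mem_set// mulr1.
  by rewrite memNset// mulr0.
apply: measurableU.
  rewrite bigcup_mkcond; apply: countable_bigcupT_measurable => // m.
  case: ifPn => // /set_mem /= om.
  apply: measurableI; [apply: measurableI|]; first exact: measurable_grid.
    by apply: measurableX => //; exact: measurable_orthant.
  by apply: measurableX => //; rewrite -[X in measurable X]setTI; exact: mh.
apply: measurableI.
  by apply: measurableX => //; apply: measurableC; exact: measurable_orthant.
by rewrite -[X in measurable X]setTI; exact: measurable_cst.
Unshelve. all: by end_near. Qed.

End row_vectors.

(** * Bounded integrands: Fubini, laws of random vectors, independent pairs *)

Section bounded_integrals.
Context {R : realType}.

Lemma integrable_bounded d (T : measurableType d)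
    (mu : {measure set T -> \bar R}) (D : set T) (f : T -> R) (C : R) :
  measurable D -> (mu D < +oo)%E -> measurable_fun D f ->
  (forall x, D x -> `|f x| <= C) -> mu.-integrable D (EFin \o f).
Proof.
move=> mD muD mf fC; apply: measurable_bounded_integrable => //.
by exists C; split; [exact: num_real|move=> e Ce x Dx /=; apply: le_trans (fC _ Dx) (ltW Ce)].
Qed.

Lemma probability_lty d (T : measurableType d) (P : probability T R) D :
  measurable D -> (P D < +oo)%E.
Proof. by move=> mD; apply: le_lt_trans (ltry 1); exact: probability_le1. Qed.

Lemma integrable_prob d (T : measurableType d) (P : probability T R)
    (D : set T) (f : T -> R) (C : R) :
  measurable D -> measurable_fun D f ->
  (forall x, D x -> `|f x| <= C) -> P.-integrable D (EFin \o f).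
Proof. by move=> mD; apply: integrable_bounded => //; exact: probability_lty. Qed.

Lemma Rintegral_fin d (T : measurableType d) (mu : {measure set T -> \bar R})
    (D : set T) (f : T -> R) : measurable D -> mu.-integrable D (EFin \o f) ->
  (\int[mu]_(x in D) f x)%:E = (\int[mu]_(x in D) (f x)%:E)%E.
Proof. by move=> mD fi; rewrite fineK//; exact: integrable_fin_num. Qed.

Lemma Rintegral_norm_le d (T : measurableType d)
    (mu : {measure set T -> \bar R}) (D : set T) (f g : T -> R) :
  measurable D -> measurable_fun D f -> mu.-integrable D (EFin \o g) ->
  (forall x, D x -> `|f x| <= g x) ->
  mu.-integrable D (EFin \o f) /\
  `|\int[mu]_(x in D) f x| <= \int[mu]_(x in D) g x.
Proof.
move=> mD mf gi fg.
have fi : mu.-integrable D (EFin \o f).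
  apply: le_integrable gi => //; first exact/measurable_EFinP.
  move=> x Dx /=; rewrite lee_fin (le_trans (fg x Dx))//; exact: ler_norm.
split => //; apply: (le_trans (le_normr_Rintegral mD fi)).
by apply: le_Rintegral => //; exact: integrable_norm.
Qed.

Lemma Rintegral_prob_le d (T : measurableType d) (P : probability T R)
    (D : set T) (f : T -> R) (C : R) : 0 <= C ->
  measurable D -> measurable_fun D f ->
  (forall x, D x -> `|f x| <= C) -> `|\int[P]_(x in D) f x| <= C.
Proof.
move=> C0 mD mf fC; have Ci : P.-integrable D (EFin \o cst C).
  by apply: (@integrable_prob _ _ _ _ _ C) => // x _; rewrite ger0_norm.
have [_ /le_trans->//] := Rintegral_norm_le mD mf Ci fC.
rewrite Rintegral_cst// -[leRHS]mulr1 ler_wpM2l//.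
by rewrite -lee_fin fineK ?probability_le1// fin_num_measure.
Qed.

Lemma Rintegral_sum d (T : measurableType d) (mu : {measure set T -> \bar R})
    (D : set T) (I : Type) (r : seq I) (f : I -> T -> R) : measurable D ->
  (forall i, mu.-integrable D (EFin \o f i)) ->
  mu.-integrable D (EFin \o (fun x => \sum_(i <- r) f i x)) /\
  \int[mu]_(x in D) (\sum_(i <- r) f i x) =
    \sum_(i <- r) \int[mu]_(x in D) f i x.
Proof.
move=> mD fi; elim: r => [|i r [ihi ih]].
  split; last by under eq_Rintegral do rewrite big_nil; rewrite big_nil Rintegral_cst// mul0r.
  rewrite (_ : _ \o _ = cst 0%E); first exact: integrable0.
  by apply/funext => x /=; rewrite big_nil.
split.
  rewrite (_ : _ \o _ = (fun x => (EFin \o f i) x + (EFin \o (fun x => \sum_(i <- r) f i x)%R) x)%E); first exact: integrableD.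
  by apply/funext => x /=; rewrite big_cons.
by under eq_Rintegral do rewrite big_cons; rewrite big_cons RintegralD// ih.
Qed.

(** Tonelli gives measurability for nonnegative integrands; adding the bound [C] makes [F]
    nonnegative and, under a probability, shifts the integral by exactly [C]. *)
Lemma measurable_Rintegral_fst d1 d2 (T1 : measurableType d1)
    (T2 : measurableType d2) (m : probability T1 R) (F : T1 * T2 -> R) (C : R) :
  measurable_fun setT F -> (forall z, `|F z| <= C) ->
  measurable_fun setT (fun y => \int[m]_x F (x, y)).
Proof.
move=> mF FC; pose G z := (F z + C)%:E.
have mG : measurable_fun setT (fubini_G m G).
  apply: measurable_fun_fubini_tonelli_G.
    by apply/measurable_EFinP; apply: measurable_funD.
  by move=> z; rewrite lee_fin -lerBlDr sub0r; have := FC z; rewrite ler_norml => /andP[].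
have GE y : fubini_G m G y = (\int[m]_x F (x, y) + C)%:E.
  have Fi : m.-integrable setT (EFin \o (fun x => F (x, y))).
    by apply: (@integrable_prob _ _ _ _ _ C) => //; exact: measurableT_comp.
  have Ci : m.-integrable setT (EFin \o cst C).
    by apply: (@integrable_prob _ _ _ _ _ `|C|).
  rewrite /fubini_G /G -[X in (_ + X)%:E](_ : \int[m]_x (cst C) x = C).
    rewrite -RintegralD// Rintegral_fin//.
    exact: (integrableD _ Fi Ci).
  rewrite Rintegral_cst//; transitivity (C * fine 1%E); last by rewrite mulr1.
  congr (_ * fine _).
  exact: probability_setT.
rewrite (_ : (fun _ => _) = (fun y => fine (fubini_G m G y) - C)).
  apply: measurable_funB => //.
  by apply: (measurableT_comp _ mG); exact: fine_measurable.
by apply/funext => y; rewrite GE /= addrK.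
Qed.

Section fubini.
Context d1 d2 (T1 : measurableType d1) (T2 : measurableType d2).
Variables (m1 : probability T1 R) (m2 : probability T2 R).
Variables (F : T1 * T2 -> R) (C : R).
Hypothesis mF : measurable_fun setT F.
Hypothesis FC : forall z, `|F z| <= C.

Let intF : (m1 \x m2)%E.-integrable setT (EFin \o F).
Proof.
apply: (integrable_bounded (C := C)) => //.
have := product_measure1E m1 m2 (@measurableT _ T1) (@measurableT _ T2).
by rewrite setXTT => /= ->; rewrite !probability_setT mule1 ltry.
Qed.

Let mF1 x : measurable_fun setT (fun y => F (x, y)).
Proof. exact: measurableT_comp. Qed.

Let mF2 y : measurable_fun setT (fun x => F (x, y)).
Proof. exact: measurableT_comp. Qed.

Let F1E : EFin \o (fun x => \int[m2]_y F (x, y)) = fubini_F m2 (EFin \o F).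
Proof.
apply/funext => x /=; rewrite Rintegral_fin//.
by apply: (@integrable_prob _ _ _ _ _ C).
Qed.

Let F2E : EFin \o (fun y => \int[m1]_x F (x, y)) = fubini_G m1 (EFin \o F).
Proof.
apply/funext => y /=; rewrite Rintegral_fin//.
by apply: (@integrable_prob _ _ _ _ _ C).
Qed.

Lemma Rintegral12_prod :
  \int[m1]_x \int[m2]_y F (x, y) = \int[(m1 \x m2)%E]_z F z.
Proof.
rewrite /Rintegral -integral12_prod_meas1//; congr fine.
apply: eq_integral => x _.
by rewrite -[LHS]/((EFin \o (fun x => \int[m2]_y F (x, y))) x) F1E.
Qed.

Lemma Rintegral21_prod :
  \int[m2]_y \int[m1]_x F (x, y) = \int[(m1 \x m2)%E]_z F z.
Proof.
rewrite /Rintegral -integral21_prod_meas1//; congr fine.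
apply: eq_integral => x _.
by rewrite -[LHS]/((EFin \o (fun y => \int[m1]_x F (x, y))) x) F2E.
Qed.

End fubini.

Lemma Rintegral_indic d (T : measurableType d) (mu : {measure set T -> \bar R})
    (D : set T) (f : T -> R) :
  \int[mu]_x (f x * \1_D x) = \int[mu]_(x in D) f x.
Proof.
rewrite [RHS]Rintegral_mkcond; apply: eq_Rintegral => x _.
by rewrite patchE indicE; case: ifP => _; rewrite ?mulr1 ?mulr0.
Qed.

Context {k : nat}.
Local Notation V := 'rV[R]_k.
Local Notation E := (borel_rV R k).

Section orthant_fubini.
Context d (Y : measurableType d) (m : probability E R) (h : V -> Y -> R) (C : R).
Hypothesis hm : forall s, orthant s -> measurable_fun setT (h s).
Hypothesis hc : forall y, {within orthant, continuous (h ^~ y)}.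
Hypothesis hC : forall s y, orthant s -> `|h s y| <= C.

Let F (z : E * Y) := h z.1 z.2 * \1_orthant (z.1 : V).

Let mF : measurable_fun setT F.
Proof. exact: measurable_caratheodory. Qed.

Let FC z : `|F z| <= `|C|.
Proof.
rewrite /F indicE; have [/set_mem z0|_] := boolP (_ \in orthant).
  by rewrite mulr1 (le_trans (hC _ z0))// ler_norm.
by rewrite mulr0 normr0.
Qed.

Lemma measurable_orthant_integral :
  measurable_fun setT (fun y => \int[m]_(s in orthant) h s y).
Proof.
rewrite (_ : (fun _ => _) = (fun y => \int[m]_s F (s, y))).
  exact: (measurable_Rintegral_fst m mF FC).
by apply/funext => y; rewrite -Rintegral_indic.
Qed.

Lemma orthant_fubini (P : probability Y R) :
  \int[P]_y \int[m]_(s in orthant) h s y =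
  \int[m]_(s in orthant) \int[P]_y h s y.
Proof.
under eq_Rintegral do rewrite -Rintegral_indic.
rewrite -[RHS]Rintegral_indic (Rintegral21_prod m P mF FC).
rewrite -(Rintegral12_prod m P mF FC); apply: eq_Rintegral => s _.
rewrite /F/= indicE; have [/set_mem s0|_] := boolP (_ \in orthant).
  by under eq_Rintegral do rewrite mulr1; rewrite mulr1.
by under eq_Rintegral do rewrite mulr0; rewrite mulr0 Rintegral_cst// mul0r.
Qed.

End orthant_fubini.

Lemma measurable_within_continuous (g : V -> R) :
  {within orthant, continuous g} ->
  measurable_fun setT (fun s : E => g s * \1_orthant (s : V)).
Proof.
move=> cg.
have mF : measurable_fun [set: E * E]
    (fun z : E * E => g z.1 * \1_orthant (z.1 : V)).
  exact: (@measurable_caratheodory _ _ _ E (fun s _ => g s)).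
by apply: (measurableT_comp mF (g := fun s : E => (s, s))); exact: measurable_fun_pair.
Qed.

Lemma measurable_orthant_continuous (g : V -> R) :
  {within orthant, continuous g} -> measurable_fun (orthant : set E) (g : E -> R).
Proof.
move=> cg; have /(@measurable_funTS _ _ _ _ (orthant : set E)) :=
  @measurable_within_continuous g cg.
apply: eq_measurable_fun => s /set_mem s0.
by rewrite indicE mem_set// mulr1.
Qed.

Lemma Rintegral_law d (Omega : measurableType d) (Q : probability Omega R)
    (m : probability E R) (Z : Omega -> V) (g : V -> R) (C : R) :
  measurable_fun setT (Z : Omega -> E) ->
  (forall U : set E, measurable U -> m U = Q (Z @^-1` U)) ->
  {within orthant, continuous g} -> (forall s, orthant s -> `|g s| <= C) ->
  \int[m]_(s in orthant) g s = \int[Q]_(w in Z @^-1` orthant) g (Z w).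
Proof.
move=> mZ law cg gC; pose G (s : E) := g s * \1_orthant (s : V).
have mG : measurable_fun setT G by exact: measurable_within_continuous.
have GC s : `|G s| <= `|C|.
  rewrite /G indicE; have [/set_mem s0|_] := boolP ((s : V) \in orthant).
    by rewrite mulr1 (le_trans (gC _ s0))// ler_norm.
  by rewrite mulr0 normr0.
rewrite -[LHS]Rintegral_indic -[RHS]Rintegral_indic.
transitivity (\int[Q]_w G (Z w)); last by [].
have Gi : Q.-integrable setT (EFin \o G \o Z).
  apply: (@integrable_prob _ _ _ _ (G \o Z) `|C|) => //.
    exact: measurableT_comp.
  by move=> w _; exact: GC.
rewrite /Rintegral; congr fine.
have := @integral_pushforward _ _ _ _ R (Z : Omega -> E) mZ Q setT (EFin \o G).
rewrite preimage_setT => <- //; last exact/measurable_EFinP.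
by apply: eq_measure_integral => U mU _; exact: law.
Qed.

(** The paths of the subordinator increase only almost surely, so integrals are first taken over the
    event that an increment lies in the orthant. This lemma changes one such event of full measure
    into another. *)
Lemma Rintegral_ae_sub d (Omega : measurableType d) (Q : probability Omega R)
    (D D' : set Omega) (g : Omega -> R) :
  measurable D -> measurable D' -> measurable_fun D' g -> D `<=` D' ->
  {ae Q, forall w, D w} ->
  \int[Q]_(w in D) g w = \int[Q]_(w in D') g w.
Proof.
move=> mD mD' mg DD' aD.
rewrite -(setIidr DD') Rintegral_mkcondr; congr fine.
apply: ae_eq_integral => //.
- apply/measurable_EFinP; apply/(measurable_restrict _ mD mD').
  by apply: measurable_funS mg => //; exact: subIsetl.
- exact/measurable_EFinP.
- by apply: filterS aD => w Dw _; rewrite patchE mem_set.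
Qed.

Section independent_pair.
Context d (Omega : measurableType d) (P : probability Omega R) (A B : Omega -> V).
Variables (m1 m2 : probability E R) (phi : V -> V -> R) (C : R).
Hypothesis mA : measurable_fun setT (A : Omega -> E).
Hypothesis mB : measurable_fun setT (B : Omega -> E).
Hypothesis AB : forall U W : set E, measurable U -> measurable W ->
  P ((A @^-1` U) `&` (B @^-1` W)) = (m1 U * m2 W)%E.
Hypothesis phi1 : forall r, orthant r -> {within orthant, continuous (phi ^~ r)}.
Hypothesis phi2 : forall s, orthant s -> {within orthant, continuous (phi s)}.
Hypothesis phiC : forall s r, orthant s -> orthant r -> `|phi s r| <= C.

(** The law of the pair agrees with the product measure on rectangles, hence everywhere. Separate
    continuity of [phi] gives joint measurability by [measurable_caratheodory]. *)
Lemma Rintegral_independent :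
  \int[P]_(w in (A @^-1` orthant) `&` (B @^-1` orthant)) phi (A w) (B w) =
  \int[m1]_(s in orthant) \int[m2]_(r in orthant) phi s r.
Proof.
pose h s r := phi s r * \1_orthant r.
pose F (z : E * E) := h z.1 z.2 * \1_orthant (z.1 : V).
have mF : measurable_fun setT F.
  apply: measurable_caratheodory => [s s0|r].
    by apply: measurable_within_continuous; exact: phi2.
  have [r0|r0] := pselect (orthant (r : V)).
    rewrite (_ : h ^~ r = phi ^~ r); first exact: phi1.
    by apply/funext => s; rewrite /h indicE mem_set// mulr1.
  rewrite (_ : h ^~ r = cst 0).
    by apply: continuous_subspaceT => s; exact: cst_continuous.
  by apply/funext => s; rewrite /h indicE memNset// mulr0.
have FC z : `|F z| <= `|C|.
  rewrite /F /h !indicE; have [/set_mem z0|_] := boolP (z.1 \in orthant); last first.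
    by rewrite mulr0 normr0.
  have [/set_mem z1|_] := boolP (z.2 \in orthant); last by rewrite mulr0 mul0r normr0.
  by rewrite !mulr1 (le_trans (phiC _ _))// ler_norm.
transitivity (\int[(m1 \x m2)%E]_z F z).
  pose AB_ (w : Omega) : E * E := (A w, B w).
  have mAB : measurable_fun setT AB_ by exact: measurable_fun_pair.
  transitivity (\int[P]_w F (AB_ w)).
    rewrite -[LHS]Rintegral_indic; apply: eq_Rintegral => w _.
    rewrite /F /h /= !indicE in_setI.
    rewrite -[w \in A @^-1` _]/(A w \in orthant) -[w \in B @^-1` _]/(B w \in orthant).
    by case: (A w \in orthant); case: (B w \in orthant); rewrite ?mulr0 ?mulr1 ?mul0r.
  have FiE : P.-integrable setT (EFin \o F \o AB_).
    apply: (@integrable_prob _ _ _ _ (F \o AB_) `|C|) => //.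
      exact: measurableT_comp.
    by move=> w _; exact: FC.
  rewrite /Rintegral; congr fine.
  have := @integral_pushforward _ _ _ _ R AB_ mAB P setT (EFin \o F).
  rewrite preimage_setT => <- //; last exact/measurable_EFinP.
  apply: eq_measure_integral => X mX _.
  by apply/esym; exact: (@product_measure_unique _ _ _ _ _ m1 m2 (pushforward P AB_)).
rewrite -(Rintegral12_prod m1 m2 mF FC) -[RHS]Rintegral_indic.
apply: eq_Rintegral => s _; rewrite -[X in X * _]Rintegral_indic /F /h/= !indicE.
have [_|_] := boolP (s \in orthant).
  by rewrite mulr1; apply: eq_Rintegral => r _; rewrite mulr1.
by under eq_Rintegral do rewrite mulr0; rewrite mulr0 Rintegral_cst// mul0r.
Qed.

End independent_pair.

End bounded_integrals.

(** * Bounded Borel functions and the semigroup *)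

Section bounded_functions.
Context {R : realType} {d : nat}.
Local Notation V := 'rV[R]_d.
Local Notation E := (borel_rV R d).
Implicit Types f g : V -> R.

Lemma norm_cvgP (I : Type) (H : set_system I) (FH : Filter H) (u : I -> V -> R) g :
  norm_cvg (u @ H) g <->
  forall e, 0 < e -> \forall i \near H, forall x, `|g x - u i x| <= e.
Proof.
split => [cu e e0|cu].
  have /cu : nbhs (g : {uniform V -> R}) [set h | forall x, `|g x - h x| <= e].
    apply/uniform_nbhs; exists [set xy | `|xy.1 - xy.2| < e]; split.
      exact: entourage_ball (PosNum e0).
    by move=> h gh x; apply: ltW; exact: gh.
  by [].
move=> A /uniform_nbhs[B [entB BA]].
have [e e0 eB] : exists2 e, 0 < e & forall x y : R, `|x - y| <= e -> B (x, y).
  move: entB; rewrite -entourage_ballE => -[e /= e0 eB]; exists (e / 2); first by rewrite divr_gt0.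
  move=> x y xy; apply: (eB (x, y)); rewrite /= /ball/=; apply: (le_lt_trans xy); lra.
rewrite nbhs_filterE; apply: filterS (cu e e0) => i gi; apply: BA => x _.
exact: eB.
Qed.

Lemma Bb_bound f : Bb f -> exists2 C, 0 <= C & forall x, `|f x| <= C.
Proof.
move=> [_ [M [_ fM]]]; exists (`|M| + 1); first by rewrite addr_ge0.
by move=> x; apply: (fM (`|M| + 1)) => //; rewrite (le_lt_trans (ler_norm M))// ltrDl.
Qed.

Lemma BbP f C : measurable_fun setT (f : E -> R) -> (forall x, `|f x| <= C) -> Bb f.
Proof.
move=> mf fC; split => //; exists C; split; first exact: num_real.
by move=> e Ce x _; apply: le_trans (fC x) (ltW Ce).
Qed.

Lemma supnorm_ge f : Bb f -> forall x, `|f x| <= supnorm f.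
Proof.
move=> /Bb_bound[C _ fC] x; apply: ub_le_sup; last by exists x.
by exists C => _ [y _ <-].
Qed.

Lemma supnorm_ge0 f : Bb f -> 0 <= supnorm f.
Proof. by move=> bf; apply: le_trans (supnorm_ge bf 0). Qed.

Lemma supnorm_le f C : (forall x, `|f x| <= C) -> supnorm f <= C.
Proof.
move=> fC; apply: ge_sup; first by exists `|f 0|; exists 0.
by move=> _ [x _ <-].
Qed.

Lemma Bb_lin (a : R) f g : Bb f -> Bb g -> Bb (fun x => a * f x + g x).
Proof.
move=> bf bg; have [C C0 fC] := Bb_bound bf; have [C' C'0 gC'] := Bb_bound bg.
apply: (@BbP _ (`|a| * C + C')).
  apply: measurable_funD; last exact: bg.1.
  by apply: measurable_funM => //; exact: bf.1.
by move=> x; apply: (le_trans (ler_normD _ _)); rewrite lerD// normrM ler_wpM2l.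
Qed.

Lemma Bb_cst (a : R) : Bb (fun _ : V => a).
Proof. by apply: (@BbP _ `|a|). Qed.

Lemma Bb_scale (a : R) f : Bb f -> Bb (fun x => a * f x).
Proof.
move=> bf; have := Bb_lin a bf (Bb_cst 0); congr Bb.
by apply/funext => x; rewrite addr0.
Qed.

Lemma BbB f g : Bb f -> Bb g -> Bb (fun x => f x - g x).
Proof.
move=> bf bg; have := Bb_lin (-1) bg bf; congr Bb.
by apply/funext => x; rewrite mulN1r addrC.
Qed.

(** Measurability survives limits of sequences only, hence the sequence [h] running along the
    filter. *)
Lemma norm_cvg_Bb (I : Type) (H : set_system I) (FH : ProperFilter H)
    (u : I -> V -> R) g (h : nat -> I) :
  (forall n, Bb (u (h n))) -> (h @ \oo --> H) -> norm_cvg (u @ H) g -> Bb g.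
Proof.
move=> bu hH /norm_cvgP cu.
have mg : measurable_fun setT (g : E -> R).
  apply: (@measurable_fun_cvg _ E R setT (fun n => (u (h n) : E -> R)) g) => [n|x _].
    exact: (bu n).1.
  apply/cvgrPdist_le => e e0; near=> n; have hP : forall x, `|g x - u (h n) x| <= e.
    by near: n; exact: (hH _ (cu e e0)).
  exact: hP.
have [n _ /(_ n (leqnn _)) gn] := hH _ (cu 1 ltr01).
have [C _ uC] := Bb_bound (bu n).
apply: (@BbP _ (1 + C)) => // x; rewrite -[g x](subrK (u (h n) x)).
by rewrite (le_trans (ler_normD _ _))// lerD.
Unshelve. all: by end_near. Qed.

Lemma norm_cvg_unique (I : Type) (H : set_system I) (FH : ProperFilter H)
    (u : I -> V -> R) g g' : norm_cvg (u @ H) g -> norm_cvg (u @ H) g' -> g = g'.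
Proof.
move=> /norm_cvgP cg /norm_cvgP cg'; apply/funext => x.
have H1 : u i x @[i --> H] --> g x.
  apply/cvgrPdist_le => e e0; near=> i; have hP : forall x, `|g x - u i x| <= e.
    by near: i; exact: cg.
  exact: hP.
have H2 : u i x @[i --> H] --> g' x.
  apply/cvgrPdist_le => e e0; near=> i; have hP : forall x, `|g' x - u i x| <= e.
    by near: i; exact: cg'.
  exact: hP.
exact: (cvg_unique _ H1 H2).
Unshelve. all: by end_near. Qed.

Lemma generatorE (A : R -> (V -> R) -> (V -> R)) f g :
  is_generator A f g -> generator A f = g.
Proof.
move=> fg; rewrite /generator; case: xgetP => [g' -> [_ _ fg']|/(_ g)//].
by case: fg => _ _ fg; exact: (norm_cvg_unique _ fg' fg).
Qed.

Lemma gen_domainP (A : R -> (V -> R) -> (V -> R)) f :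
  gen_domain A f -> is_generator A f (generator A f).
Proof. by move=> [g fg]; rewrite (generatorE fg). Qed.

End bounded_functions.

(** * Contraction, uniform continuity, mixtures and first-order expansion of the semigroup *)

Section markov_semigroup.
Context {R : realType} {d k : nat}.
Context {dO : measure_display} {Omega : measurableType dO}.
Local Notation V := 'rV[R]_d.
Local Notation E := (borel_rV R d).
Local Notation W := 'rV[R]_k.
Local Notation EW := (borel_rV R k).
Variables (T : W -> (V -> R) -> (V -> R)) (P : V -> probability Omega R).
Variable (X : W -> Omega -> V).
Hypothesis X_meas : forall s, orthant s -> measurable_fun setT (X s : Omega -> E).
Hypothesis T_sc : sc_semigroup T.
Hypothesis T_assoc : associated_semigroup P X T.

Lemma T_Bb s f : orthant s -> Bb f -> Bb (T s f).
Proof. by move=> s0 bf; have [/(_ s s0)[Tb _ _] _ _ _] := T_sc; exact: Tb. Qed.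

Lemma T_lin s a f g : orthant s -> Bb f -> Bb g ->
  T s (fun x => a * f x + g x) = (fun x => a * T s f x + T s g x).
Proof. by move=> s0 bf; have [/(_ s s0)[_ Tl _] _ _ _] := T_sc; exact: Tl. Qed.

Lemma TB s f g : orthant s -> Bb f -> Bb g ->
  T s (fun x => f x - g x) = (fun x => T s f x - T s g x).
Proof.
move=> s0 bf bg; have := T_lin (-1) s0 bg bf.
rewrite (_ : (fun x => -1 * g x + f x) = (fun x => f x - g x)).
  by move=> ->; apply/funext => x; rewrite mulN1r addrC.
by apply/funext => x; rewrite mulN1r addrC.
Qed.

(** Boundedness of [T s] only provides some constant; the constant 1 comes from writing [T s f x] as
    an expectation. *)
Lemma T_le s f C : orthant s -> 0 <= C -> Bb f -> (forall x, `|f x| <= C) ->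
  forall x, `|T s f x| <= C.
Proof.
move=> s0 C0 bf fC x; rewrite T_assoc//; apply: Rintegral_prob_le => //.
by apply: (measurableT_comp (f := (f : E -> R))); [exact: bf.1|exact: X_meas].
Qed.

Lemma T_near0 f e : Bb f -> 0 < e -> exists2 dl, 0 < dl &
  forall s, orthant s -> (forall j, s 0 j < dl) -> forall x, `|T s f x - f x| <= e.
Proof.
move=> bf e0; have [_ _ _ /(_ f bf)/norm_cvgP/(_ e e0)] := T_sc.
rewrite near_withinE => /nbhs_ballP[dl /= dl0 dlP]; exists dl => // s s0 sdl x.
rewrite distrC; apply: dlP => //; apply: ball_rV => // j.
by rewrite mxE sub0r normrN ger0_norm ?sdl//; exact: orthant_ge0.
Qed.

Lemma vmin_orthant (s t : W) : orthant s -> orthant t -> orthant (vmin s t).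
Proof. by move=> s0 t0 j; rewrite !mxE le_min !orthant_ge0. Qed.

(** Two points of the orthant need not be comparable, so both are compared with v = [vmin s t]: T_s
    f - T_v f = T_v (T_{s-v} f - f), which is small by contraction and strong continuity at 0. *)
Lemma T_unif f e : Bb f -> 0 < e -> exists2 dl, 0 < dl &
  forall s t, orthant s -> orthant t -> (forall j, `|s 0 j - t 0 j| < dl) ->
  forall x, `|T s f x - T t f x| <= e.
Proof.
move=> bf e0; have e20 : 0 < e / 2 by rewrite divr_gt0.
have [dl dl0 dlP] := T_near0 bf e20; exists dl => // s t s0 t0 st x.
have key (u v : W) : orthant u -> orthant v -> (forall j, `|u 0 j - v 0 j| < dl) ->
    `|T u f x - T (vmin u v) f x| <= e / 2.
  move=> u0 v0 uv; have m0 := vmin_orthant u0 v0.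
  have w0 : orthant (u - vmin u v).
    by move=> j; rewrite !mxE subr_ge0 ge_min lexx.
  have [_ _ TD _] := T_sc.
  have {1}-> : u = vmin u v + (u - vmin u v) by rewrite addrC subrK.
  rewrite TD// -[X in `|X|]/((fun x => _ - _) x) -TB//; last exact: T_Bb.
  apply: T_le => //; first exact: ltW.
    by apply: BbB => //; exact: T_Bb.
  apply: dlP => // j; rewrite !mxE; have := uv j.
  rewrite /Num.min; case: ifP => _; rewrite ?subrr// => h.
  by apply: le_lt_trans h; exact: ler_norm.
have h1 := key s t s0 t0 st.
have h2 : `|T t f x - T (vmin t s) f x| <= e / 2.
  by apply: key => // j; rewrite distrC.
have vC : vmin t s = vmin s t by apply/rowP => j; rewrite !mxE minC.
rewrite vC in h2; move: h1 h2; rewrite !ler_norml; lra.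
Qed.

Lemma T_cont f x : Bb f -> {within orthant, continuous (fun s => T s f x)}.
Proof.
move=> bf; apply/within_continuousP => s s0 e e0.
have e20 : 0 < e / 2 by rewrite divr_gt0.
have [dl dl0 dlP] := T_unif bf e20; exists dl => // t t0 st.
by apply: le_lt_trans (dlP s t s0 t0 st x) _; lra.
Qed.

Lemma T_cont_shift f x r : Bb f -> orthant r ->
  {within orthant, continuous (fun s => T (s + r) f x)}.
Proof.
move=> bf r0; apply/within_continuousP => s s0 e e0.
have e20 : 0 < e / 2 by rewrite divr_gt0.
have [dl dl0 dlP] := T_unif bf e20; exists dl => // t t0 st.
have h : `|T (s + r) f x - T (t + r) f x| <= e / 2.
  apply: dlP; rewrite ?orthantD//; try exact: orthantD.
  by move=> j; rewrite !mxE opprD addrACA subrr addr0.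
by apply: le_lt_trans h _; lra.
Qed.

(** [evolution T pi t1 t2] is convertible to [average] at the law [pi t1 t2]. *)
Definition average (m : probability EW R) (f : V -> R) (x : V) : R :=
  \int[m]_(s in orthant) T s f x.

Lemma integrable_T (m : probability EW R) f x : Bb f ->
  m.-integrable orthant (EFin \o (fun s => T s f x)).
Proof.
move=> bf; have [C C0 fC] := Bb_bound bf.
apply: (@integrable_prob _ _ _ _ _ _ C); first exact: measurable_orthant.
  by apply: measurable_orthant_continuous; exact: T_cont.
by move=> s s0; exact: T_le.
Qed.

Lemma average_le m f C : 0 <= C -> Bb f -> (forall x, `|f x| <= C) ->
  forall x, `|average m f x| <= C.
Proof.
move=> C0 bf fC x; apply: Rintegral_prob_le => //; first exact: measurable_orthant.
  by apply: measurable_orthant_continuous; exact: T_cont.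
by move=> s s0; exact: T_le.
Qed.

Lemma average_Bb m f : Bb f -> Bb (average m f).
Proof.
move=> bf; have [C C0 fC] := Bb_bound bf.
apply: (BbP (C := C)); last exact: average_le.
apply: (@measurable_orthant_integral _ _ _ E m (fun s x => T s f x) C).
- by move=> s s0; exact: (T_Bb s0 bf).1.
- by move=> x; exact: T_cont.
- by move=> s x s0; exact: T_le.
Qed.

Lemma average_lin m a f g : Bb f -> Bb g ->
  average m (fun x => a * f x + g x) = (fun x => a * average m f x + average m g x).
Proof.
move=> bf bg; apply/funext => x; rewrite /average.
rewrite -RintegralZl; [|exact: measurable_orthant|exact: integrable_T].
rewrite -RintegralD; [|exact: measurable_orthant| |exact: integrable_T].
  by apply: eq_Rintegral => s /set_mem s0; rewrite T_lin.
rewrite (_ : _ \o _ = (fun s => a%:E * (EFin \o (fun s => T s f x)) s)%E)//.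
by apply: integrableZl; [exact: measurable_orthant|exact: integrable_T].
Qed.

Lemma averageB m f g : Bb f -> Bb g ->
  average m (fun x => f x - g x) = (fun x => average m f x - average m g x).
Proof.
move=> bf bg; have := average_lin m (-1) bg bf.
rewrite (_ : (fun x => -1 * g x + f x) = (fun x => f x - g x)).
  by move=> ->; apply/funext => x; rewrite mulN1r addrC.
by apply/funext => x; rewrite mulN1r addrC.
Qed.

Lemma average_bounded m : bounded_operator (average m).
Proof.
split; first exact: average_Bb.
  by move=> a f g bf bg; rewrite average_lin.
exists 1 => f bf; rewrite mul1r; apply: supnorm_le; apply: average_le => //.
  exact: supnorm_ge0.
exact: supnorm_ge.
Qed.

(** [T s] is integration against the law of [X s], so it passes under the integral over [m] by
    Fubini. *)
Lemma T_average m s f x : orthant s -> Bb f ->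
  T s (average m f) x = \int[m]_(r in orthant) T (s + r) f x.
Proof.
move=> s0 bf; have [C C0 fC] := Bb_bound bf.
rewrite T_assoc//; last exact: average_Bb.
rewrite /average (@orthant_fubini _ _ _ Omega m (fun r w => T r f (X s w)) C).
- apply: eq_Rintegral => r /set_mem r0.
  have [_ _ TD _] := T_sc; rewrite TD//.
  by rewrite [RHS]T_assoc//; exact: T_Bb.
- move=> r r0; apply: (measurableT_comp (f := (T r f : E -> R))).
    exact: (T_Bb r0 bf).1.
  exact: X_meas.
- by move=> w; exact: T_cont.
- by move=> r w r0; exact: T_le.
Qed.

Lemma T_add s t f : orthant s -> orthant t -> Bb f -> T (s + t) f = T s (T t f).
Proof. by move=> s0 t0 bf; have [_ _ TD _] := T_sc; exact: TD. Qed.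

(** By the semigroup law a composition of averages integrates T_{s+r} f over a product of laws, that
    is, over the law of a sum of independent vectors. *)
Lemma average_conv (m1 m2 m3 : probability EW R) (A B : Omega -> W)
    (Q : probability Omega R) f :
  measurable_fun setT (A : Omega -> EW) -> measurable_fun setT (B : Omega -> EW) ->
  (forall U U' : set EW, measurable U -> measurable U' ->
    Q ((A @^-1` U) `&` (B @^-1` U')) = (m1 U * m2 U')%E) ->
  {ae Q, forall w, orthant (A w)} -> {ae Q, forall w, orthant (B w)} ->
  (forall U : set EW, measurable U -> m3 U = Q [set w | U (A w + B w)]) ->
  Bb f -> average m1 (average m2 f) = average m3 f.
Proof.
move=> mA mB AB A0 B0 lawZ bf; have [C C0 fC] := Bb_bound bf.
have mZ : measurable_fun setT ((fun w => A w + B w) : Omega -> EW).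
  apply: measurable_rV => j.
  rewrite (_ : (fun _ => _) = (fun w => A w 0 j + B w 0 j)).
    by apply: measurable_funD; exact: (measurableT_comp (measurable_coord j)).
  by apply/funext => w; rewrite mxE.
have mDA : measurable (A @^-1` orthant).
  by rewrite -[X in measurable X]setTI; apply: mA => //; exact: measurable_orthant.
have mDB : measurable (B @^-1` orthant).
  by rewrite -[X in measurable X]setTI; apply: mB => //; exact: measurable_orthant.
apply/funext => x.
transitivity (\int[Q]_(w in A @^-1` orthant `&` B @^-1` orthant)
    T (A w + B w) f x).
  rewrite (@Rintegral_independent _ _ _ _ Q A B m1 m2 (fun s r => T (s + r) f x) C) //.
  - by apply: eq_Rintegral => s /set_mem s0; rewrite T_average.
  - by move=> r r0; exact: T_cont_shift.
  - move=> s s0; rewrite (_ : (fun _ => _) = (fun r => T (r + s) f x)).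
      exact: T_cont_shift.
    by apply/funext => r; rewrite addrC.
  - by move=> s r s0 r0; apply: T_le => //; exact: orthantD.
have {}A0 : {ae Q, forall w, (A @^-1` orthant `&` B @^-1` orthant) w}.
  by apply: filterS2 A0 B0 => w Aw Bw; split.
rewrite /average (Rintegral_law mZ lawZ (C := C)); last 2 first.
- exact: T_cont.
- by move=> s s0; exact: T_le.
apply: Rintegral_ae_sub => //.
- exact: measurableI.
- by rewrite -[X in measurable X]setTI; apply: mZ => //; exact: measurable_orthant.
- have mg : measurable_fun setT ((fun s : EW => T s f x * \1_orthant (s : W)) \o
      ((fun w => A w + B w) : Omega -> EW)).
    apply: measurableT_comp => //.
    by apply: measurable_within_continuous; exact: T_cont.
  move: mg => /(@measurable_funTS _ _ _ _ ((fun w => A w + B w) @^-1` orthant)).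
  apply: eq_measurable_fun => w /set_mem w0 /=.
  by rewrite indicE mem_set// mulr1.
- by move=> w [Aw Bw]; exact: orthantD.
Qed.

Lemma T_expand f (g : 'I_k -> V -> R) e :
  Bb f -> (forall j, is_generator (marginal T j) f (g j)) -> 0 < e ->
  exists2 dl, 0 < dl & forall s, orthant s -> (forall j, s 0 j < dl) ->
    forall x, `|T s f x - f x - \sum_j s 0 j * g j x| <= e * \sum_j s 0 j.
Proof.
move=> bf fg e0; have e20 : 0 < e / 2 by rewrite divr_gt0.
have bg j : Bb (g j) by case: (fg j).
have T0 h : Bb h -> T 0 h = h by have [_ + _ _] := T_sc; exact.
have near_gen j : \forall dl \near (0 : R)^'+,
    (forall u, 0 <= u -> u < dl ->
      forall x, `|T (u *: basis_vec j) f x - f x - u * g j x| <= e / 2 * u) /\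
    (forall s, orthant s -> (forall i, s 0 i < dl) ->
      forall x, `|T s (g j) x - g j x| <= e / 2).
  have [_ _ /norm_cvgP/(_ _ e20)] := fg j.
  rewrite near_withinE => /nbhs_ballP[d1 /= d10 d1P].
  have [d2 d20 d2P] := T_near0 (bg j) e20.
  near=> dl; split=> [u u0 udl x|s s0 sdl x]; last first.
    apply: d2P => // i; apply: lt_trans (sdl i) _.
    by near: dl; exact: nbhs_right_lt.
  (* The generator controls difference quotients for u > 0 only; at u = 0 both sides vanish. *)
  have [->|un0] := eqVneq u 0.
    by rewrite scale0r T0// mul0r !subr0 subrr normr0 mulr0.
  have {un0}u0 : 0 < u by rewrite lt_neqAle eq_sym un0.
  have := d1P u _ u0 x.
  rewrite /ball/= sub0r normrN gtr0_norm// /marginal => h.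
  have {}h := h (lt_trans udl _).
  have {}h : `|g j x - u^-1 * (T (u *: basis_vec j) f x - f x)| <= e / 2.
    by apply: h; near: dl; exact: nbhs_right_lt.
  set a := T _ f x - f x in h *.
  have -> : a - u * g j x = - (u * (g j x - u^-1 * a)) by field; rewrite gt_eqF.
  by rewrite normrN normrM gtr0_norm// [leRHS]mulrC ler_pM2l.
have [dl dl0 dlP] : exists2 dl, 0 < dl & forall j,
    (forall u, 0 <= u -> u < dl ->
      forall x, `|T (u *: basis_vec j) f x - f x - u * g j x| <= e / 2 * u) /\
    (forall s, orthant s -> (forall i, s 0 i < dl) ->
      forall x, `|T s (g j) x - g j x| <= e / 2).
  near (0 : R)^'+ => dl; exists dl => //.
  by near: dl; exact: filter_forall near_gen.
exists dl => // s s0 sdl x.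
(* Move from 0 to s one coordinate at a time. *)
pose p (i : nat) : W := \row_j (if (j < i)%N then s 0 j else 0).
have p0 i : orthant (p i).
  by move=> j; rewrite !mxE; case: ifP => // _; exact: orthant_ge0.
have pdl i j : p i 0 j < dl by rewrite mxE; case: ifP.
have pS (j : 'I_k) : p j.+1 = p j + s 0 j *: basis_vec j.
  apply/rowP => i; rewrite !mxE eqxx/= ltnS leq_eqVlt.
  case: eqVneq => [/val_inj ->|ij]; first by rewrite eqxx ltnn mulr1 add0r.
  by rewrite -val_eqE/= (negbTE ij) mulr0 addr0.
have pk : p k = s by apply/rowP => j; rewrite mxE ltn_ord.
have p00 : p 0%N = 0 by apply/rowP => j; rewrite !mxE.
have -> : T s f x - f x = \sum_(j < k) (T (p j.+1) f x - T (p j) f x).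
  rewrite -(big_mkord xpredT (fun j => T (p j.+1) f x - T (p j) f x)).
  rewrite telescope_sumr// pk p00; have [_ -> //] := T_sc.
rewrite -sumrB mulr_sumr; apply: (le_trans (ler_norm_sum _ _ _)).
apply: ler_sum => j _; have [H1 H2] := dlP j.
set u := s 0 j; have u0 : 0 <= u by exact: orthant_ge0.
have b0 : orthant (u *: basis_vec j).
  by move=> i; rewrite !mxE mulr_ge0// ler0n.
have bTf : Bb (T (u *: basis_vec j) f) by exact: T_Bb.
(* One summand is the error of the marginal generator, transported by the contraction [T (p j)]; the
   other is the continuity of the semigroup at 0 on [g j]. Each receives e / 2. *)
have -> : T (p j.+1) f x - T (p j) f x - u * g j x =
    T (p j) (fun x => (T (u *: basis_vec j) f x - f x) - u * g j x) x +
    u * (T (p j) (g j) x - g j x).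
  rewrite pS -/u T_add// TB//; [|exact: BbB|exact: Bb_scale].
  rewrite TB//.
  have -> : T (p j) (fun x => u * g j x) = (fun x => u * T (p j) (g j) x).
    have := T_lin u (p0 j) (bg j) (Bb_cst 0).
    rewrite (_ : (fun x => u * g j x + 0) = (fun x => u * g j x)).
      move=> ->; apply/funext => y; rewrite [X in _ + X](_ : _ = 0) ?addr0//.
      by apply/eqP; rewrite -normr_le0; apply: T_le => //; [exact: Bb_cst|by move=> z; rewrite normr0].
    by apply/funext => y; rewrite addr0.
  ring.
apply: (le_trans (ler_normD _ _)).
have h1 : `|T (p j) (fun x => (T (u *: basis_vec j) f x - f x) - u * g j x) x|
    <= e / 2 * u.
  apply: T_le => //; first by rewrite mulr_ge0// ltW.
    by apply: BbB; [exact: BbB|exact: Bb_scale].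
  by move=> y; apply: H1 => //; exact: sdl.
have h2 : `|u * (T (p j) (g j) x - g j x)| <= e / 2 * u.
  by rewrite normrM ger0_norm// mulrC ler_wpM2r// H2.
by apply: le_trans (lerD h1 h2) _; lra.
Unshelve. all: by end_near. Qed.

End markov_semigroup.

(** * Trigonometric approximation *)

Section trigonometry.
Context {R : realType}.
Implicit Types x y : R.

Lemma sin_lip x y : `|sin x - sin y| <= `|x - y|.
Proof.
wlog xy : x y / x <= y.
  by move=> h; have [/h//|/ltW/h] := leP x y; rewrite distrC [leRHS]distrC.
have [c _ e] : exists2 c, c \in `[x, y] & sin y - sin x = cos c * (y - x).
  apply: (@MVT_segment R sin cos) => //.
  by apply: continuous_subspaceT; exact: continuous_sin.
by rewrite distrC e distrC normrM ler_piMl// cos_max.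
Qed.

Lemma sin_le x : `|sin x| <= `|x|.
Proof. by have := sin_lip x 0; rewrite sin0 !subr0. Qed.

Lemma cos_lip x y : `|cos x - cos y| <= `|x - y|.
Proof.
have := sin_lip (x + pi / 2) (y + pi / 2); rewrite !sinDpihalf.
by rewrite opprD addrACA subrr addr0.
Qed.

Lemma subr1_cosE x : 1 - cos x = (sin (x / 2)) ^+ 2 *+ 2.
Proof.
have {1}-> : x = (x / 2) *+ 2 by rewrite -mulr_natr divfK.
by rewrite cos_mulr2n cos2sin2; ring.
Qed.

Lemma subr1_cos_ge0 x : 0 <= 1 - cos x.
Proof. by rewrite subr_ge0 cos_le1. Qed.

Lemma subr1_cos_le x : 1 - cos x <= x ^+ 2 / 2.
Proof.
rewrite subr1_cosE; have : sin (x / 2) ^+ 2 <= (x / 2) ^+ 2.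
  by rewrite -[leLHS]real_normK ?num_real// -[leRHS]real_normK ?num_real//
    lerXn2r ?nnegrE// sin_le.
by lra.
Qed.

Lemma sin_ge_half x : 0 <= x <= 1 -> x / 2 <= sin x.
Proof.
move=> /andP[x0 x1].
have [c cx e] : exists2 c, c \in `[0, x] & sin x - sin 0 = cos c * (x - 0).
  apply: (@MVT_segment R sin cos) => //.
  by apply: continuous_subspaceT; exact: continuous_sin.
rewrite sin0 !subr0 in e; rewrite e mulrC ler_wpM2r//.
move: cx; rewrite in_itv/= => /andP[c0 cx].
have := subr1_cos_le c; have : c ^+ 2 <= 1 by rewrite expr_le1// (le_trans cx).
lra.
Qed.

(** Quantitative injectivity of cos on [0, pi]: distant points have distant cosines. With a = cos x
    >= c = cos y, the claim amounts to (1 - a)(1 + c) <= sin x sin y. *)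
Lemma subr_cos_ge x y : 0 <= x <= pi -> 0 <= y <= pi ->
  1 - cos (x - y) <= `|cos x - cos y|.
Proof.
wlog xy : x y / cos y <= cos x.
  move=> h; have [/h//|/ltW/h] := leP (cos y) (cos x).
  by rewrite distrC -cosN opprB => h' ? ?; apply: h'.
move=> xp yp; rewrite ger0_norm ?subr_ge0// cosB.
have := sin_ge0_pi xp; have := sin_ge0_pi yp.
have := cos2Dsin2 x; have := cos2Dsin2 y; have := cos_le1 x; have := cos_geN1 y.
have := cos_geN1 x; have := xy.
set a := cos x; set b := sin x; set c := cos y; set e := sin y => *.
have [ac0|ac0] := leP 0 (1 + c); last lra.
suff : (1 - a) * (1 + c) <= b * e by lra.
(* The squared right side factors as (1 - a)(1 + c) times (1 + a)(1 - c), and c <= a makes the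
   second factor the larger one. *)
have : ((1 - a) * (1 + c)) ^+ 2 <= (b * e) ^+ 2.
  have -> : (b * e) ^+ 2 = ((1 - a) * (1 + c)) * ((1 + a) * (1 - c)).
    rewrite exprMn (_ : b ^+ 2 = (1 - a) * (1 + a)); last lra.
    rewrite (_ : e ^+ 2 = (1 - c) * (1 + c)); last lra.
    ring.
  rewrite expr2 ler_wpM2l//; first by rewrite mulr_ge0//; lra.
  lra.
by rewrite ler_pXn2r// nnegrE mulr_ge0//; lra.
Qed.

Lemma subr1_cos_mono x y : 0 <= x -> x <= y -> y <= pi -> 1 - cos x <= 1 - cos y.
Proof.
move=> x0 xy yp; rewrite lerD2l lerN2; move: xy; rewrite le_eqVlt.
move=> /orP[/eqP->//|xy]; apply/ltW; rewrite ltr_cos// in_itv/=.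
  by rewrite x0 (le_trans (ltW xy)).
by rewrite yp andbT (le_trans x0)// ltW.
Qed.

Lemma subr1_cos_gt0 x : 0 < x <= pi -> 0 < 1 - cos x.
Proof.
move=> /andP[x0 xp]; rewrite subr_gt0 -[ltRHS]cos0 ltr_cos ?in_itv/= ?lexx ?pi_ge0//.
by rewrite ltW.
Qed.

End trigonometry.

(** * Bernstein polynomials in one and several variables *)

Section bernstein.
Context {R : realType}.

(** The probability of i successes in n trials of parameter x, by conditioning on one trial. The
    recursion uses only sums and products, so [cos_poly_bern] follows by a plain induction. *)
Fixpoint bern (n i : nat) (x : R) : R :=
  if n is n'.+1 then
    (if i is i'.+1 then x * bern n' i' x else 0) + (1 - x) * bern n' i x
  else (i == 0%N)%:R.

Lemma bern_ge0 n i x : 0 <= x <= 1 -> 0 <= bern n i x.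
Proof.
move=> /andP[x0 x1]; elim: n i => [|n IH] i /=; first by rewrite ler0n.
apply: addr_ge0; last by rewrite mulr_ge0// subr_ge0.
by case: i => // i; rewrite mulr_ge0.
Qed.

Lemma bern_gt n i x : (n < i)%N -> bern n i x = 0.
Proof.
elim: n i => [|n IH] [|i]//= ni; first by rewrite IH// IH// ?mulr0 ?addr0// ltnW.
Qed.

Lemma bern_sumS n x (phi : nat -> R) :
  \sum_(i < n.+2) phi i * bern n.+1 i x =
  x * \sum_(i < n.+1) phi i.+1 * bern n i x +
  (1 - x) * \sum_(i < n.+1) phi i * bern n i x.
Proof.
under eq_bigr do rewrite /= mulrDr.
rewrite big_split; congr (_ + _).
  rewrite big_ord_recl /= mulr0 add0r mulr_sumr; apply: eq_bigr => i _.
  by rewrite mulrCA.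
rewrite big_ord_recr /= bern_gt// !mulr0 addr0 mulr_sumr.
by apply: eq_bigr => i _; rewrite mulrCA.
Qed.

Lemma bern_sum1 n x : \sum_(i < n.+1) bern n i x = 1.
Proof.
suff : \sum_(i < n.+1) 1 * bern n i x = 1 by under eq_bigr do rewrite mul1r.
elim: n => [|n IH]; first by rewrite big_ord1 /= mulr1.
by rewrite (bern_sumS _ _ (fun=> 1)) IH; ring.
Qed.

Lemma bern_var n x (c : R) :
  \sum_(i < n.+1) (i%:R - c) ^+ 2 * bern n i x =
  n%:R * x * (1 - x) + (n%:R * x - c) ^+ 2.
Proof.
elim: n c => [|n IH] c; first by rewrite big_ord1 /=; ring.
rewrite (bern_sumS n x (fun i => (i%:R - c) ^+ 2)) IH.
have E (z : R) : z + 1 - c = z - (c - 1) by ring.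
under eq_bigr do rewrite -natr1 E.
rewrite IH -natr1; ring.
Qed.

Section multivariate.
Context {k : nat}.
Local Notation W := 'rV[R]_k.

Definition mbern n (m : {ffun 'I_k -> 'I_n.+1}) (x : W) : R :=
  \prod_j bern n (m j) (x 0 j).

Lemma mbern_ge0 n m (x : W) : (forall j, 0 <= x 0 j <= 1) -> 0 <= @mbern n m x.
Proof. by move=> x01; apply: prodr_ge0 => j _; exact: bern_ge0. Qed.

Lemma mbern_sum1 n (x : W) : \sum_m @mbern n m x = 1.
Proof.
rewrite -(bigA_distr_bigA (fun j (i : 'I_n.+1) => bern n i (x 0 j))).
by apply: big1 => j _; exact: bern_sum1.
Qed.

Lemma mbern_var n (x : W) l :
  \sum_(m : {ffun 'I_k -> 'I_n.+2})
    ((m l)%:R / n.+1%:R - x 0 l) ^+ 2 * mbern m x =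
  x 0 l * (1 - x 0 l) / n.+1%:R.
Proof.
(* The quadratic factor sits in coordinate [l] only, so after distributing the product every other
   coordinate sums to 1. *)
pose F j (i : 'I_n.+2) := (if j == l then (i%:R / n.+1%:R - x 0 l) ^+ 2 else 1) *
  bern n.+1 i (x 0 j).
transitivity (\prod_j \sum_i F j i).
  rewrite bigA_distr_bigA; apply: eq_bigr => m _; rewrite /F big_split/=.
  by congr (_ * _); rewrite -big_mkcond/= big_pred1_eq.
rewrite (bigD1 l)//= [X in _ * X]big1 ?mulr1; last first.
  move=> j /negbTE jl; rewrite /F jl -[RHS](bern_sum1 n.+1 (x 0 j)).
  by apply: eq_bigr => i _; rewrite mul1r.
have n0 : n.+1%:R != 0 :> R by rewrite pnatr_eq0.
transitivity (n.+1%:R ^- 2 * \sum_(i < n.+2)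
    (i%:R - n.+1%:R * x 0 l) ^+ 2 * bern n.+1 i (x 0 l)).
  rewrite mulr_sumr; apply: eq_bigr => i _; rewrite /F eqxx mulrA; congr (_ * _).
  by field; rewrite addrC natr1.
rewrite bern_var subrr expr0n addr0.
by field; rewrite addrC natr1.
Qed.

(* The Bernstein operator is positive, so the bound passes to the average, where
   the quadratic term becomes a variance of order 1/n. *)
Lemma mbern_approx n (Phi : {ffun 'I_k -> 'I_n.+2} -> R) (x : W) v M e :
  (forall j, 0 <= x 0 j <= 1) -> 0 <= M ->
  (forall m, `|Phi m - v| <=
    e + M * \sum_j ((m j)%:R / n.+1%:R - x 0 j) ^+ 2) ->
  `|\sum_m Phi m * mbern m x - v| <= e + M * k%:R / n.+1%:R.
Proof.
move=> x01 M0 Phiv; rewrite -[v]mulr1 -(mbern_sum1 n.+1 x) mulr_sumr -sumrB.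
apply: (le_trans (ler_norm_sum _ _ _)).
apply: (@le_trans _ _ (\sum_(m : {ffun 'I_k -> 'I_n.+2}) (e + M * \sum_j ((m j)%:R / n.+1%:R - x 0 j) ^+ 2) *
    @mbern n.+1 m x)).
  apply: ler_sum => m _; rewrite -mulrBl normrM [X in _ * X]ger0_norm ?mbern_ge0//.
  by rewrite ler_wpM2r ?mbern_ge0.
under eq_bigr do rewrite mulrDl.
rewrite big_split/= -mulr_sumr mbern_sum1 mulr1 lerD2l.
under eq_bigr do rewrite -mulrA mulr_suml.
rewrite -mulr_sumr exchange_big/= -mulrA ler_wpM2l//.
rewrite (_ : k%:R / n.+1%:R = \sum_(j < k) n.+1%:R^-1 :> R); last first.
  by rewrite sumr_const card_ord mulr_natl.
apply: ler_sum => j _; rewrite mbern_var ler_piMl ?invr_ge0//.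
have /andP[a b] := x01 j; apply: mulr_ile1 => //; lra.
Qed.

End multivariate.

End bernstein.

Section more_trigonometry.
Context {R : realType}.

Lemma subr_sin_le (x : R) : 0 <= x -> `|x - sin x| <= x * (x ^+ 2 / 2).
Proof.
move=> x0.
have [c cx e] : exists2 c, c \in `[0, x] & sin x - sin 0 = cos c * (x - 0).
  apply: (@MVT_segment R sin cos) => //.
  by apply: continuous_subspaceT; exact: continuous_sin.
rewrite sin0 !subr0 in e; rewrite e mulrC -{1}[x]mulr1 -mulrBr normrM ger0_norm//.
rewrite ler_wpM2l// ger0_norm ?subr1_cos_ge0// (le_trans (subr1_cos_le _))//.
move: cx; rewrite in_itv/= => /andP[c0 cx].
by rewrite ler_wpM2r// lerXn2r ?nnegrE.
Qed.

(* Hence averaging 1 - cos over equidistant frequencies bounds the indicator of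
   large values from above: this replaces an integral over the frequency in the
   usual tightness criterion. *)
Lemma cos_average_le (n : nat) (a : R) : (0 < n)%N -> 4 / n%:R <= a <= 1 ->
  n%:R^-1 * \sum_(i < n) cos (i.+1%:R * a) <= 1 / 2.
Proof.
move=> n0 /andP[a4 a1]; have n0' : 0 < n%:R :> R by rewrite ltr0n.
have a0 : 0 < a by apply: lt_le_trans a4; rewrite divr_gt0.
have sa : a / 4 <= sin (a / 2).
  have -> : a / 4 = a / 2 / 2 by field.
  by apply: sin_ge_half; apply/andP; split; lra.
(* Multiplication by 2 sin(a/2) telescopes the sum. Since sin(a/2) >= a/4, the sum is at most 2/a,
   and the hypothesis a >= 4/n brings it below n/2. *)
have dirichlet m : 2 * sin (a / 2) * \sum_(i < m) cos (i.+1%:R * a) =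
    sin (m%:R * a + a / 2) - sin (a / 2).
  elim: m => [|m IH]; first by rewrite big_ord0 mul0r add0r subrr mulr0.
  rewrite big_ord_recr/= mulrDr IH.
  have -> : m%:R * a + a / 2 = m.+1%:R * a - a / 2 by rewrite -natr1; field.
  by rewrite sinB sinD; ring.
have s0 : 0 < sin (a / 2) by lra.
have h1 : 2 * sin (a / 2) * \sum_(i < n) cos (i.+1%:R * a) <= 1.
  by rewrite dirichlet; have := sin_le1 (n%:R * a + a / 2); lra.
rewrite ler_pdivrMl//.
have [S0|S0] := leP 0 (\sum_(i < n) cos (i.+1%:R * a)); last first.
  by apply: le_trans (ltW S0) _; rewrite mulr_ge0 ?ltW.
have h2 : 4 <= n%:R * a by rewrite mulrC -ler_pdivrMr.
set S := \sum_(i < n) _ in h1 S0 *.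
have h3 : a / 4 * S <= sin (a / 2) * S by rewrite ler_wpM2r.
have h4 : a * S <= 2 by lra.
have h5 : 4 * S <= n%:R * (a * S) by rewrite mulrA ler_wpM2r.
have h6 : n%:R * (a * S) <= n%:R * 2 by rewrite ler_wpM2l// ltW.
lra.
Qed.

End more_trigonometry.

(** * The algebra generated by the functions cos(xi.s) *)

Section cosine_polynomials.
Context {R : realType} {k : nat}.
Local Notation W := 'rV[R]_k.
Implicit Types (s xi : W) (p q : W -> R).

Lemma dotC s xi : dot s xi = dot xi s.
Proof. by apply: eq_bigr => j _; rewrite mulrC. Qed.

Lemma dotDl s t xi : dot (s + t) xi = dot s xi + dot t xi.
Proof. by rewrite -big_split; apply: eq_bigr => j _; rewrite mxE mulrDl. Qed.

Lemma dotNl s xi : dot (- s) xi = - dot s xi.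
Proof. by rewrite -sumrN; apply: eq_bigr => j _; rewrite mxE mulNr. Qed.

Lemma dot0l xi : dot 0 xi = 0.
Proof. by apply: big1 => j _; rewrite mxE mul0r. Qed.

Lemma dot_basis a j s : dot (a *: basis_vec j) s = a * s 0 j.
Proof.
rewrite /dot (bigD1 j)//= big1 ?addr0; first by rewrite !mxE !eqxx mulr1.
by move=> i ij; rewrite !mxE (negbTE ij) andbF mulr0 mul0r.
Qed.

(** The product-to-sum formula makes this class closed under products, so it contains the
    polynomials in the cos(eta s_j). Statements about integrals need only be checked on a single
    cosine and on sums. *)
Inductive cos_poly : (W -> R) -> Prop :=
| cos_poly_cos a xi : cos_poly (fun s => a * cos (dot xi s))
| cos_polyD p q : cos_poly p -> cos_poly q -> cos_poly (fun s => p s + q s).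

Lemma cos_poly_ext p q : p =1 q -> cos_poly p -> cos_poly q.
Proof. by move=> /funext ->. Qed.

Lemma cos_poly_cst a : cos_poly (fun=> a).
Proof.
apply: cos_poly_ext (cos_poly_cos a 0) => s.
by rewrite dot0l cos0 mulr1.
Qed.

Lemma cos_polyM p q : cos_poly p -> cos_poly q -> cos_poly (fun s => p s * q s).
Proof.
move=> cp cq; elim: cp => [a xi|p1 p2 _ H1 _ H2]; last first.
  by apply: cos_poly_ext (cos_polyD H1 H2) => s; rewrite mulrDl.
elim: cq => [b zeta|q1 q2 _ H1 _ H2]; last first.
  by apply: cos_poly_ext (cos_polyD H1 H2) => s; rewrite mulrDr.
apply: cos_poly_ext (cos_polyD (cos_poly_cos (a * b / 2) (xi + zeta))
  (cos_poly_cos (a * b / 2) (xi - zeta))) => s.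
by rewrite !dotDl dotNl cosB cosD; field.
Qed.

Lemma cos_poly_coord (a : R) j : cos_poly (fun s => cos (a * s 0 j)).
Proof.
by apply: cos_poly_ext (cos_poly_cos 1 (a *: basis_vec j)) => s;
  rewrite dot_basis mul1r.
Qed.

Lemma cos_poly_sum (I : Type) (r : seq I) (q : I -> W -> R) :
  (forall i, cos_poly (q i)) -> cos_poly (fun s => \sum_(i <- r) q i s).
Proof.
move=> cq; elim: r => [|i r IH].
  by apply: cos_poly_ext (cos_poly_cst 0) => s; rewrite big_nil.
by apply: cos_poly_ext (cos_polyD (cq i) IH) => s; rewrite big_cons.
Qed.

Lemma cos_poly_prod (I : Type) (r : seq I) (q : I -> W -> R) :
  (forall i, cos_poly (q i)) -> cos_poly (fun s => \prod_(i <- r) q i s).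
Proof.
move=> cq; elim: r => [|i r IH].
  by apply: cos_poly_ext (cos_poly_cst 1) => s; rewrite big_nil.
by apply: cos_poly_ext (cos_polyM (cq i) IH) => s; rewrite big_cons.
Qed.

Lemma cos_poly_bern n i p : cos_poly p -> cos_poly (fun s => bern n i (p s)).
Proof.
move=> cp; elim: n i => [|n IH] i /=; first exact: cos_poly_cst.
apply: cos_polyD; first by case: i => [|i]; [exact: cos_poly_cst|exact: cos_polyM].
apply: cos_polyM => //; apply: cos_polyD; first exact: cos_poly_cst.
by apply: cos_poly_ext (cos_polyM (cos_poly_cst (-1)) cp) => s; rewrite mulN1r.
Qed.

(** A coordinatewise substitute on the orthant for |s| /\ 1: the weight relative to which
    approximation errors are measured. *)
Definition csum s : R := \sum_j Num.min (s 0 j) 1.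

Lemma csum_ge0 s : orthant s -> 0 <= csum s.
Proof. by move=> s0; apply: sumr_ge0 => j _; rewrite le_min orthant_ge0/=. Qed.

Lemma csum_ge s j : orthant s -> Num.min (s 0 j) 1 <= csum s.
Proof.
move=> s0; rewrite /csum (bigD1 j)//= lerDl; apply: sumr_ge0 => i _.
by rewrite le_min orthant_ge0/=.
Qed.

End cosine_polynomials.

(** * Uniform approximation by cosine polynomials vanishing at 0 *)

Section trigonometric_approximation.
Context {R : realType} {k : nat} (I : Type).
Local Notation W := 'rV[R]_k.
Variables (r : I -> W -> R) (C K : R).
Hypothesis C0 : 0 <= C.
Hypothesis rC : forall i s, orthant s -> `|r i s| <= C.
Hypothesis r_unif : forall e, 0 < e -> exists2 dl, 0 < dl &
  forall i s t, orthant s -> orthant t -> (forall j, `|s 0 j - t 0 j| < dl) ->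
  `|r i s - r i t| <= e.
Hypothesis r_small : forall e, 0 < e -> exists2 dl, 0 < dl &
  forall i s, orthant s -> (forall j, s 0 j < dl) ->
  `|r i s| <= e * \sum_j s 0 j.
Hypothesis K_pi : pi <= K.

(** The frequency that maps [0, K] onto [0, pi], where cos is injective. *)
Let eta := pi / K.
Let box (s : W) := orthant s /\ forall j, s 0 j <= K.
Let w (s : W) := \sum_j (1 - cos (eta * s 0 j)).
Let x (s : W) : W := \row_j ((1 - cos (eta * s 0 j)) / 2).
(** The point of the box whose image under [x] is the Bernstein node with coordinates m_j /
    (n+1). *)
Let node n (m : {ffun 'I_k -> 'I_n.+2}) : W :=
  \row_j (acos (1 - 2 * ((m j)%:R / n.+1%:R)) / eta).
Let rho tau i (s : W) := r i s / (w s + tau).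

Let K_gt0 : 0 < K.
Proof. by apply: lt_le_trans K_pi; exact: pi_gt0. Qed.

Let eta_gt0 : 0 < eta.
Proof. by rewrite divr_gt0// pi_gt0. Qed.

Let eta_le1 : eta <= 1.
Proof. by rewrite ler_pdivrMr// mul1r. Qed.

Let etaK : eta * K = pi.
Proof. by rewrite divfK// gt_eqF. Qed.

Let w_ge0 s : 0 <= w s.
Proof. by apply: sumr_ge0 => j _; exact: subr1_cos_ge0. Qed.

Let w_ge (s : W) j : 1 - cos (eta * s 0 j) <= w s.
Proof.
rewrite /w (bigD1 j)//= lerDl; apply: sumr_ge0 => i _; exact: subr1_cos_ge0.
Qed.

Let w_le2k s : w s <= 2 * k%:R.
Proof.
rewrite (_ : 2 * k%:R = \sum_(j < k) 2); last by rewrite sumr_const card_ord mulr_natr.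
by apply: ler_sum => j _; have := cos_geN1 (eta * s 0 j); lra.
Qed.

Let w_le s : orthant s -> w s <= 2 * csum s.
Proof.
move=> s0; rewrite mulr_sumr; apply: ler_sum => j _.
have sj := orthant_ge0 j s0; rewrite /Num.min; case: ifP => _; last first.
  by have := cos_geN1 (eta * s 0 j); lra.
have := cos_lip 0 (eta * s 0 j); rewrite cos0 sub0r normrN.
rewrite ger0_norm ?subr1_cos_ge0// (ger0_norm (mulr_ge0 (ltW eta_gt0) sj)) => h.
apply: (le_trans h); rewrite ler_wpM2r// (le_trans eta_le1)//; lra.
Qed.

Let w_lip (s t : W) dl : (forall j, `|s 0 j - t 0 j| < dl) -> `|w s - w t| <= k%:R * dl.
Proof.
move=> st; rewrite -sumrB (le_trans (ler_norm_sum _ _ _))//.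
rewrite (_ : k%:R * dl = \sum_(j < k) dl); last by rewrite sumr_const card_ord mulr_natl.
apply: ler_sum => j _.
have -> : 1 - cos (eta * s 0 j) - (1 - cos (eta * t 0 j)) =
    cos (eta * t 0 j) - cos (eta * s 0 j) by ring.
rewrite distrC; apply: (le_trans (cos_lip _ _)).
rewrite -mulrBr normrM gtr0_norm//.
apply: (@le_trans _ _ (1 * `|s 0 j - t 0 j|)); last by rewrite mul1r ltW.
by rewrite ler_wpM2r.
Qed.

Let x01 s j : 0 <= x s 0 j <= 1.
Proof.
rewrite mxE; have := cos_geN1 (eta * s 0 j); have := cos_le1 (eta * s 0 j).
by move=> *; apply/andP; split; lra.
Qed.

Let node_arg n (m : {ffun 'I_k -> 'I_n.+2}) j :
  -1 <= (1 - 2 * ((m j)%:R / n.+1%:R) : R) <= 1.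
Proof.
have : (m j)%:R / n.+1%:R <= 1 :> R.
  by rewrite ler_pdivrMr ?ltr0n// mul1r ler_nat -ltnS ltn_ord.
have : 0 <= (m j)%:R / n.+1%:R :> R by rewrite divr_ge0.
set z := _ / _; by move=> *; apply/andP; split; lra.
Qed.

Let node_box n (m : {ffun 'I_k -> 'I_n.+2}) : box (node m).
Proof.
split=> j; rewrite !mxE.
  by apply: divr_ge0; [apply: acos_ge0; exact: node_arg|exact: ltW].
by rewrite ler_pdivrMr// [K * _]mulrC etaK acos_lepi// node_arg.
Qed.

Let x_node n (m : {ffun 'I_k -> 'I_n.+2}) j :
  x (node m) 0 j = (m j)%:R / n.+1%:R.
Proof.
rewrite !mxE [eta * _]mulrC divfK ?gt_eqF// acosK ?in_itv/= ?node_arg//.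
by field; rewrite addrC natr1 pnatr_eq0.
Qed.

Let box_pi (s : W) j : box s -> 0 <= eta * s 0 j <= pi.
Proof.
move=> [s0 sK]; rewrite (mulr_ge0 (ltW eta_gt0) (orthant_ge0 j s0))/=.
by rewrite -etaK ler_wpM2l// ltW.
Qed.

Let rho_bound tau i s : 0 < tau -> orthant s -> `|rho tau i s| <= C / tau.
Proof.
move=> t0 s0; rewrite normrM normfV ler_pM ?invr_ge0//; first exact: rC.
have h : tau <= w s + tau by rewrite lerDr.
by rewrite lef_pV2 ?posrE ?normr_gt0 ?ger0_norm ?gt_eqF// ?(lt_le_trans t0 h)// ltW// (lt_le_trans t0 h).
Qed.

Let rho_unif tau e : 0 < tau -> 0 < e -> exists2 dl, 0 < dl &
  forall i s t, orthant s -> orthant t -> (forall j, `|s 0 j - t 0 j| < dl) ->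
  `|rho tau i s - rho tau i t| <= e.
Proof.
move=> t0 e0; have et0 : 0 < e * tau / 2 by rewrite divr_gt0// mulr_gt0.
have [d1 d10 d1P] := r_unif et0.
(* Changing the denominator costs at most C k d2 / tau^2, which this choice brings below e / 2; the
   added ones avoid dividing by 0. *)
pose d2 := e * tau ^+ 2 / 2 / ((C + 1) * (k%:R + 1)).
have C1 : 0 < C + 1 by rewrite ltr_wpDl.
have k1 : 0 < k%:R + 1 :> R by rewrite ltr_wpDl.
have d20 : 0 < d2 by rewrite !divr_gt0// ?mulr_gt0// exprn_gt0.
exists (Num.min d1 d2); first by rewrite lt_min d10.
move=> i s t s0 t0' st.
have h1 : `|r i s - r i t| <= e * tau / 2.
  by apply: d1P => // j; have := st j; rewrite lt_min => /andP[].
have h2 : `|w s - w t| <= k%:R * d2.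
  by apply: w_lip => j; have := st j; rewrite lt_min => /andP[].
have ws0 := w_ge0 s; have wt0 := w_ge0 t.
have a0 : 0 < w s + tau by rewrite ltr_wpDl.
have b0 : 0 < w t + tau by rewrite ltr_wpDl.
have -> : rho tau i s - rho tau i t = (r i s - r i t) / (w s + tau) +
    r i t * (w t - w s) / ((w s + tau) * (w t + tau)).
  by rewrite /rho; field; rewrite !gt_eqF.
apply: (le_trans (ler_normD _ _)).
have -> : e = e * tau / 2 / tau + e * tau ^+ 2 / 2 / (tau * tau).
  by field; rewrite gt_eqF.
apply: lerD.
  rewrite normrM normfV (gtr0_norm a0) ler_pM ?invr_ge0 ?(ltW a0)//.
  by rewrite lef_pV2 ?posrE// lerDr.
rewrite normrM normfV (gtr0_norm (mulr_gt0 a0 b0)) ler_pM ?invr_ge0 ?(ltW (mulr_gt0 a0 b0))//.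
- rewrite normrM distrC.
  apply: (@le_trans _ _ ((C + 1) * (k%:R * d2))).
    by rewrite ler_pM// (le_trans (rC _ _))// lerDl.
  rewrite /d2 -[leRHS](mulfK (lt0r_neq0 (mulr_gt0 C1 k1))) mulrA.
  rewrite [leLHS](_ : _ = e * tau ^+ 2 / 2 / ((C + 1) * (k%:R + 1)) * ((C + 1) * k%:R)); last by ring.
  rewrite [leRHS](_ : _ = e * tau ^+ 2 / 2 / ((C + 1) * (k%:R + 1)) * ((C + 1) * (k%:R + 1))); last by ring.
  by rewrite ler_wpM2l ?(ltW d20)// ler_wpM2l ?(ltW C1)// lerDl.
- rewrite lef_pV2 ?posrE ?mulr_gt0//.
  by rewrite ler_pM ?(ltW t0)// lerDr.
Qed.

(** A Chebyshev argument. Nodes near s cost e / 2 by uniform continuity. For any other node some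
    coordinate of [x] moves by at least [kap], by [subr_cos_ge], and [M] is chosen so that M kap^2
    equals the trivial bound 2 C / tau. All constants are independent of i. *)
Let bernstein_rho tau e : 0 < tau -> 0 < e -> exists n, forall i s, box s ->
  `|\sum_(m : {ffun 'I_k -> 'I_n.+2}) rho tau i (node m) * mbern m (x s) -
    rho tau i s| <= e.
Proof.
move=> t0 e0; have e20 : 0 < e / 2 by rewrite divr_gt0.
have [d1 d10 d1P] := rho_unif t0 e20.
(* The cap at K keeps eta * dl in [0, pi], where 1 - cos is increasing. *)
pose dl := Num.min d1 K; have dl0 : 0 < dl by rewrite lt_min d10.
pose kap := (1 - cos (eta * dl)) / 2.
have etadl : eta * dl <= pi by rewrite -etaK ler_wpM2l ?(ltW eta_gt0)// ge_min lexx orbT.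
have kap0 : 0 < kap by rewrite divr_gt0// subr1_cos_gt0// mulr_gt0.
pose M := 2 * (C / tau) / kap ^+ 2.
have M0 : 0 <= M.
  by rewrite !mulr_ge0// ?invr_ge0// ?sqr_ge0// ltW.
have Mk0 : 0 <= M * k%:R by rewrite mulr_ge0.
have MK1 : 0 < e / 2 / (M * k%:R + 1) by rewrite divr_gt0// ltr_wpDl.
have [n _ /(_ n (leqnn n))/= nP] := near_infty_natSinv_lt (PosNum MK1).
exists n => i s bs.
have -> : e = e / 2 + e / 2 by lra.
apply: le_trans (mbern_approx (e := e / 2) (M := M) (x01 s) M0 _) _ => [m|].
  have [near_|/existsNP[j /negP]] :=
      pselect (forall j, `|node m 0 j - s 0 j| < dl).
    apply: ler_wpDr; last first.
      apply: d1P; [exact: (node_box m).1|exact: bs.1|].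
      by move=> j; apply: lt_le_trans (near_ j) _; rewrite ge_min lexx.
    by rewrite mulr_ge0//; apply: sumr_ge0 => j _; exact: sqr_ge0.
  rewrite -leNgt => far; apply: ler_wpDl; first exact: ltW.
  apply: (@le_trans _ _ (M * kap ^+ 2)).
    rewrite divfK ?sqrf_eq0 ?gt_eqF//.
    apply: (le_trans (ler_normB _ _)).
    have := rho_bound i t0 (node_box m).1; have := rho_bound i t0 bs.1; lra.
  rewrite ler_wpM2l// (bigD1 j)//=; apply: ler_wpDr.
    by apply: sumr_ge0 => l _; exact: sqr_ge0.
  rewrite -x_node -[leRHS]real_normK ?num_real// lerXn2r ?nnegrE ?(ltW kap0)//.
  have -> : x (node m) 0 j - x s 0 j =
      (cos (eta * s 0 j) - cos (eta * node m 0 j)) / 2.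
    by rewrite [x _ 0 j]mxE [x s 0 j]mxE; ring.
  rewrite normrM distrC (ger0_norm (_ : 0 <= 2^-1))// ler_wpM2r//.
  apply: le_trans (subr_cos_ge (box_pi j (node_box m)) (box_pi j bs)).
  rewrite -mulrBr -[cos (_ * (_ - _))]cos_norm.
  apply: subr1_cos_mono; first by rewrite mulr_ge0// ltW.
    by rewrite normrM (gtr0_norm eta_gt0) ler_wpM2l// ltW.
  have /andP[a1 a2] := box_pi j (node_box m); have /andP[b1 b2] := box_pi j bs.
  by rewrite mulrBr ler_norml; apply/andP; split; lra.
rewrite lerD2l; apply: (@le_trans _ _ (M * k%:R * (e / 2 / (M * k%:R + 1)))).
  by rewrite ler_wpM2l// ltW.
rewrite mulrCA ler_piMr ?(ltW e20)// ler_pdivrMr ?ltr_wpDl//.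
by rewrite mul1r lerDl.
Qed.

(** The cost of regularising. Near 0 the factor tau / (w + tau) is at most 1 and r is already small
    relative to [csum]; elsewhere in the box w >= kap and csum >= dl, so a small tau suffices. *)
Let small_tau e : 0 < e -> exists2 tau, 0 < tau & forall i s, box s ->
  `|r i s * (tau / (w s + tau))| <= e * csum s.
Proof.
move=> e0; have [d1 d10 d1P] := r_small e0.
pose dl := Num.min d1 1; have dl0 : 0 < dl by rewrite lt_min d10/=.
pose kap := 1 - cos (eta * dl).
have dl1 : dl <= 1 by rewrite ge_min lexx orbT.
have pi1 : 1 <= pi :> R by have := @pi_ge2 R; lra.
have etadl1 : eta * dl <= 1.
  by rewrite mulr_ile1// ltW.
have etadl : eta * dl <= pi by apply: le_trans pi1.
have kap0 : 0 < kap by rewrite subr1_cos_gt0// mulr_gt0.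
have C1 : 0 < C + 1 by rewrite ltr_wpDl.
pose tau := e * kap * dl / (C + 1).
have t0 : 0 < tau by rewrite divr_gt0// !mulr_gt0.
exists tau => // i s bs.
have wt0 : 0 < w s + tau by rewrite ltr_wpDl.
have q0 : 0 <= tau / (w s + tau) by rewrite divr_ge0// ltW.
rewrite normrM [X in _ * X]ger0_norm//.
have [near_|/existsNP[j /negP]] := pselect (forall j, s 0 j < dl).
  apply: (@le_trans _ _ (`|r i s| * 1)).
    by rewrite ler_wpM2l// ler_pdivrMr// mul1r lerDr.
  rewrite mulr1 (le_trans (d1P i s bs.1 _))//.
    by move=> j; apply: lt_le_trans (near_ j) _; rewrite ge_min lexx.
  rewrite ler_wpM2l ?(ltW e0)//; apply: ler_sum => j _.
  by rewrite le_min lexx /= ltW// (lt_le_trans (near_ j)).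
rewrite -leNgt => far.
have wk : kap <= w s.
  apply: le_trans (w_ge s j); apply: subr1_cos_mono.
  - by rewrite mulr_ge0// ltW.
  - by rewrite ler_wpM2l// ltW.
  - by have /andP[] := box_pi j bs.
have cs : dl <= csum s.
  by apply: le_trans (csum_ge j bs.1); rewrite le_min far.
apply: (@le_trans _ _ (C * (tau / kap))).
  rewrite ler_pM//; first exact: rC bs.1.
  rewrite ler_wpM2l ?(ltW t0)// lef_pV2 ?posrE//.
  by rewrite (le_trans wk)// lerDl ltW.
apply: (@le_trans _ _ (e * dl)); last by rewrite ler_wpM2l// ltW.
rewrite /tau (_ : C * _ = e * dl * (C / (C + 1))); last by field; rewrite !gt_eqF.
by rewrite ler_piMr ?mulr_ge0 ?(ltW e0) ?(ltW dl0)// ler_pdivrMr// mul1r lerDl.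
Qed.

(* The variables x_j = (1 - cos (eta s_j)) / 2 are coordinates on the box [0, K]^k.
   Writing r = w * (r / w), with r / w regularised to r / (w + tau), and replacing
   the second factor by its Bernstein polynomial in x yields trigonometric
   polynomials that vanish at 0. Outside the box they take the values that they
   take at the reflected point of the box. *)
Lemma trigonometric_approximation e : 0 < e ->
  exists (J : finType) (q : J -> W -> R) (a : I -> J -> R) (M : R),
  [/\ forall i j, `|a i j| <= M,
      forall j, cos_poly (q j) /\ q j 0 = 0,
      forall i s, orthant s -> (forall j, s 0 j <= K) ->
        `|r i s - \sum_j a i j * q j s| <= e * csum s &
      forall i s, orthant s -> `|r i s - \sum_j a i j * q j s| <= 2 * C + 1].
Proof.
move=> e0; have e20 : 0 < e / 2 by rewrite divr_gt0.
have [tau t0 tauP] := small_tau e20.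
(* The first entry with w <= 2 csum makes the Bernstein error at most (e / 2) csum. The second with
   w <= 2 k makes it at most 1, which is the 1 in the global bound 2 C + 1. *)
pose e1 := Num.min (e / 4) (2 * k%:R + 1)^-1.
have e10 : 0 < e1 by rewrite lt_min divr_gt0//= invr_gt0 ltr_wpDl.
have [n nP] := bernstein_rho t0 e10.
pose q (m : {ffun 'I_k -> 'I_n.+2}) s := w s * mbern m (x s).
pose a i (m : {ffun 'I_k -> 'I_n.+2}) := rho tau i (node m).
have sumE i s : \sum_m a i m * q m s =
    w s * \sum_(m : {ffun 'I_k -> 'I_n.+2}) rho tau i (node m) * mbern m (x s).
  by rewrite mulr_sumr; apply: eq_bigr => m _; rewrite /a /q mulrCA.
have err i s : box s -> `|\sum_m a i m * q m s - r i s * (w s / (w s + tau))| <=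
    w s * e1.
  move=> bs; rewrite sumE (_ : r i s * _ = w s * rho tau i s); last first.
    by rewrite /rho mulrCA.
  by rewrite -mulrBr normrM ger0_norm// ler_wpM2l// nP.
exists {ffun 'I_k -> 'I_n.+2}, q, a, (C / tau); split.
- by move=> i m; apply: rho_bound => //; exact: (node_box m).1.
- move=> m; have w0 : w 0 = 0.
    by apply: big1 => j _; rewrite mxE mulr0 cos0 subrr.
  split; last by rewrite /q w0 mul0r.
  have cw j : cos_poly (fun s : W => 1 - cos (eta * s 0 j)).
    apply: cos_polyD; first exact: cos_poly_cst.
    apply: cos_poly_ext (cos_polyM (cos_poly_cst (-1)) (cos_poly_coord eta j)) => s.
    by rewrite mulN1r.
  apply: cos_polyM; first by apply: cos_poly_sum => j; exact: cw.
  apply: cos_poly_prod => j; apply: cos_poly_bern.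
  apply: cos_poly_ext (cos_polyM (cw j) (cos_poly_cst 2^-1)) => s.
  by rewrite mxE.
- move=> i s s0 sK; have bs : box s by [].
  have h1 := err i s bs; have h2 := tauP i s bs.
  have wt : w s + tau != 0 by rewrite gt_eqF// ltr_wpDl.
  have -> : r i s - \sum_m a i m * q m s = r i s * (tau / (w s + tau)) -
      (\sum_m a i m * q m s - r i s * (w s / (w s + tau))).
    by field.
  apply: (le_trans (ler_normB _ _)).
  have h3 : w s * e1 <= e / 2 * csum s.
    apply: (@le_trans _ _ (2 * csum s * (e / 4))); last by lra.
    by rewrite ler_pM// ?(ltW e10)// ?w_le// ge_min lexx.
  by apply: le_trans (lerD h2 (le_trans h1 h3)) _; lra.
- move=> i s s0; pose s' : W := \row_j (acos (cos (eta * s 0 j)) / eta).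
  have ca j : -1 <= cos (eta * s 0 j) <= 1 by rewrite cos_geN1 cos_le1.
  have cs' j : cos (eta * s' 0 j) = cos (eta * s 0 j).
    by rewrite mxE [eta * _]mulrC divfK ?gt_eqF// acosK// in_itv/= ca.
  have bs' : box s'.
    split=> j; rewrite !mxE; first by rewrite divr_ge0 ?acos_ge0// ltW.
    by rewrite ler_pdivrMr// [K * _]mulrC etaK acos_lepi.
  have ws : w s = w s' by rewrite /w; apply: eq_bigr => j _; rewrite cs'.
  have xs : x s = x s' by apply/rowP => j; rewrite !(mxE,cs').
  have -> : \sum_m a i m * q m s = \sum_m a i m * q m s'.
    by apply: eq_bigr => m _; rewrite /q ws xs.
  have wt0 : 0 < w s' + tau by rewrite ltr_wpDl.
  have h1 := err i s' bs'.
  have h2 : `|r i s' * (w s' / (w s' + tau))| <= C.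
    rewrite normrM -[leRHS]mulr1 ler_pM ?rC//; first exact: bs'.1.
    by rewrite ger0_norm ?divr_ge0 ?(ltW wt0)// ler_pdivrMr// mul1r lerDl ltW.
  have h3 : w s' * e1 <= 1.
    apply: (@le_trans _ _ (2 * k%:R * (2 * k%:R + 1)^-1)).
      by rewrite ler_pM ?(ltW e10)// ge_min lexx orbT.
    by rewrite ler_pdivrMr ?mul1r ?lerDl// ltr_wpDl// mulr_ge0.
  have h4 := rC i s0.
  move: h1 h2 h4; rewrite !ler_norml => /andP[? ?] /andP[? ?] /andP[? ?].
  by apply/andP; split; lra.
Qed.

End trigonometric_approximation.

(** * Limits of integrals as h tends to 0 *)

Section measurability.
Context {R : realType} {k : nat}.
Local Notation W := 'rV[R]_k.
Local Notation E := (borel_rV R k).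

Lemma measurable_dot (xi : W) : measurable_fun setT (fun s : E => dot xi (s : W)).
Proof.
apply: measurable_sum => j; apply: measurable_funM => //; exact: measurable_coord.
Qed.

Lemma measurable_sin_dot (xi : W) :
  measurable_fun setT (fun s : E => sin (dot xi (s : W))).
Proof.
apply: (measurableT_comp _ (measurable_dot xi)).
exact: (continuous_measurable_fun (@continuous_sin R)).
Qed.

Lemma measurable_cos_dot (xi : W) :
  measurable_fun setT (fun s : E => cos (dot xi (s : W))).
Proof.
apply: (measurableT_comp _ (measurable_dot xi)).
exact: (continuous_measurable_fun (@continuous_cos R)).
Qed.

Lemma measurable_csum : measurable_fun setT (csum : E -> R).
Proof.
apply: measurable_sum => j; apply: measurable_minr => //; exact: measurable_coord.
Qed.

Lemma measurable_cos_poly (q : W -> R) : cos_poly q -> measurable_fun setT (q : E -> R).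
Proof.
elim=> [a xi|p1 p2 _ H1 _ H2]; last exact: measurable_funD.
by apply: measurable_funM => //; exact: measurable_cos_dot.
Qed.

(** If all coordinates are at most 1 then [csum] is their sum and controls |xi.s|; otherwise [csum]
    is at least 1 and controls the constant 2. *)
Lemma dot_csum (xi s : W) : orthant s ->
  Num.min `|dot xi s| 2 <= (\sum_j `|xi 0 j| + 2) * csum s.
Proof.
move=> s0; have X0 : 0 <= \sum_j `|xi 0 j| by apply: sumr_ge0.
have c0 := csum_ge0 s0.
have [s1|/existsNP[j /negP]] := pselect (forall j, s 0 j <= 1).
  rewrite ge_min; apply/orP; left; apply: (le_trans (ler_norm_sum _ _ _)).
  apply: (@le_trans _ _ ((\sum_j `|xi 0 j|) * csum s)); last first.
    by rewrite ler_wpM2r// lerDl.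
  rewrite mulr_suml; apply: ler_sum => j _; rewrite normrM ler_wpM2l//.
  rewrite ger0_norm ?orthant_ge0//; apply: le_trans (csum_ge j s0).
  by rewrite le_min lexx s1.
rewrite -ltNge => sj; rewrite ge_min; apply/orP; right.
have c1 : 1 <= csum s by apply: le_trans (csum_ge j s0); rewrite le_min lexx ltW.
nra.
Qed.

Lemma sin_dot_csum (xi s : W) : orthant s ->
  `|sin (dot xi s)| <= (\sum_j `|xi 0 j| + 2) * csum s.
Proof.
move=> s0; apply: le_trans (dot_csum xi s0); rewrite le_min sin_le/=.
by rewrite (le_trans (sin_max _))// ler1n.
Qed.

Lemma cos_dot_csum (xi s : W) : orthant s ->
  `|cos (dot xi s) - 1| <= (\sum_j `|xi 0 j| + 2) * csum s.
Proof.
move=> s0; apply: le_trans (dot_csum xi s0); rewrite le_min.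
have := cos_lip (dot xi s) 0; rewrite cos0 subr0 => ->/=.
rewrite (le_trans (ler_normB _ _))// normr1.
by have := cos_max (dot xi s); lra.
Qed.

Lemma cos_poly_csum (q : W -> R) : cos_poly q ->
  exists C, forall s, orthant s -> `|q s - q 0| <= C * csum s.
Proof.
elim=> [a xi|p1 p2 _ [C1 H1] _ [C2 H2]].
  exists (`|a| * (\sum_j `|xi 0 j| + 2)) => s s0.
  rewrite (dotC xi 0) dot0l cos0 -mulrBr normrM -mulrA ler_wpM2l//.
  exact: cos_dot_csum.
exists (C1 + C2) => s s0; rewrite mulrDl opprD addrACA.
by rewrite (le_trans (ler_normD _ _))// lerD ?H1 ?H2.
Qed.

End measurability.

Section dominated_integrals.
Context {R : realType} {k : nat}.
Local Notation W := 'rV[R]_k.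
Local Notation E := (borel_rV R k).
Variables (m : {measure set E -> \bar R}) (D : set E).
Hypothesis mD : measurable D.
Hypothesis Dorthant : D `<=` (orthant : set W).
Hypothesis icsum : m.-integrable D (EFin \o csum).

Lemma integrable_csum (phi : W -> R) (C : R) :
  measurable_fun D (phi : E -> R) ->
  (forall s, D s -> `|phi s| <= C * csum s) -> m.-integrable D (EFin \o phi).
Proof.
move=> mphi phiC.
have iC : m.-integrable D (EFin \o (fun s : E => C * csum (s : W))).
  rewrite (_ : _ \o _ = (fun s => C%:E * (EFin \o csum) s)%E)//.
  exact: integrableZl.
by have [] := Rintegral_norm_le mD mphi iC phiC.
Qed.

Let isub1cos (xi : R) j :
  m.-integrable D (EFin \o (fun s : E => 1 - cos (xi * (s : W) 0 j))).
Proof.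
apply: (@integrable_csum (fun s => 1 - cos (xi * (s : W) 0 j))
    (\sum_i `|(xi *: basis_vec j : W) 0 i| + 2)).
  apply: measurable_funTS; apply: measurable_funB => //.
  rewrite (_ : (fun _ => _) = (fun s : E => cos (dot (xi *: basis_vec j) (s : W)))).
    exact: measurable_cos_dot.
  by apply/funext => s; rewrite dot_basis.
by move=> s /Dorthant s0; rewrite distrC -dot_basis; exact: cos_dot_csum.
Qed.

(** On [A n] the number a = u s_j / (n+1) lies in [4/(n+1), 1], so by [cos_average_le] twice the
    average of 1 - cos(xi s_j) over the n+1 frequencies xi = (i+1) u / (n+1), all at most u, is at
    least 1. As n grows, [A n] exhausts the tail. *)
Lemma tail_le (j : 'I_k) (u e : R) : 0 < u ->
  (forall xi, 0 <= xi <= u -> \int[m]_(s in D) (1 - cos (xi * (s : W) 0 j)) <= e) ->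
  (m (D `&` [set s : E | (4 / u <= (s : W) 0 j)%R]) <= (2 * e)%:E)%E.
Proof.
move=> u0 He.
have mset a b : measurable (D `&` [set s : E | a <= (s : W) 0 j <= b]).
  apply: measurableI => //; rewrite -[X in measurable X]setTI.
  rewrite (_ : [set _ | _] = (fun s : E => (s : W) 0 j) @^-1` `[a, b]).
    exact: measurable_coord.
  by apply/seteqP; split => s /=; rewrite in_itv/=.
pose A n := D `&` [set s : E | 4 / u <= (s : W) 0 j <= n.+1%:R / u].
have An n : (m (A n) <= (2 * e)%:E)%E.
  pose phi (s : E) := 2 * (n.+1%:R^-1 * \sum_(i < n.+1)
    (1 - cos (i.+1%:R * (u / n.+1%:R) * (s : W) 0 j))).
  have n0 : 0 < n.+1%:R :> R by rewrite ltr0n.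
  have phi0 s : 0 <= phi s.
    by rewrite !mulr_ge0// sumr_ge0// => i _; exact: subr1_cos_ge0.
  have [isum sumE] := @Rintegral_sum R _ _ m D _ (index_enum 'I_n.+1)
    (fun i s => 1 - cos (i.+1%:R * (u / n.+1%:R) * (s : W) 0 j)) mD
    (fun i => isub1cos _ j).
  have iphi' : m.-integrable D (EFin \o (fun s : E => n.+1%:R^-1 * \sum_(i < n.+1)
      (1 - cos (i.+1%:R * (u / n.+1%:R) * (s : W) 0 j)))).
    exact: (integrableZl mD n.+1%:R^-1 isum).
  have iphi : m.-integrable D (EFin \o phi).
    exact: (integrableZl mD 2 iphi').
  have miphi : measurable_fun D (EFin \o phi) by have /integrableP[] := iphi.
  have phiE : \int[m]_(s in D) phi s <= 2 * e.
    rewrite /phi RintegralZl// ler_wpM2l// RintegralZl// sumE.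
    rewrite ler_pdivrMl// (_ : n.+1%:R * e = \sum_(i < n.+1) e); last first.
      by rewrite sumr_const card_ord mulr_natl.
    apply: ler_sum => i _; apply: He; rewrite mulr_ge0 ?divr_ge0// ?(ltW u0)//=.
    by rewrite mulrCA ler_piMr ?(ltW u0)// ler_pdivrMr// mul1r ler_nat.
  apply: (@le_trans _ _ (\int[m]_(s in A n) (phi s)%:E)%E).
    rewrite -[leLHS]mul1e -integral_cst//; last exact: mset.
    apply: ge0_le_integral => //.
    - exact: mset.
    - by apply: measurable_funS miphi => //; exact: subIsetl.
    move=> s [Ds /= /andP[s4 sn]]; rewrite lee_fin.
    have := @cos_average_le R n.+1 (u / n.+1%:R * (s : W) 0 j) isT.
    have -> : 4 / n.+1%:R <= u / n.+1%:R * (s : W) 0 j <= 1.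
      rewrite mulrAC ler_pM2r ?invr_gt0// ler_pdivrMr// mul1r.
      by rewrite ler_pdivrMr// mulrC in s4; rewrite s4 /= -ler_pdivlMl// mulrC.
    move=> /(_ isT) h; rewrite /phi sumrB sumr_const card_ord mulrBr.
    rewrite -[1 *+ _]mulr_natr mul1r mulVf ?gt_eqF//.
    have -> : \sum_(i < n.+1) cos (i.+1%:R * (u / n.+1%:R) * (s : W) 0 j) =
        \sum_(i < n.+1) cos (i.+1%:R * (u / n.+1%:R * (s : W) 0 j)).
      by apply: eq_bigr => i _; rewrite -mulrA.
    by set S := _ * \sum_(i < n.+1) _ in h *; lra.
  apply: (@le_trans _ _ (\int[m]_(s in D) (phi s)%:E)%E).
    apply: ge0_subset_integral => //; first exact: mset.
      by move=> s _; rewrite lee_fin.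
    exact: subIsetl.
  by rewrite -(Rintegral_fin mD iphi) lee_fin.
have -> : D `&` [set s : E | 4 / u <= (s : W) 0 j] = \bigcup_n A n.
  apply/seteqP; split=> [s [Ds /= s4]|s [n _ [Ds /= /andP[s4 _]]]]; last by split.
  exists (Num.truncn (u * (s : W) 0 j)) => //; split => //=.
  rewrite s4/= ler_pdivlMr// mulrC; apply: ltW; apply: truncnS_gt.
have ndA : nondecreasing_seq A.
  move=> p q pq; apply/subsetPset => s [Ds /= /andP[s4 sp]]; split => //=.
  by rewrite s4/= (le_trans sp)// ler_wpM2r ?invr_ge0 ?(ltW u0)// ler_nat.
have cv := nondecreasing_cvg_mu (mu := m) (fun n => mset _ _ : measurable (A n))
  (bigcup_measurable (fun n _ => mset _ _ : measurable (A n))) ndA.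
rewrite -(cvg_lim _ cv)//; apply: lime_le; first by apply/cvg_ex; eexists; exact: cv.
by apply: nearW => n; exact: An.
Qed.

End dominated_integrals.

(** * Integration errors of an approximation that is good on a box only *)

Section approximated_integrals.
Context {R : realType} {k : nat}.
Local Notation W := 'rV[R]_k.
Local Notation E := (borel_rV R k).
Variables (m : {measure set E -> \bar R}) (D : set E).
Hypothesis mD : measurable D.
Hypothesis Dorthant : D `<=` (orthant : set W).
Hypothesis icsum : m.-integrable D (EFin \o csum).

Definition far (K : R) (j : 'I_k) : set E := [set s : E | K <= (s : W) 0 j].

Lemma measurable_far K j : measurable (far K j).
Proof.
rewrite -[X in measurable X]setTI.
rewrite (_ : far K j = (fun s : E => (s : W) 0 j) @^-1` `[K, +oo[).
  exact: measurable_coord.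
by apply/seteqP; split => s /=; rewrite in_itv/= andbT.
Qed.

Lemma integrable_far K j : 1 <= K -> m.-integrable D (EFin \o \1_(far K j)).
Proof.
move=> K1; apply: (integrable_csum mD icsum (C := 1)).
  by apply: measurable_funTS; exact: measurable_indic (measurable_far K j).
move=> s /Dorthant s0; rewrite mul1r indicE; have [|_] := boolP (s \in far K j).
  rewrite inE/= => Ks; rewrite normr1 (le_trans _ (csum_ge j s0))//.
  by rewrite le_min (le_trans K1 Ks) lexx.
by rewrite normr0 csum_ge0.
Qed.

Lemma Rintegral_far K j :
  \int[m]_(s in D) \1_(far K j) s = fine (m (D `&` far K j)).
Proof.
by rewrite /Rintegral integral_indic//; [rewrite setIC|exact: measurable_far].
Qed.

(** Outside the box at least one of the indicators of [far K j] equals 1, so e * csum plus C times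
    their sum bounds the error everywhere on the orthant. *)
Lemma approx_integral (J : finType) (q : J -> W -> R) (a : J -> R) (r : W -> R)
    (e C K : R) : 1 <= K -> 0 <= C ->
  m.-integrable D (EFin \o r) -> (forall j, m.-integrable D (EFin \o q j)) ->
  (forall s, orthant s -> (forall j, s 0 j <= K) ->
    `|r s - \sum_j a j * q j s| <= e * csum s) -> 0 <= e ->
  (forall s, orthant s -> `|r s - \sum_j a j * q j s| <= C) ->
  `|\int[m]_(s in D) r s - \sum_j a j * \int[m]_(s in D) q j s| <=
    e * \int[m]_(s in D) csum s + C * \sum_j fine (m (D `&` far K j)).
Proof.
move=> K1 C0 ir iq near_ e0 far_.
have iaq j : m.-integrable D (EFin \o (fun s : E => a j * q j s)).
  exact: (integrableZl mD (a j) (iq j)).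
have [isum sumE] := @Rintegral_sum R _ _ m D _ (index_enum J)
  (fun j s => a j * q j s) mD iaq.
have -> : \sum_j a j * \int[m]_(s in D) q j s =
    \int[m]_(s in D) (\sum_j a j * q j s).
  by rewrite sumE; apply: eq_bigr => j _; rewrite RintegralZl.
have [ifar farE] := @Rintegral_sum R _ _ m D _ (index_enum 'I_k)
  (fun j => \1_(far K j)) mD (fun j => integrable_far j K1).
have -> : \sum_j fine (m (D `&` far K j)) =
    \int[m]_(s in D) (\sum_j \1_(far K j) s).
  by rewrite farE; apply: eq_bigr => j _; rewrite Rintegral_far.
rewrite -RintegralB// -RintegralZl// -RintegralZl//.
have ie : m.-integrable D (EFin \o (fun s : E => e * csum (s : W))).
  exact: (integrableZl mD e icsum).
have iC : m.-integrable D (EFin \o (fun s : E => C * \sum_j \1_(far K j) s)).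
  exact: (integrableZl mD C ifar).
rewrite -RintegralD//.
have idiff : m.-integrable D (EFin \o (fun s : E => r s - \sum_j a j * q j s)).
  rewrite (_ : _ \o _ = (EFin \o r) \- (EFin \o (fun s : E => \sum_j a j * q j s)%R))%E//.
  exact: integrableB.
have ibound : m.-integrable D (EFin \o (fun s : E =>
    e * csum (s : W) + C * \sum_j \1_(far K j) s)).
  rewrite (_ : _ \o _ = (fun s : E => (EFin \o (fun s : E => e * csum (s : W))%R) s +
    (EFin \o (fun s : E => C * \sum_j \1_(far K j) s)%R) s)%E)//.
  exact: integrableD.
have mdiff : measurable_fun D (fun s : E => r s - \sum_j a j * q j s).
  by apply/measurable_EFinP; have /integrableP[] := idiff.
suff H : forall s, D s -> `|r s - \sum_j a j * q j s| <=
    e * csum s + C * \sum_j \1_(far K j) s.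
  by have [] := Rintegral_norm_le mD mdiff ibound H.
move=> s /Dorthant s0.
have ind0 j : 0 <= \1_(far K j) s :> R by rewrite indicE.
have [sK|/existsNP[j /negP]] := pselect (forall j, (s : W) 0 j <= K).
  apply: ler_wpDr; last exact: near_.
  by rewrite mulr_ge0// sumr_ge0.
rewrite -ltNge => Ks; apply: ler_wpDl; first by rewrite mulr_ge0// csum_ge0.
apply: (le_trans (far_ s s0)); rewrite ler_peMr// (bigD1 j)//=.
rewrite indicE mem_set/=; last exact: ltW.
by rewrite lerDl sumr_ge0.
Qed.

End approximated_integrals.

(** * Limits of mu_h / h, uniformly over families of test functions *)

Section small_time_limit.
Context {R : realType} {k : nat}.
Local Notation W := 'rV[R]_k.
Local Notation E := (borel_rV R k).
Variables (mu : R -> probability E R) (nu : {measure set E -> \bar R}) (c : W).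
Local Notation L h phi := (h^-1 * \int[mu h]_(s in orthant) phi s).
Local Notation N phi := (\int[nu]_(s in orthant0) phi s).

(* The derivative at h = 0 of the characteristic function of mu h, tightness of
   mu h / h at infinity, and boundedness of its mass away from 0. *)
Definition small_time_limit : Prop :=
  [/\ forall xi : W, L h (fun s => cos (dot xi s) - 1) @[h --> 0^'+] -->
        N (fun s => cos (dot xi s) - 1),
      forall xi : W, L h (fun s => sin (dot xi s)) @[h --> 0^'+] -->
        dot c xi + N (fun s => sin (dot xi s)),
      forall e, 0 < e -> exists2 u, 0 < u & \forall h \near 0^'+,
        forall (j : 'I_k) xi, 0 <= xi <= u ->
        L h (fun s => 1 - cos (xi * s 0 j)) <= e &
      exists M, \forall h \near 0^'+, forall (j : 'I_k) xi, 0 <= xi <= 4 ->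
        L h (fun s => 1 - cos (xi * s 0 j)) <= M].

Hypothesis nu_csum : nu.-integrable orthant0 (EFin \o csum).
Hypothesis mu_nu : small_time_limit.

Let Hcos (xi : W) : L h (fun s => cos (dot xi s) - 1) @[h --> 0^'+] -->
  N (fun s => cos (dot xi s) - 1).
Proof. by case: mu_nu => H _ _ _; exact: H. Qed.

Let Hsin (xi : W) : L h (fun s => sin (dot xi s)) @[h --> 0^'+] -->
  dot c xi + N (fun s => sin (dot xi s)).
Proof. by case: mu_nu => _ H _ _; exact: H. Qed.

Let mO : measurable (orthant : set E) := measurable_orthant.
Let mO0 : measurable (orthant0 : set E) := measurable_orthant0.

Let O0O : (orthant0 : set W) `<=` orthant.
Proof. by move=> s []. Qed.

Let mu_csum h : (mu h).-integrable orthant (EFin \o csum).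
Proof.
apply: (@integrable_prob _ _ _ _ _ _ k%:R) => //.
  by apply: measurable_funTS; exact: measurable_csum.
move=> s s0; rewrite ger0_norm ?csum_ge0//.
rewrite (_ : k%:R = \sum_(j < k) 1); last by rewrite sumr_const card_ord.
by apply: ler_sum => j _; rewrite ge_min lexx orbT.
Qed.

Let cos_poly_i (q : W -> R) : cos_poly q ->
  (forall h, (mu h).-integrable orthant (EFin \o (fun s => q s - q 0))) /\
  nu.-integrable orthant0 (EFin \o (fun s => q s - q 0)).
Proof.
move=> cq; have [C qC] := cos_poly_csum cq.
have mq D : measurable_fun (D : set E) (fun s : E => q s - q 0).
  by apply: measurable_funTS; apply: measurable_funB => //; exact: measurable_cos_poly.
split=> [h|].
  by apply: (integrable_csum mO (mu_csum h) (C := C)).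
by apply: (integrable_csum mO0 nu_csum (C := C)) => // s /O0O; exact: qC.
Qed.

Let cos_poly_cvg (q : W -> R) : cos_poly q ->
  L h (fun s => q s - q 0) @[h --> 0^'+] --> N (fun s => q s - q 0).
Proof.
elim=> [a xi|p1 p2 cp1 H1 cp2 H2].
  have cc : cos_poly (fun s => 1 * cos (dot xi s)) by exact: cos_poly_cos.
  have [i1 i2] := cos_poly_i cc.
  have eE : (fun s : E => a * cos (dot xi (s : W)) - a * cos (dot xi 0)) =
      (fun s : E => a * (1 * cos (dot xi (s : W)) - 1 * cos (dot xi 0))).
    by apply/funext => s; rewrite !mul1r mulrBr.
  have eE1 : (fun s : E => 1 * cos (dot xi (s : W)) - 1 * cos (dot xi 0)) =
      (fun s : E => cos (dot xi (s : W)) - 1).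
    by apply/funext => s; rewrite !mul1r (dotC xi 0) dot0l cos0.
  have eN : N (fun s : E => a * cos (dot xi (s : W)) - a * cos (dot xi 0)) =
      a * N (fun s : E => cos (dot xi (s : W)) - 1).
    by rewrite eE RintegralZl; [rewrite eE1|exact: mO0|exact: i2].
  rewrite eN (_ : (fun h => _) =
      (fun h => a * L h (fun s : E => cos (dot xi (s : W)) - 1))).
    by apply: cvgM; [exact: cvg_cst|exact: Hcos].
  apply/funext => h.
  by rewrite eE RintegralZl; [rewrite eE1 mulrCA|exact: mO|exact: i1].
have [i11 i12] := cos_poly_i cp1; have [i21 i22] := cos_poly_i cp2.
have eE : (fun s : E => p1 s + p2 s - (p1 0 + p2 0)) =
    (fun s : E => (p1 s - p1 0) + (p2 s - p2 0)).
  by apply/funext => s; rewrite opprD addrACA.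
have eN : N (fun s : E => p1 s + p2 s - (p1 0 + p2 0)) =
    N (fun s : E => p1 s - p1 0) + N (fun s : E => p2 s - p2 0).
  by rewrite eE; apply: RintegralD.
rewrite eN (_ : (fun h => _) = (fun h => L h (fun s : E => p1 s - p1 0) +
    L h (fun s : E => p2 s - p2 0))); first exact: cvgD.
apply/funext => h; rewrite eE -mulrDr; congr (_ * _).
exact: (RintegralD mO (i11 h) (i21 h)).
Qed.

Let near_pos : \forall h \near (0 : R)^'+, 0 < h.
Proof. exact: nbhs_right_gt. Qed.

Let tail_mu (u e h : R) j : 0 < h -> 0 < u ->
  (forall xi, 0 <= xi <= u -> L h (fun s => 1 - cos (xi * (s : W) 0 j)) <= e) ->
  h^-1 * fine (mu h (orthant `&` far (4 / u) j)) <= 2 * e.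
Proof.
move=> h0 u0 He.
rewrite ler_pdivrMl// -lee_fin fineK ?fin_num_measure//; last first.
  by apply: measurableI => //; exact: measurable_far.
rewrite mulrCA; apply: (tail_le mO _ (mu_csum h) u0) => [s //|xi xiu].
by rewrite -ler_pdivrMl//; exact: He.
Qed.

(** For each fixed frequency the bound on the cosine integral passes to the limit h -> 0+, after
    which [tail_le] applies to [nu] itself. *)
Let tail_nu (u e : R) j : 0 < u ->
  (\forall h \near 0^'+, forall xi, 0 <= xi <= u ->
    L h (fun s => 1 - cos (xi * (s : W) 0 j)) <= e) ->
  fine (nu (orthant0 `&` far (4 / u) j)) <= 2 * e /\
  (nu (orthant0 `&` far (4 / u) j) < +oo)%E.
Proof.
move=> u0 He.
have H : (nu (orthant0 `&` far (4 / u) j) <= (2 * e)%:E)%E.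
  apply: (tail_le mO0 O0O nu_csum u0) => xi xiu.
  have eE : (fun s : E => 1 - cos (xi * (s : W) 0 j)) =
      (fun s : E => -1 * (1 * cos (dot (xi *: basis_vec j) (s : W)) -
        1 * cos (dot (xi *: basis_vec j) 0))).
    by apply/funext => s; rewrite !dot_basis mxE mulr0 cos0 !mul1r mulN1r opprB.
  have [i1 i2] := cos_poly_i (cos_poly_cos 1 (xi *: basis_vec j)).
  have cv := cos_poly_cvg (cos_poly_cos 1 (xi *: basis_vec j)).
  rewrite eE RintegralZl//.
  have {}cv : -1 * L h (fun s : E => 1 * cos (dot (xi *: basis_vec j) (s : W)) -
        1 * cos (dot (xi *: basis_vec j) 0)) @[h --> 0^'+] -->
      -1 * N (fun s : E => 1 * cos (dot (xi *: basis_vec j) (s : W)) -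
        1 * cos (dot (xi *: basis_vec j) 0)).
    by apply: cvgM; [exact: cvg_cst|exact: cv].
  refine (cvgr_to_le cv _); near=> h.
  suff : L h (fun s => 1 - cos (xi * (s : W) 0 j)) <= e.
    by rewrite eE (RintegralZl _ mO (i1 h)) mulrCA.
  by move: xi xiu {eE i1 i2 cv}; near: h; exact: He.
split; last by apply: le_lt_trans H _; rewrite ltry.
by rewrite -lee_fin fineK// ge0_fin_numE// (le_lt_trans H)// ltry.
Unshelve. all: by end_near. Qed.

Let e_ (j : 'I_k) : W := 1 *: basis_vec j.

Let e_E j s : dot (e_ j) s = s 0 j.
Proof. by rewrite dot_basis mul1r. Qed.

Let sin_i (j : 'I_k) :
  (forall h, (mu h).-integrable orthant (EFin \o (fun s : E => sin ((s : W) 0 j)))) /\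
  nu.-integrable orthant0 (EFin \o (fun s : E => sin ((s : W) 0 j))).
Proof.
have ms D : measurable_fun (D : set E) (fun s : E => sin ((s : W) 0 j)).
  apply: measurable_funTS; apply: eq_measurable_fun (measurable_sin_dot (e_ j)).
  by move=> s _; rewrite e_E.
have sC (s : W) : orthant s ->
    `|sin (s 0 j)| <= (\sum_i `|e_ j 0 i| + 2) * csum s.
  by move=> s0; rewrite -(e_E j); exact: sin_dot_csum.
split=> [h|]; first exact: (integrable_csum mO (mu_csum h) (ms _) sC).
by apply: (integrable_csum mO0 nu_csum (ms _)) => s /O0O; exact: sC.
Qed.

Let sin_cvg (j : 'I_k) : L h (fun s : E => sin ((s : W) 0 j)) @[h --> 0^'+] -->
  c 0 j + N (fun s : E => sin ((s : W) 0 j)).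
Proof.
have := Hsin (xi := e_ j); rewrite dotC e_E.
by under eq_Rintegral do rewrite e_E; under eq_fun do under eq_Rintegral do rewrite e_E.
Qed.

(** Coordinatewise min(s, 1) <= 2 sin s + 3 * 1_{s >= 1}: for s >= 1 the right side is at least -2 +
    3. The sine integrals converge. The indicator is handled by [tail_mu] with u = 4, whose
    threshold 4 / u is then 1; this is why the last clause of [small_time_limit] covers frequencies
    up to 4. *)
Let first_moment : exists2 A, 0 <= A & \forall h \near 0^'+, L h csum <= A.
Proof.
have [_ _ _ [B HB]] := mu_nu.
pose l j := c 0 j + N (fun s : E => sin ((s : W) 0 j)).
exists `|\sum_j (2 * (l j + 1) + 3 * (2 * B))| => //.
have sinl : \forall h \near (0 : R)^'+, forall j,
    L h (fun s : E => sin ((s : W) 0 j)) <= l j + 1.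
  apply: filter_forall => j; have lj : l j < l j + 1 by rewrite ltrDl.
  exact: (cvgr_le (l j) (@sin_cvg j) _ lj).
near=> h; have h0 : 0 < h by near: h.
have sinlh : forall j, L h (fun s : E => sin ((s : W) 0 j)) <= l j + 1 by near: h.
have Bh : forall (j : 'I_k) xi, 0 <= xi <= 4 ->
    L h (fun s : E => 1 - cos (xi * (s : W) 0 j)) <= B by near: h.
apply: le_trans (ler_norm _).
have ifar j : (mu h).-integrable orthant (EFin \o \1_(far 1 j)).
  exact: (integrable_far mO (fun s x => x) (mu_csum h)).
have i2sin j := integrableZl mO 2 ((sin_i j).1 h).
have i3far j := integrableZl mO 3 (ifar j).
have isum j : (mu h).-integrable orthant
    (EFin \o (fun s : E => 2 * sin ((s : W) 0 j) + 3 * \1_(far 1 j) s)).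
  exact: (integrableD mO (i2sin j) (i3far j)).
have [isum' sumE] := @Rintegral_sum R _ _ (mu h) _ _ (index_enum 'I_k)
  (fun j (s : E) => 2 * sin ((s : W) 0 j) + 3 * \1_(far 1 j) s) mO isum.
apply: (@le_trans _ _ (h^-1 * \int[mu h]_(s in orthant)
    (\sum_j (2 * sin ((s : W) 0 j) + 3 * \1_(far 1 j) s)))).
  rewrite ler_wpM2l ?invr_ge0 ?(ltW h0)//; apply: (le_Rintegral mO (mu_csum h) isum').
  move=> s s0; apply: ler_sum => j _; have sj := orthant_ge0 j s0.
  rewrite indicE; have [|] := boolP (s \in far 1 j).
    by move=> _; rewrite /= mulr1; have := sin_geN1 ((s : W) 0 j); rewrite ge_min => ?; apply/orP; right; lra.
  rewrite notin_setE /far/= => /negP; rewrite -ltNge => s1; rewrite mulr0 addr0.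
  have : 0 <= (s : W) 0 j <= 1 by rewrite sj ltW.
  by move=> /sin_ge_half; rewrite ge_min => ?; apply/orP; left; lra.
rewrite sumE mulr_sumr; apply: ler_sum => j _.
rewrite (RintegralD mO (i2sin j) (i3far j)) (RintegralZl _ mO ((sin_i j).1 h)).
rewrite (RintegralZl _ mO (ifar j)) (Rintegral_far _ mO) mulrDr mulrCA [h^-1 * (3 * _)]mulrCA.
apply: lerD; rewrite ler_wpM2l//.
have := @tail_mu 4 B h j h0 (ltr0n _ 4) (Bh j).
by rewrite divff.
Unshelve. all: by end_near. Qed.

Section family.
Variables (I : Type) (g : I -> W -> R) (b : I -> 'I_k -> R) (Cg Cb : R).
Hypothesis gC : forall i s, orthant s -> `|g i s| <= Cg.
Hypothesis bC : forall i j, `|b i j| <= Cb.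
Hypothesis Cg0 : 0 <= Cg.
Hypothesis Cb0 : 0 <= Cb.
Hypothesis g_unif : forall e, 0 < e -> exists2 dl, 0 < dl &
  forall i s t, orthant s -> orthant t -> (forall j, `|s 0 j - t 0 j| < dl) ->
  `|g i s - g i t| <= e.
Hypothesis g_small : forall e, 0 < e -> exists2 dl, 0 < dl &
  forall i s, orthant s -> (forall j, s 0 j < dl) ->
  `|g i s - \sum_j s 0 j * b i j| <= e * \sum_j s 0 j.

(* sin s_j agrees with s_j to first order at 0, and its integrals converge. *)
Let r i (s : W) := g i s - \sum_j sin (s 0 j) * b i j.
Let C := Cg + k%:R * Cb.

Let C0 : 0 <= C.
Proof. by rewrite addr_ge0// mulr_ge0. Qed.

Let rC i s : orthant s -> `|r i s| <= C.
Proof.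
move=> s0; apply: (le_trans (ler_normB _ _)); rewrite lerD ?gC//.
apply: (le_trans (ler_norm_sum _ _ _)).
rewrite (_ : k%:R * Cb = \sum_(j < k) Cb); last by rewrite sumr_const card_ord mulr_natl.
apply: ler_sum => j _; rewrite normrM -[leRHS]mul1r ler_pM ?bC//.
exact: sin_max.
Qed.

Let r_unif e : 0 < e -> exists2 dl, 0 < dl &
  forall i s t, orthant s -> orthant t -> (forall j, `|s 0 j - t 0 j| < dl) ->
  `|r i s - r i t| <= e.
Proof.
move=> e0; have e20 : 0 < e / 2 by rewrite divr_gt0.
have [d1 d10 d1P] := g_unif e20.
have kC : 0 < k%:R * Cb + 1 by rewrite ltr_wpDl// mulr_ge0.
exists (Num.min d1 (e / 2 / (k%:R * Cb + 1))); first by rewrite lt_min d10 divr_gt0.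
move=> i s t s0 t0 st.
have h1 : `|g i s - g i t| <= e / 2.
  by apply: d1P => // j; have := st j; rewrite lt_min => /andP[].
have -> : r i s - r i t = (g i s - g i t) -
    \sum_j (sin (s 0 j) - sin (t 0 j)) * b i j.
  rewrite /r; under [X in _ = _ - X]eq_bigr do rewrite mulrBl.
  by rewrite sumrB; ring.
apply: (le_trans (ler_normB _ _)); have -> : e = e / 2 + e / 2 by lra.
apply: (lerD h1); apply: (le_trans (ler_norm_sum _ _ _)).
apply: (@le_trans _ _ (\sum_(j < k) (e / 2 / (k%:R * Cb + 1)) * Cb)).
  apply: ler_sum => j _; rewrite normrM ler_pM ?bC//.
  apply: (le_trans (sin_lip _ _)); apply: ltW.
  by have := st j; rewrite lt_min => /andP[].
rewrite sumr_const card_ord -[_ *+ k]mulr_natl mulrCA mulrAC ler_pdivrMr//.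
by rewrite ler_wpM2l ?(ltW e20)// lerDl.
Qed.

Let r_small e : 0 < e -> exists2 dl, 0 < dl &
  forall i s, orthant s -> (forall j, s 0 j < dl) ->
  `|r i s| <= e * \sum_j s 0 j.
Proof.
move=> e0; have e20 : 0 < e / 2 by rewrite divr_gt0.
have [d1 d10 d1P] := g_small e20.
have Cb1 : 0 < Cb + 1 by rewrite ltr_wpDl.
(* As s - sin s <= s^3 / 2, the conditions s_j < 1 and s_j (Cb + 1) < e make each sine correction at
   most (e / 2) s_j. *)
exists (Num.min d1 (Num.min 1 (e / (Cb + 1)))).
  by rewrite !lt_min d10 ltr01 divr_gt0.
move=> i s s0 sd.
have {}sd j : [/\ s 0 j < d1, s 0 j < 1 & s 0 j < e / (Cb + 1)].
  by have := sd j; rewrite !lt_min => /and3P[].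
have h1 : `|g i s - \sum_j s 0 j * b i j| <= e / 2 * \sum_j s 0 j.
  by apply: d1P => // j; have [] := sd j.
have -> : r i s = (g i s - \sum_j s 0 j * b i j) +
    \sum_j (s 0 j - sin (s 0 j)) * b i j.
  rewrite /r; under [X in _ = _ + X]eq_bigr do rewrite mulrBl.
  by rewrite sumrB; ring.
apply: (le_trans (ler_normD _ _)).
have -> : e * \sum_j s 0 j = e / 2 * \sum_j s 0 j + e / 2 * \sum_j s 0 j by lra.
apply: (lerD h1); apply: (le_trans (ler_norm_sum _ _ _)).
rewrite mulr_sumr; apply: ler_sum => j _; have sj := orthant_ge0 j s0.
rewrite normrM; have [_ s1 se] := sd j.
apply: (@le_trans _ _ (s 0 j * (s 0 j ^+ 2 / 2) * Cb)).
  by rewrite ler_pM ?bC ?subr_sin_le.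
rewrite -mulrA mulrC ler_wpM2r// mulrAC ler_wpM2r//.
rewrite ltr_pdivlMr// in se.
apply: (@le_trans _ _ (s 0 j * (Cb + 1))); last exact: ltW.
by rewrite expr2 ler_pM ?mulr_ge0// ?ler_piMr ?(ltW s1)// lerDl.
Qed.

(** Smallness of r near 0 and boundedness elsewhere combine into domination by [csum], hence
    integrability for the possibly infinite measure [nu]. *)
Let r_csum : exists C', forall i s, orthant s -> `|r i s| <= C' * csum s.
Proof.
have [d1 d10 d1P] := r_small ltr01.
pose dl := Num.min d1 1; have dl0 : 0 < dl by rewrite lt_min d10/=.
exists (1 + C / dl) => i s s0; have c0 := csum_ge0 s0.
rewrite mulrDl mul1r.
have [near_|/existsNP[j /negP]] := pselect (forall j, s 0 j < dl).
  apply: ler_wpDr; first by rewrite mulr_ge0// divr_ge0// ltW.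
  apply: le_trans (d1P i s s0 _) _.
    by move=> j; apply: lt_le_trans (near_ j) _; rewrite ge_min lexx.
  rewrite mul1r; apply: ler_sum => j _.
  by rewrite le_min lexx/= ltW// (lt_le_trans (near_ j))// ge_min lexx orbT.
rewrite -leNgt => sj; apply: ler_wpDl => //; apply: (le_trans (rC i s0)).
rewrite mulrAC ler_pdivlMr// ler_wpM2l// (le_trans _ (csum_ge j s0))//.
by rewrite le_min sj ge_min lexx orbT.
Qed.

Let g_meas i (D : set E) : D `<=` (orthant : set W) -> measurable D ->
  measurable_fun D (g i : E -> R).
Proof.
move=> DO mD; apply: (measurable_funS mO DO).
apply: measurable_orthant_continuous; apply/within_continuousP => s s0 e e0.
have e20 : 0 < e / 2 by rewrite divr_gt0.
have [dl dl0 dlP] := g_unif e20; exists dl => // t t0 st.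
by apply: le_lt_trans (dlP i s t s0 t0 st) _; lra.
Qed.

Let split_integral (m : {measure set E -> \bar R}) (D : set E) i :
  measurable D -> D `<=` (orthant : set W) -> m.-integrable D (EFin \o csum) ->
  (forall j, m.-integrable D (EFin \o (fun s : E => sin ((s : W) 0 j)))) ->
  [/\ m.-integrable D (EFin \o r i), m.-integrable D (EFin \o g i) &
  \int[m]_(s in D) g i s = \int[m]_(s in D) r i s +
    \sum_j b i j * \int[m]_(s in D) sin ((s : W) 0 j)].
Proof.
move=> mD DO ics isin; have [C' C'P] := r_csum.
have [isum sumE] := @Rintegral_sum R _ _ m D _ (index_enum 'I_k)
  (fun j (s : E) => b i j * sin ((s : W) 0 j)) mD
  (fun j => integrableZl mD (b i j) (isin j)).
have mr : measurable_fun D (r i : E -> R).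
  apply: measurable_funB; first exact: g_meas.
  apply: measurable_sum => j; apply: measurable_funM => //.
  by apply/measurable_EFinP; have /integrableP[] := isin j.
have ir : m.-integrable D (EFin \o r i).
  by apply: (integrable_csum mD ics mr (C := C')) => s /DO; exact: C'P.
have gE : (g i : E -> R) = (fun s : E => r i s + \sum_j b i j * sin ((s : W) 0 j)).
  apply/funext => s; rewrite /r [X in _ = _ - X + _](eq_bigr (fun j => b i j * sin ((s : W) 0 j))).
    by rewrite subrK.
  by move=> j _; rewrite mulrC.
split => //; rewrite gE; first exact: (integrableD mD ir isum).
rewrite (RintegralD mD ir isum) sumE; congr (_ + _); apply: eq_bigr => j _.
by rewrite RintegralZl.
Qed.

(** The order of choices matters: tightness fixes the box size K, the moment bound [A] then fixes
    the accuracy [e1], these fix the finite family [q], and only afterwards is h taken small. Since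
    [q] does not depend on i and |a i j| <= M, convergence on each [q j] is uniform in i. *)
Theorem uniform_limit :
  (forall i, nu.-integrable orthant0 (EFin \o g i)) /\
  forall e, 0 < e -> \forall h \near 0^'+, forall i,
    `|\sum_j c 0 j * b i j + N (g i) - L h (g i)| <= e.
Proof.
have nu_split i := split_integral i mO0 O0O nu_csum (fun j => (sin_i j).2).
have mu_split h i := split_integral i mO (fun s x => x) (mu_csum h)
  (fun j => (sin_i j).1 h).
split=> [i|e e0]; first by have [] := nu_split i.
have [A A0 HA] := first_moment.
pose C' := 2 * C + 1; have C'0 : 0 <= C' by rewrite addr_ge0// mulr_ge0.
pose Nc := N csum.
have Nc0 : 0 <= Nc by apply: Rintegral_ge0 => s /O0O; exact: csum_ge0.
(* Error budget: each of the two tail terms gets e / 8 by this choice, the errors inside the box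
   share e / 8 through [e1], and the convergence of the polynomial and of the sine integrals gets e
   / 4 each. *)
pose et := e / 16 / (C' * k%:R + 1).
have Ck0 : 0 <= C' * k%:R by rewrite mulr_ge0.
have et0 : 0 < et by rewrite !divr_gt0// ltr_wpDl.
have [_ _ /(_ _ et0)[u0 u00 Hu0] _] := mu_nu.
(* The cap at 4 / pi gives K = 4 / u >= pi, as the approximation requires. *)
pose u := Num.min u0 (4 / pi).
have u_gt0 : 0 < u by rewrite lt_min u00 divr_gt0// pi_gt0.
pose K := 4 / u.
have piK : pi <= K.
  rewrite ler_pdivlMr// mulrC -ler_pdivlMr ?pi_gt0//.
  by rewrite ge_min lexx orbT.
have K1 : 1 <= K by apply: le_trans piK; have := @pi_ge2 R; lra.
have Hu : \forall h \near (0 : R)^'+, forall (j : 'I_k) xi, 0 <= xi <= u ->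
    L h (fun s : E => 1 - cos (xi * (s : W) 0 j)) <= et.
  near=> h => j xi /andP[xi0 xiu].
  have H : forall (j : 'I_k) xi, 0 <= xi <= u0 ->
    L h (fun s : E => 1 - cos (xi * (s : W) 0 j)) <= et by near: h.
  apply: H; rewrite xi0 (le_trans xiu)// ge_min lexx //.
pose e1 := e / 8 / (A + Nc + 1).
have AN1 : 0 < A + Nc + 1 by rewrite ltr_wpDl// addr_ge0.
have e10 : 0 < e1 by rewrite !divr_gt0.
have [J [q [a [M [aM qP near_ far_]]]]] :=
  trigonometric_approximation C0 rC r_unif r_small piK e10.
have q_i j := cos_poly_i (qP j).1.
have qE j : (fun s : E => q j s - q j 0) = q j.
  by apply/funext => s; rewrite (qP j).2 subr0.
have eM : 0 < e / 4 / (#|J|%:R * `|M| + 1) by rewrite !divr_gt0// ltr_wpDl// mulr_ge0.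
have eS : 0 < e / 4 / (k%:R * Cb + 1) by rewrite !divr_gt0// ltr_wpDl// mulr_ge0.
have nu_tail j : fine (nu (orthant0 `&` far K j)) <= 2 * et.
  have Huj : \forall h \near (0 : R)^'+, forall xi, 0 <= xi <= u ->
      L h (fun s : E => 1 - cos (xi * (s : W) 0 j)) <= et.
    by apply: filterS Hu => h H xi; exact: H.
  by have [] := tail_nu u_gt0 Huj.
have Hq : \forall h \near (0 : R)^'+, forall j,
    `|N (q j) - L h (q j)| <= e / 4 / (#|J|%:R * `|M| + 1).
  apply: filter_forall => j; have := cos_poly_cvg (qP j).1; rewrite qE => cv.
  by move/cvgrPdist_le : cv; apply.
have Hs : \forall h \near (0 : R)^'+, forall j,
    `|c 0 j + N (fun s : E => sin ((s : W) 0 j)) -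
      L h (fun s : E => sin ((s : W) 0 j))| <= e / 4 / (k%:R * Cb + 1).
  by apply: filter_forall => j; have /cvgrPdist_le := @sin_cvg j; apply.
near=> h => i; have h0 : 0 < h by near: h.
have hA : L h csum <= A by near: h.
have hu : forall (j : 'I_k) xi, 0 <= xi <= u ->
    L h (fun s : E => 1 - cos (xi * (s : W) 0 j)) <= et by near: h.
have hq : forall j, `|N (q j) - L h (q j)| <= e / 4 / (#|J|%:R * `|M| + 1) by near: h.
have hs : forall j, `|c 0 j + N (fun s : E => sin ((s : W) 0 j)) -
      L h (fun s : E => sin ((s : W) 0 j))| <= e / 4 / (k%:R * Cb + 1) by near: h.
have [ri_nu _ gE_nu] := nu_split i; have [ri_mu _ gE_mu] := mu_split h i.
have qi_nu j : nu.-integrable orthant0 (EFin \o q j) by rewrite -qE; exact: (q_i j).2.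
have qi_mu j : (mu h).-integrable orthant (EFin \o q j) by rewrite -qE; exact: (q_i j).1.
have err_nu := approx_integral mO0 O0O nu_csum K1 C'0 ri_nu qi_nu (near_ i) (ltW e10) (far_ i).
have err_mu := approx_integral mO (fun s x => x) (mu_csum h) K1 C'0 ri_mu qi_mu
  (near_ i) (ltW e10) (far_ i).
have hV : 0 <= h^-1 by rewrite invr_ge0 ltW.
have {}err_mu : `|L h (r i) - \sum_j a i j * L h (q j)| <=
    e1 * A + C' * \sum_(j < k) (2 * et).
  have -> : L h (r i) - \sum_j a i j * L h (q j) =
      h^-1 * (\int[mu h]_(s in orthant) r i s -
        \sum_j a i j * \int[mu h]_(s in orthant) q j s).
    by rewrite mulrBr mulr_sumr; congr (_ - _); apply: eq_bigr => j _; rewrite mulrCA.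
  rewrite normrM (ger0_norm hV); apply: (le_trans (ler_wpM2l hV err_mu)).
  rewrite mulrDr mulrCA [h^-1 * (C' * _)]mulrCA.
  apply: lerD; rewrite ler_wpM2l ?(ltW e10)// mulr_sumr; apply: ler_sum => j _.
  exact: (tail_mu h0 u_gt0 (hu j)).
have {}err_nu : `|N (r i) - \sum_j a i j * N (q j)| <=
    e1 * Nc + C' * \sum_(j < k) (2 * et).
  apply: (le_trans err_nu); rewrite lerD2l ler_wpM2l//.
  by apply: ler_sum => j _.
have tail_small : C' * \sum_(j < k) (2 * et) <= e / 8.
  have -> : C' * \sum_(j < k) (2 * et) = e / 8 * (C' * k%:R / (C' * k%:R + 1)).
    rewrite sumr_const card_ord -[_ *+ k]mulr_natl /et.
    by field; rewrite gt_eqF// ltr_wpDl.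
  by rewrite ler_piMr ?divr_ge0 ?(ltW e0)// ler_pdivrMr ?ltr_wpDl// mul1r lerDl.
have e1AN : e1 * A + e1 * Nc <= e / 8.
  rewrite -mulrDr /e1 mulrAC ler_pdivrMr// ler_wpM2l ?divr_ge0 ?(ltW e0)//.
  by rewrite lerDl.
have hsum : `|\sum_j a i j * N (q j) - \sum_j a i j * L h (q j)| <= e / 4.
  rewrite -sumrB; apply: (le_trans (ler_norm_sum _ _ _)).
  apply: (@le_trans _ _ (\sum_(j : J) `|M| * (e / 4 / (#|J|%:R * `|M| + 1)))).
    apply: ler_sum => j _; rewrite -mulrBr normrM ler_pM//.
    by rewrite (le_trans (aM i j))// ler_norm.
  rewrite sumr_const -[leLHS]mulr_natl mulrA mulrCA ler_piMr ?divr_ge0 ?(ltW e0)//.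
  by rewrite ler_pdivrMr ?ltr_wpDl ?mulr_ge0// mul1r lerDl.
have hsin : `|\sum_j b i j * (c 0 j + N (fun s : E => sin ((s : W) 0 j)) -
      L h (fun s : E => sin ((s : W) 0 j)))| <= e / 4.
  apply: (le_trans (ler_norm_sum _ _ _)).
  apply: (@le_trans _ _ (\sum_(j < k) Cb * (e / 4 / (k%:R * Cb + 1)))).
    by apply: ler_sum => j _; rewrite normrM ler_pM.
  rewrite sumr_const card_ord -[leLHS]mulr_natl mulrA mulrCA ler_piMr ?divr_ge0 ?(ltW e0)//.
  by rewrite ler_pdivrMr ?ltr_wpDl ?mulr_ge0// mul1r lerDl.
rewrite gE_nu gE_mu.
have -> : \sum_j c 0 j * b i j + (N (r i) + \sum_j b i j * N (fun s : E => sin ((s : W) 0 j))) -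
    h^-1 * (\int[mu h]_(s in orthant) r i s +
      \sum_j b i j * \int[mu h]_(s in orthant) sin ((s : W) 0 j)) =
    (N (r i) - L h (r i)) + \sum_j b i j * (c 0 j + N (fun s : E => sin ((s : W) 0 j)) -
      L h (fun s : E => sin ((s : W) 0 j))).
  rewrite [X in _ = _ + X](eq_bigr (fun j => c 0 j * b i j +
    b i j * N (fun s : E => sin ((s : W) 0 j)) -
    h^-1 * (b i j * \int[mu h]_(s in orthant) sin ((s : W) 0 j)))); last by move=> j _; ring.
  by rewrite sumrB big_split/= -mulr_sumr; ring.
move: err_nu err_mu hsum hsin tail_small e1AN; rewrite !ler_norml.
set x1 := N (r i); set x2 := L h (r i); set x3 := \sum_j a i j * N _.
set x4 := \sum_j a i j * _; set x5 := \sum_j b i j * _; set x6 := C' * _.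
move=> /andP[? ?] /andP[? ?] /andP[? ?] /andP[? ?] ? ?; apply/andP; split; lra.
Unshelve. all: by end_near. Qed.

End family.

End small_time_limit.

(** * Levy measures and increments of the subordinator *)

Section density.
Local Open Scope ereal_scope.
Context d (T : measurableType d) (R : realType).
Variables (m mw : {measure set T -> \bar R}) (w : T -> \bar R).
Hypothesis mw_meas : measurable_fun setT w.
Hypothesis w0 : forall x, 0 <= w x.
Hypothesis mwE : forall A, measurable A -> mw A = \int[m]_(x in A) w x.

Import HBNNSimple.

(** The identity holds for indicators by definition of [mw], then for simple functions by
    additivity, and passes to the limit by monotone convergence on both sides. *)
Lemma ge0_integral_density (D : set T) (f : T -> \bar R) : measurable D ->
  measurable_fun D f -> (forall x, D x -> 0 <= f x) ->
  \int[mw]_(x in D) f x = \int[m]_(x in D) (f x * w x).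
Proof.
move=> mD mf f0; pose f_ := nnsfun_approx mD mf.
transitivity (limn (fun n => \int[mw]_(x in D) (f_ n x)%:E)).
  rewrite -monotone_convergence//.
  - apply: eq_integral => y /[!inE] yD; apply/esym/cvg_lim => //.
    exact: cvg_nnsfun_approx.
  - by move=> n; exact/measurable_EFinP/measurable_funP.
  - by move=> n y _; rewrite lee_fin.
  - by move=> y _ i j ij; rewrite lee_fin; exact/lefP/nd_nnsfun_approx.
have mfw n : measurable_fun D (fun x => (f_ n x)%:E * w x).
  apply: emeasurable_funM; first exact/measurable_EFinP/measurable_funP.
  exact: measurable_funTS.
rewrite [X in limn X](_ : _ = (fun n => \int[m]_(x in D) ((f_ n x)%:E * w x))).
  rewrite -monotone_convergence//.
  - apply: eq_integral => y /[!inE] yD; apply/cvg_lim => //.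
    have cf : (f_ n y)%:E @[n --> \oo] --> f y by exact: cvg_nnsfun_approx.
    have [wy|] := boolP (w y \is a fin_num).
      by rewrite -[w y]fineK//; apply: cvgeZr.
    (* Where the density is infinite, continuity of the product fails at f y = 0; there every
       approximation vanishes, being at most f y. *)
    rewrite ge0_fin_numE// -leNgt leye_eq => /eqP wy; rewrite wy.
    have [fy0|fy0] := eqVneq (f y) 0.
      rewrite fy0 mul0e; rewrite (_ : (fun n => _) = cst 0); first exact: cvg_cst.
      apply/funext => n; rewrite (_ : f_ n y = 0%R) ?mul0e//.
      have fle : (f_ n y)%:E <= f y.
        rewrite -(cvg_lim _ cf)//; apply: lime_ge.
          by apply/cvg_ex; exists (f y).
        by exists n => // i /= ni; rewrite lee_fin; exact/lefP/nd_nnsfun_approx.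
      by rewrite fy0 lee_fin in fle; apply/eqP; rewrite eq_le fle fun_ge0.
    apply: cvgeM => //; last exact: cvg_cst.
    by apply: neq0_mule_def; rewrite gt0_muley// lt_neqAle eq_sym fy0 f0.
  - by move=> n x _; rewrite mule_ge0// lee_fin.
  - move=> x _ i j ij; apply: lee_wpmul2r => //.
    by rewrite lee_fin; exact/lefP/nd_nnsfun_approx.
apply/funext => n.
have mset r : measurable (D `&` f_ n @^-1` [set r]).
  exact: measurableI.
transitivity (\sum_(r \in range (f_ n)) \int[mw]_(x in D)
    (r * \1_(f_ n @^-1` [set r]) x)%:E).
  under eq_integral do rewrite fimfunE -fsumEFin//.
  rewrite ge0_integral_fsum//.
  - by move=> y; exact/measurable_EFinP/measurable_funM.
  - by move=> y x _; rewrite nnfun_muleindic_ge0.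
transitivity (\sum_(r \in range (f_ n)) \int[m]_(x in D)
    ((r * \1_(f_ n @^-1` [set r]) x)%:E * w x)).
  apply: eq_fsbigr => r _; rewrite integralZl_indic_nnsfun// integral_indic//=.
  rewrite setIC mwE//.
  have [r0|r0] := leP 0%R r; last first.
    rewrite (_ : f_ n @^-1` [set r] = set0); last exact: preimage_nnfun0.
    rewrite setI0 integral_set0 mule0.
    rewrite (eq_integral (cst 0)) ?integral0// => x _.
    by rewrite indic0 mulr0 mul0e.
  rewrite -ge0_integralZl//; last exact: measurable_funTS.
  rewrite [LHS]integral_mkcondr; apply: eq_integral => x _.
  rewrite patchE indicE; case: ifPn => _; first by rewrite mulr1.
  by rewrite mulr0 mul0e.
rewrite -ge0_integral_fsum//.
- apply: eq_integral => x _; rewrite fimfunE -fsumEFin// ge0_mule_fsuml//.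
  by move=> r; rewrite nnfun_muleindic_ge0.
- move=> r; apply: emeasurable_funM; last exact: measurable_funTS.
  exact/measurable_EFinP/measurable_funM.
- by move=> r x _; rewrite mule_ge0// nnfun_muleindic_ge0.
Qed.

End density.

(** * Levy measures and their truncations *)

Section levy_measures.
Context {R : realType} {k : nat}.
Local Notation W := 'rV[R]_k.
Local Notation E := (borel_rV R k).
Implicit Types (s xi : W) (m : {measure set E -> \bar R}).

Lemma enorm_ge0 s : 0 <= enorm s.
Proof. exact: sqrtr_ge0. Qed.

Lemma coord_le_enorm s j : `|s 0 j| <= enorm s.
Proof.
rewrite -(sqrtr_sqr (s 0 j)) ler_wsqrtr// /dot (bigD1 j)//= -expr2 lerDl.
by apply: sumr_ge0 => i _; rewrite -expr2 sqr_ge0.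
Qed.

Lemma enorm_eq0 s : enorm s = 0 -> s = 0.
Proof.
move=> s0; apply/rowP => j; rewrite mxE; apply/eqP; rewrite -normr_le0 -s0.
exact: coord_le_enorm.
Qed.

Lemma enorm0 : enorm (0 : W) = 0.
Proof. by rewrite /enorm dot0l sqrtr0. Qed.

Lemma enorm_gt0 s : s != 0 -> 0 < enorm s.
Proof.
move=> s0; rewrite lt_neqAle enorm_ge0 andbT eq_sym.
by apply: contra s0 => /eqP/enorm_eq0 ->.
Qed.

Lemma continuous_dot xi : continuous (dot xi).
Proof.
apply: continuous_big => [|j _ s]; first exact: add_continuous.
by apply: (@cvgM _ _ (nbhs s)); [exact: cvg_cst|exact: coord_continuous].
Qed.

Lemma continuous_enorm : continuous (@enorm R k).
Proof.
have cdot : continuous (fun s : W => dot s s).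
  apply: continuous_big => [|j _ s]; first exact: add_continuous.
  by apply: (@cvgM _ _ (nbhs s)); exact: coord_continuous.
by move=> s; apply: continuous_comp; [exact: cdot|exact: sqrt_continuous].
Qed.

Definition tnorm s : R := Num.min (enorm s) 1.

Lemma tnorm_ge0 s : 0 <= tnorm s.
Proof. by rewrite le_min enorm_ge0/=. Qed.

Lemma tnorm_gt0 s : s != 0 -> 0 < tnorm s.
Proof. by move=> s0; rewrite lt_min enorm_gt0/=. Qed.

Lemma tnorm0 : tnorm (0 : W) = 0.
Proof. by rewrite /tnorm enorm0 min_l. Qed.

Lemma truncated_normE s : truncated_norm s = (tnorm s)%:E.
Proof. by []. Qed.

Lemma continuous_tnorm : continuous tnorm.
Proof. by move=> s; apply: continuous_min; [exact: continuous_enorm|exact: cst_continuous]. Qed.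

Lemma csum_tnorm s : orthant s -> csum s <= k%:R * tnorm s.
Proof.
move=> s0; rewrite (_ : _ * _ = \sum_(j < k) tnorm s); last first.
  by rewrite sumr_const card_ord mulr_natl.
apply: ler_sum => j _; rewrite le_min ge_min (le_trans _ (coord_le_enorm s j))//.
  by rewrite ge_min lexx orbT.
exact: ler_norm.
Qed.

Lemma dot_le_enorm xi s : `|dot xi s| <= (\sum_j `|xi 0 j|) * enorm s.
Proof.
apply: (le_trans (ler_norm_sum _ _ _)); rewrite mulr_suml; apply: ler_sum => j _.
by rewrite normrM ler_wpM2l// coord_le_enorm.
Qed.

Lemma min_dot_le_tnorm xi s :
  Num.min `|dot xi s| 2 <= (\sum_j `|xi 0 j| + 2) * tnorm s.
Proof.
have X0 : 0 <= \sum_j `|xi 0 j| by apply: sumr_ge0.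
have := dot_le_enorm xi s; have := enorm_ge0 s; rewrite /tnorm.
case: (leP (enorm s) 1) => [s1 e0 dx|s1 _ _].
  rewrite ge_min; apply/orP; left; apply: (le_trans dx).
  by rewrite ler_wpM2r// lerDl.
by rewrite mulr1 ge_min; apply/orP; right; rewrite lerDr.
Qed.

Lemma sin_dot_tnorm xi s : `|sin (dot xi s)| <= (\sum_j `|xi 0 j| + 2) * tnorm s.
Proof.
apply: le_trans (min_dot_le_tnorm xi s); rewrite le_min sin_le/=.
by rewrite (le_trans (sin_max _))// ler1n.
Qed.

Lemma cos_dot_tnorm xi s : `|cos (dot xi s) - 1| <= (\sum_j `|xi 0 j| + 2) * tnorm s.
Proof.
apply: le_trans (min_dot_le_tnorm xi s); rewrite le_min.
have := cos_lip (dot xi s) 0; rewrite cos0 subr0 => ->/=.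
rewrite (le_trans (ler_normB _ _))// normr1.
by have := cos_max (dot xi s); lra.
Qed.

Lemma measurable_tnorm : measurable_fun setT (tnorm : E -> R).
Proof. exact: measurable_continuous_rV continuous_tnorm. Qed.

Section one_measure.
Variables (m : {measure set E -> \bar R}).
Hypothesis ml : levy_measure m.

Lemma levy_integrable_tnorm : m.-integrable orthant0 (EFin \o tnorm).
Proof.
apply/integrableP; split.
  by apply/measurable_EFinP; apply: measurable_funTS; exact: measurable_tnorm.
case: ml => _; congr (_ < _)%E; apply: eq_integral => s _ /=.
by rewrite ger0_norm ?tnorm_ge0.
Qed.

Lemma levy_integrable (phi : W -> R) (C : R) :
  measurable_fun (orthant0 : set E) (phi : E -> R) ->
  (forall s, orthant0 s -> `|phi s| <= C * tnorm s) ->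
  m.-integrable orthant0 (EFin \o phi).
Proof.
move=> mphi phiC.
have iC : m.-integrable orthant0 (EFin \o (fun s : E => C * tnorm (s : W))).
  exact: (integrableZl measurable_orthant0 C levy_integrable_tnorm).
by have [] := Rintegral_norm_le measurable_orthant0 mphi iC phiC.
Qed.

Lemma levy_integrable_csum : m.-integrable orthant0 (EFin \o csum).
Proof.
apply: (@levy_integrable _ k%:R).
  by apply: measurable_funTS; exact: measurable_csum.
by move=> s [s0 _]; rewrite ger0_norm ?csum_ge0// csum_tnorm.
Qed.

(** The domain may change from the orthant to the orthant without 0 because the density [tnorm]
    vanishes at 0. *)
Lemma ge0_truncated_integral (g : E -> R) :
  measurable_fun setT g -> (forall s, 0 <= g s) ->
  (\int[truncated_measure m]_(s in orthant) (g s)%:E =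
   \int[m]_(s in orthant0) (g s * tnorm s)%:E)%E.
Proof.
move=> mg g0.
rewrite (@ge0_integral_density _ _ _ m _ (@truncated_norm R k)).
- rewrite [LHS]integral_mkcond [RHS]integral_mkcond; apply: eq_integral => s _.
  rewrite !patchE; case: ifPn => [|]; rewrite ?notin_setE ?inE => sO; last first.
    by rewrite memNset// => -[].
  case: ifPn; rewrite ?notin_setE ?inE => sO0; first by rewrite EFinM.
  have -> : s = 0 by apply: contrapT => s0; apply: sO0; split.
  by rewrite truncated_normE tnorm0 mule0.
- exact: measurable_truncated_norm.
- exact: truncated_norm_ge0.
- by [].
- exact: measurable_orthant.
- by apply/measurable_EFinP; exact: measurable_funTS.
- by move=> s _; rewrite lee_fin.
Qed.

Lemma truncated_orthant_lty : (truncated_measure m orthant < +oo)%E.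
Proof.
rewrite -[X in (X < _)%E]mul1e -integral_cst; last exact: measurable_orthant.
rewrite (@ge0_truncated_integral (cst 1) (measurable_cst _) (fun=> ler01)).
case: ml => _; congr (_ < _)%E; apply: eq_integral => s _.
by rewrite mul1r.
Qed.

(** A signed integrand becomes nonnegative after adding its bound; the integrals of the added
    constant are finite on both sides and cancel. *)
Lemma truncated_integral (g : E -> R) (C : R) :
  measurable_fun setT g -> (forall s, `|g s| <= C) ->
  \int[truncated_measure m]_(s in orthant) g s =
  \int[m]_(s in orthant0) (g s * tnorm s).
Proof.
move=> mg gC.
have C0 : 0 <= C by apply: le_trans (gC 0).
have mC : measurable_fun setT (fun s : E => g s + C) by apply: measurable_funD.
have gC0 s : 0 <= g s + C by have := gC s; rewrite ler_norml => /andP[+ _]; lra.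
have e1 : \int[truncated_measure m]_(s in orthant) (g s + C) =
    \int[m]_(s in orthant0) ((g s + C) * tnorm s).
  by rewrite /Rintegral ge0_truncated_integral.
have e2 : \int[truncated_measure m]_(s in orthant) (cst C s) =
    \int[m]_(s in orthant0) (cst C s * tnorm s).
  by rewrite /Rintegral ge0_truncated_integral.
have mO : measurable (orthant : set E) := measurable_orthant.
have mO0 : measurable (orthant0 : set E) := measurable_orthant0.
have ig : (truncated_measure m).-integrable orthant (EFin \o (g : E -> R)).
  apply: (@integrable_bounded _ _ _ _ _ _ C) => //; first exact: truncated_orthant_lty.
  exact: measurable_funTS.
have iC : (truncated_measure m).-integrable orthant (EFin \o (cst C : E -> R)).
  apply: (@integrable_bounded _ _ _ _ _ _ C) => //; first exact: truncated_orthant_lty.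
  by move=> s _ /=; rewrite ger0_norm.
have igt : m.-integrable orthant0 (EFin \o (fun s : E => g s * tnorm (s : W))).
  apply: (@levy_integrable _ C).
    apply: measurable_funTS; apply: measurable_funM => //; exact: measurable_tnorm.
  by move=> s _; rewrite normrM (ger0_norm (tnorm_ge0 s)) ler_wpM2r// tnorm_ge0.
have iCt : m.-integrable orthant0 (EFin \o (fun s : E => cst C s * tnorm (s : W))).
  exact: (integrableZl mO0 C levy_integrable_tnorm).
have : \int[truncated_measure m]_(s in orthant) (g s + C) =
  \int[truncated_measure m]_(s in orthant) g s +
  \int[truncated_measure m]_(s in orthant) (cst C s).
  exact: (RintegralD mO ig iC).
have -> : (fun s : E => (g s + C)) = (fun s => g s + cst C s) by [].
rewrite [in LHS]e1 e2.
have -> : (fun s : E => (g s + C) * tnorm (s : W)) =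
   (fun s : E => g s * tnorm (s : W) + cst C s * tnorm (s : W)).
  by apply/funext => s; rewrite mulrDl.
by rewrite (RintegralD mO0 igt iCt) => /addIr.
Qed.

End one_measure.

End levy_measures.

Section dominated_convergence_real.
Context d (T : measurableType d) (R : realType).
Variables (mu : {measure set T -> \bar R}) (D : set T).
Variables (f_ : nat -> T -> R) (f g : T -> R).

Lemma Rintegral_dominated_cvg : measurable D ->
  (forall n, measurable_fun D (f_ n)) ->
  (forall x, D x -> f_ n x @[n --> \oo] --> f x) ->
  mu.-integrable D (EFin \o g) -> (forall n x, D x -> `|f_ n x| <= g x) ->
  \int[mu]_(x in D) f_ n x @[n --> \oo] --> \int[mu]_(x in D) f x.
Proof.
move=> mD mf_ cf ig fg.
have mf : measurable_fun D f by exact: measurable_fun_cvg cf.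
have [] := @dominated_convergence _ _ _ mu D mD (fun n => EFin \o f_ n)
  (EFin \o f) (EFin \o g).
- by move=> n; exact/measurable_EFinP.
- exact/measurable_EFinP.
- by apply: aeW => x Dx; apply: cvg_EFin; [exact: nearW|exact: cf].
- exact: ig.
- by apply: aeW => x n Dx /=; rewrite lee_fin fg.
move=> fi _ cv; apply: fine_cvg; rewrite fineK//.
exact: integrable_fin_num.
Qed.

End dominated_convergence_real.

(** * From weak convergence of truncations to convergence of Levy integrals *)

Section weak_convergence.
Context {R : realType} {k : nat}.
Local Notation W := 'rV[R]_k.
Local Notation E := (borel_rV R k).

Let theta n (s : W) : R := Num.min (n.+1%:R * enorm s) 1.

Let theta_ge0 n s : 0 <= theta n s.
Proof. by rewrite le_min mulr_ge0 ?enorm_ge0/=. Qed.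

Let theta_le1 n s : theta n s <= 1.
Proof. by rewrite ge_min lexx orbT. Qed.

Let theta_cont n : continuous (theta n).
Proof.
move=> s; apply: (@continuous_min _ _ (fun s => n.+1%:R * enorm s) (cst 1));
  last exact: cst_continuous.
by apply: (@cvgM _ _ (nbhs s)); [exact: cvg_cst|exact: continuous_enorm].
Qed.

Let mtheta n : measurable_fun setT (theta n : E -> R).
Proof. by apply: measurable_continuous_rV; exact: theta_cont. Qed.

(** The truncation of a Levy measure has no atom at 0, the only point where 1 - theta n does not
    tend to 0. *)
Lemma cutoff_small (m : {measure set E -> \bar R}) : levy_measure m ->
  \int[truncated_measure m]_(s in orthant) (1 - theta n s) @[n --> \oo] --> 0.
Proof.
move=> ml.
rewrite (_ : (fun n => _) =
    (fun n => \int[m]_(s in orthant0) ((1 - theta n s) * tnorm s))); last first.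
  apply/funext => n; apply: (truncated_integral ml (C := 1)).
    by apply: measurable_funB.
  by move=> s; rewrite ger0_norm ?subr_ge0// lerBlDr lerDl.
have <- : \int[m]_(s in orthant0) ((cst 0 : E -> R) s) = 0.
  by rewrite Rintegral_cst ?mul0r//; exact: measurable_orthant0.
apply: (@Rintegral_dominated_cvg _ E _ m orthant0
  (fun n (s : E) => (1 - theta n s) * tnorm (s : W)) (cst 0) tnorm).
- exact: measurable_orthant0.
- move=> n; apply: measurable_funTS; apply: measurable_funM; last exact: measurable_tnorm.
  exact: measurable_funB.
- move=> s [_ /eqP s0]; have es := enorm_gt0 s0.
  apply: cvg_near_cst; near=> n.
  rewrite /theta min_r ?subrr ?mul0r// -ler_pdivrMr//.
  apply: ltW; apply: (@le_lt_trans _ _ (Num.truncn (1 / enorm s)).+1%:R).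
    by apply: ltW; exact: truncnS_gt.
  by rewrite ltr_nat ltnS; near: n; exact: nbhs_infty_gt.
- exact: levy_integrable_tnorm.
- move=> n s _; rewrite normrM (ger0_norm (tnorm_ge0 s)) ler_piMl ?tnorm_ge0//.
  by rewrite ger0_norm ?subr_ge0// lerBlDr lerDl.
Unshelve. all: by end_near. Qed.

Variables (nus : R -> {measure set E -> \bar R}) (G : set_system R).
Variable (m : {measure set E -> \bar R}).
Hypothesis FG : ProperFilter G.
Hypothesis nus_levy : \forall u \near G, levy_measure (nus u).
Hypothesis m_levy : levy_measure m.
Hypothesis nus_cvg : weak_cvg (fun u => truncated_measure (nus u)) G (truncated_measure m).

(* phi / tnorm has no continuous extension to 0 in general. Multiplied by the
   cutoff theta n it has one, and the error is at most the integral of 1 - theta n,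
   which is small for the limit measure, hence eventually for all measures. *)
Lemma levy_cvg (phi : W -> R) (C : R) : continuous phi ->
  (forall s, `|phi s| <= C * tnorm s) ->
  \int[nus u]_(s in orthant0) phi s @[u --> G] --> \int[m]_(s in orthant0) phi s.
Proof.
move=> cphi phiC.
have C0 : 0 <= `|C| by [].
have {}phiC s : `|phi s| <= `|C| * tnorm s.
  by apply: le_trans (phiC s) _; rewrite ler_wpM2r ?tnorm_ge0// ler_norm.
pose g n s := phi s * theta n s / tnorm s.
have gC n s : `|g n s| <= `|C| * theta n s.
  have [->|s0] := eqVneq s 0.
    by rewrite /g tnorm0 invr0 mulr0 normr0 mulr_ge0// theta_ge0.
  rewrite /g normrM normfV (gtr0_norm (tnorm_gt0 s0)) ler_pdivrMr ?tnorm_gt0//.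
  by rewrite normrM (ger0_norm (theta_ge0 n s)) mulrAC ler_wpM2r// theta_ge0.
have gC1 n s : `|g n s| <= `|C|.
  by apply: (le_trans (gC n s)); rewrite ler_piMr// theta_le1.
have cg n : continuous (g n).
  have cg0 : g n s @[s --> (0 : W)] --> g n 0.
    apply/(@cvgrPdist_le _ _ _ (nbhs (0 : W))) => e e0.
    (* The convention 0^-1 = 0 gives g the value 0 at the origin, which is its limit there, since |g
       n| <= |C| theta n. *)
    have g0 : g n 0 = 0 by rewrite /g tnorm0 invr0 mulr0.
    have th0 : theta n 0 = 0 by rewrite /theta enorm0 mulr0 min_l.
    have eC : 0 < e / (`|C| + 1) by rewrite divr_gt0// ltr_wpDl.
    have ct : theta n s @[s --> (0 : W)] --> theta n 0 by exact: theta_cont.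
    move/cvgrPdist_le : ct => /(_ _ eC)  ct.
    apply: (@filterS _ (nbhs (0 : W)) (nbhs_filter (0 : W)) _ _ _ ct) => t /=.
    rewrite th0 g0 !sub0r !normrN.
    rewrite (ger0_norm (theta_ge0 n t)) ler_pdivlMr ?ltr_wpDl// => h.
    apply: (le_trans (gC n t)); apply: le_trans h.
    by rewrite mulrC ler_wpM2l ?theta_ge0// lerDl.
  move=> s; have [->|s0] := eqVneq s 0; first exact: cg0.
  have t0 : tnorm s != 0 by rewrite gt_eqF// tnorm_gt0.
  apply: (@cvgM _ _ (nbhs s)); last first.
    by apply: cvgV => //; exact: continuous_tnorm.
  by apply: (@cvgM _ _ (nbhs s)); [exact: cphi|exact: theta_cont].
have mphi : measurable_fun setT (phi : E -> R) by exact: measurable_continuous_rV.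
have mg n : measurable_fun setT (g n : E -> R) by apply: measurable_continuous_rV; exact: cg.
have mO0 : measurable (orthant0 : set E) := measurable_orthant0.
have key n m' : levy_measure m' ->
    `|\int[m']_(s in orthant0) phi s - \int[truncated_measure m']_(s in orthant) g n s| <=
    `|C| * \int[truncated_measure m']_(s in orthant) (1 - theta n s).
  move=> ml'.
  have mt1 : measurable_fun setT (fun s : E => 1 - theta n s).
    exact: measurable_funB.
  rewrite (truncated_integral ml' (mg n) (gC1 n)).
  rewrite (@truncated_integral _ _ _ ml' (fun s : E => 1 - theta n s) 1)//; last first.
    by move=> s; rewrite ger0_norm ?subr_ge0// lerBlDr lerDl.
  have iphi : m'.-integrable orthant0 (EFin \o (phi : E -> R)).
    by apply: (levy_integrable ml' (C := `|C|)) => //; exact: measurable_funTS.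
  have igt : m'.-integrable orthant0 (EFin \o (fun s : E => g n s * tnorm (s : W))).
    apply: (levy_integrable ml' (C := `|C|)).
      by apply: measurable_funTS; apply: measurable_funM => //; exact: measurable_tnorm.
    by move=> s _; rewrite normrM (ger0_norm (tnorm_ge0 s)) ler_wpM2r ?tnorm_ge0.
  have itt : m'.-integrable orthant0 (EFin \o (fun s : E => (1 - theta n s) * tnorm (s : W))).
    apply: (levy_integrable ml' (C := 1)).
      by apply: measurable_funTS; apply: measurable_funM => //; exact: measurable_tnorm.
    move=> s _; rewrite normrM (ger0_norm (tnorm_ge0 s)) ler_wpM2r ?tnorm_ge0//.
    by rewrite ger0_norm ?subr_ge0// lerBlDr lerDl.
  rewrite -RintegralB// -(RintegralZl _ mO0 itt).
  have iCtt := integrableZl mO0 `|C| itt.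
  have mdiff : measurable_fun (orthant0 : set E)
      (fun s : E => phi s - g n s * tnorm (s : W)).
    apply: measurable_funTS; apply: measurable_funB => //.
    by apply: measurable_funM => //; exact: measurable_tnorm.
  have bnd (s : E) : orthant0 (s : W) -> `|phi s - g n s * tnorm (s : W)| <=
      `|C| * ((1 - theta n s) * tnorm (s : W)).
    move=> [_ /eqP s0].
    rewrite /g divfK ?gt_eqF ?tnorm_gt0// -{1}[phi s]mulr1 -mulrBr normrM.
    rewrite [X in _ * X]ger0_norm ?subr_ge0// mulrCA mulrC ler_wpM2l//.
    by rewrite subr_ge0.
  by have [] := Rintegral_norm_le mO0 mdiff iCtt bnd.
apply/cvgrPdist_le => e e0.
(* The cutoff costs e / 4 for the limit measure, hence e / 2 for nearby measures, whose cutoff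
   integral may exceed the limit one by this amount; e / 4 remains for the convergence of the
   integrals of g. *)
have eC : 0 < e / (4 * (`|C| + 1)) by rewrite divr_gt0// mulr_gt0// ltr_wpDl.
have /cvgrPdist_le/(_ _ eC)[n _ /(_ n (leqnn n))] := cutoff_small m_levy.
rewrite sub0r normrN => hn.
have ctheta1 : continuous (fun s : W => 1 - theta n s).
  by move=> s; apply: (@cvgB _ _ _ (nbhs s)); [exact: cvg_cst|exact: theta_cont].
have cvg1 : \int[truncated_measure (nus u)]_(s in orthant) (1 - theta n s)
    @[u --> G] --> \int[truncated_measure m]_(s in orthant) (1 - theta n s).
  apply: nus_cvg; first exact: continuous_subspaceT.
  exists 1 => s _; by rewrite ger0_norm ?subr_ge0// lerBlDr lerDl.
have cvg2 : \int[truncated_measure (nus u)]_(s in orthant) g n s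
    @[u --> G] --> \int[truncated_measure m]_(s in orthant) g n s.
  apply: nus_cvg; first exact: continuous_subspaceT.
  by exists `|C| => s _; exact: gC1.
have e4 : 0 < e / 4 by rewrite divr_gt0.
move/cvgrPdist_le : cvg1 => /(_ _ eC) near1.
move/cvgrPdist_le : cvg2 => /(_ _ e4) near2.
near=> u.
have lu : levy_measure (nus u) by near: u.
have h1 : `|\int[truncated_measure m]_(s in orthant) (1 - theta n s) -
  \int[truncated_measure (nus u)]_(s in orthant) (1 - theta n s)| <=
  e / (4 * (`|C| + 1)) by near: u.
have h2 : `|\int[truncated_measure m]_(s in orthant) g n s -
  \int[truncated_measure (nus u)]_(s in orthant) g n s| <= e / 4 by near: u.
have k1 := key n _ m_levy; have k2 := key n _ lu.
move: k1 k2 h1 h2 hn.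
set a := (\int[m]_(s in orthant0) phi s).
set b := (\int[truncated_measure m]_(s in orthant) g n s).
set x := (\int[truncated_measure m]_(s in orthant) (1 - theta n s)).
set a' := (\int[nus u]_(s in orthant0) phi s).
set b' := (\int[truncated_measure (nus u)]_(s in orthant) g n s).
set y := (\int[truncated_measure (nus u)]_(s in orthant) (1 - theta n s)).
move=> k1 k2 h1 h2 hn.
have C1 : 0 < `|C| + 1 by rewrite ltr_wpDl.
have xe : `|C| * x <= e / 4.
  apply: (@le_trans _ _ ((`|C| + 1) * (e / (4 * (`|C| + 1))))).
    have x_le := le_trans (ler_norm _) hn.
    by rewrite (le_trans (ler_wpM2l C0 x_le))// ler_wpM2r ?(ltW eC)// lerDl.
  by rewrite le_eqVlt; apply/orP; left; apply/eqP; field; rewrite gt_eqF.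
have ye : `|C| * y <= e / 2.
  apply: (@le_trans _ _ (`|C| * x + (`|C| + 1) * (e / (4 * (`|C| + 1))))).
    have y_le : y <= x + e / (4 * (`|C| + 1)) by move: h1; rewrite ler_norml; lra.
    rewrite (le_trans (ler_wpM2l C0 y_le))// mulrDr lerD2l.
    by rewrite ler_wpM2r ?(ltW eC)// lerDl.
  have -> : (`|C| + 1) * (e / (4 * (`|C| + 1))) = e / 4 by field; rewrite gt_eqF.
  lra.
move: k1 k2 h2; rewrite !ler_norml => /andP[? ?] /andP[? ?] /andP[? ?].
by apply/andP; split; lra.
Unshelve. all: by end_near. Qed.

End weak_convergence.

(** * Functions with one-sided limits or finitely many discontinuities *)

Section regulated_functions.
Context {R : realType}.
Implicit Types (f : R -> R) (t T : R).

Lemma regulated_bounded f T :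
  (forall t, 0 <= t -> cvg (f u @[u --> t^'+])) ->
  (forall t, 0 < t -> cvg (f u @[u --> t^'-])) ->
  exists M, forall t, 0 <= t <= T -> `|f t| <= M.
Proof.
move=> fr fl.
pose P (M t : R) := 0 <= t -> `|f t| <= M.
have : \forall M \near +oo, `[0, T]%classic `<=` P M.
  apply: ((compact_near_coveringP `[0, T]%classic).1 (@segment_compact R 0 T)).
  move=> x; rewrite /= in_itv/= => /andP[x0 xT].
  have [br Hr] : exists br, \forall u \near x, x < u -> `|f u| <= br.
    have /cvg_ex[l /cvgrPdist_le/(_ _ ltr01)] := fr x x0.
    rewrite near_withinE => H; exists (`|l| + 1); apply: filterS H => u Hu xu.
    have := Hu xu; rewrite distrC => h; rewrite -[f u](subrK l) addrC.
    by rewrite (le_trans (ler_normD _ _))// lerD2l.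
  have [bl Hl] : exists bl, \forall u \near x, u < x -> 0 <= u -> `|f u| <= bl.
    have [xe|xn0] := eqVneq x 0.
      by exists 0; near=> u => u0 u0'; rewrite xe ltNge u0' in u0.
    have xp : 0 < x by rewrite lt_neqAle eq_sym xn0.
    have /cvg_ex[l /cvgrPdist_le/(_ _ ltr01)] := fl x xp.
    rewrite near_withinE => H; exists (`|l| + 1); apply: filterS H => u Hu xu _.
    have := Hu xu; rewrite distrC => h; rewrite -[f u](subrK l) addrC.
    by rewrite (le_trans (ler_normD _ _))// lerD2l.
  have Hx : \forall u \near x,
      (x < u -> `|f u| <= br) /\ (u < x -> 0 <= u -> `|f u| <= bl).
    by apply: filterI.
  have HM : \forall M \near +oo, br <= M /\ (bl <= M /\ `|f x| <= M).
    by apply: filterI; [|apply: filterI]; exact: nbhs_pinfty_ge (num_real _).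
  exists ([set u | (x < u -> `|f u| <= br) /\ (u < x -> 0 <= u -> `|f u| <= bl)],
    [set M | br <= M /\ (bl <= M /\ `|f x| <= M)]).
    by split; [exact: Hx|exact: HM].
  move=> [u M] /= [[ur ul] [brM [blM fxM]]] u0.
  have [xu|ux|<-//] := ltgtP x u; first exact: le_trans (ur xu) brM.
  exact: le_trans (ul ux u0) blM.
move=> [M0 [_ HM]]; exists (M0 + 1) => t tT.
have /HM : M0 < M0 + 1 by rewrite ltrDl.
by apply; [rewrite /= in_itv|case/andP: tT].
Unshelve. all: by end_near. Qed.

(** On the finite set every preimage is finite, hence measurable; on its complement in [0, T] the
    function is continuous. *)
Lemma measurable_piecewise f T (N : set R) : finite_set N ->
  (forall t, 0 <= t -> ~ N t ->
    f u @[u --> within [set u | 0 <= u] (nbhs t)] --> f t) ->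
  measurable_fun (`[0, T]%classic : set (measurableTypeR R)) f.
Proof.
move=> finN cf.
have mN : measurable (N : set (measurableTypeR R)).
  by apply: countable_measurable; [move=> t; exact: measurable_set1|exact: finite_set_countable].
rewrite -(setDUK (_ : `[0, T] `&` N `<=` `[0, T])); last exact: subIsetl.
apply/measurable_funU.
- exact: measurableI.
- by apply: measurableD => //; exact: measurableI.
split.
  move=> _ B mB; apply: countable_measurable; first by move=> t; exact: measurable_set1.
  apply: finite_set_countable; apply: sub_finite_set finN.
  by move=> t [[]].
apply: subspace_continuous_measurable_fun.
  by apply: measurableD => //; exact: measurableI.
apply/subspace_continuousP => t [/=]; rewrite in_itv/= => /andP[t0 tT] tN.
have tI : `[0, T]%classic t by rewrite /= in_itv/= t0 tT.
have {}tN : ~ N t by move=> Nt; exact: (tN (conj tI Nt)).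
have := cf t t0 tN; apply: cvg_trans; apply: cvg_fmap2.
move=> A; rewrite /within/= !near_simpl; apply: filterS => u Au [uT _].
by apply: Au; move: uT; rewrite /= in_itv/= => /andP[].
Qed.

End regulated_functions.

Section levy_exponent.
Context {R : realType} {k : nat}.
Local Notation W := 'rV[R]_k.
Local Notation E := (borel_rV R k).
Local Open Scope complex_scope.

Definition psi_re (m : {measure set E -> \bar R}) (xi : W) : R :=
  \int[m]_(s in orthant0) (cos (dot xi s) - 1).

Definition psi_im (c : W) (m : {measure set E -> \bar R}) (xi : W) : R :=
  dot c xi + \int[m]_(s in orthant0) sin (dot xi s).

Lemma levy_exponentE c m xi :
  levy_exponent c m xi = psi_re m xi +i* psi_im c m xi.
Proof.
rewrite /levy_exponent /cintegral /psi_re /psi_im.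
congr (_ +i* _); rewrite ?add0r.
  apply: eq_Rintegral => s _ /=.
  by rewrite expR0 mul1r dotC.
congr (_ + _); apply: eq_Rintegral => s _ /=.
by rewrite expR0 mul1r dotC oppr0 addr0.
Qed.

Lemma additive_exponentE (c : R -> W) (nu : R -> {measure set E -> \bar R}) t xi :
  additive_exponent c nu t xi =
  (\int[lebesgue_measure]_(u in `[0, t]) psi_re (nu u) xi) +i*
  (\int[lebesgue_measure]_(u in `[0, t]) psi_im (c u) (nu u) xi).
Proof.
rewrite /additive_exponent /cintegral.
by congr (_ +i* _); apply: eq_Rintegral => u _; rewrite levy_exponentE.
Qed.

Lemma char_funE d (T : measurableType d) (P : probability T R) (Y : T -> W) xi :
  char_fun P Y xi = (\int[P]_w cos (dot xi (Y w))) +i*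
                    (\int[P]_w sin (dot xi (Y w))).
Proof.
rewrite /char_fun /cintegral; congr (_ +i* _); apply: eq_Rintegral => w _ /=;
  by rewrite expR0 mul1r.
Qed.

End levy_exponent.

(** * Laws and characteristic functions of the increments *)

Section increments.
Context {R : realType} {k : nat} {dO : measure_display} {Omega : measurableType dO}.
Local Notation W := 'rV[R]_k.
Local Notation E := (borel_rV R k).
Variables (P : probability Omega R) (S : R -> Omega -> W).
Variable (pi : R -> R -> probability E R).
Hypothesis S_sub : additive_subordinator P S.
Hypothesis pi_law : forall t1 t2 A, 0 <= t1 -> t1 <= t2 -> measurable A ->
  pi t1 t2 A = P [set w | A (S t2 w - S t1 w)].

Let mO : measurable (orthant : set E) := measurable_orthant.

Lemma measurable_increment a b : 0 <= a -> 0 <= b ->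
  measurable_fun setT ((fun w => S b w - S a w) : Omega -> E).
Proof.
move=> a0 b0; apply: measurable_rV => j.
have mS t : 0 <= t -> measurable_fun setT (fun w => S t w 0 j).
  move=> t0; apply: (measurableT_comp (measurable_coord j)).
  exact: subordinator_measurable S_sub _ t0.
rewrite (_ : (fun _ => _) = (fun w => S b w 0 j - S a w 0 j)).
  by apply: measurable_funB; exact: mS.
by apply/funext => w; rewrite !mxE.
Qed.

Lemma increment_ge0 a b : 0 <= a -> a <= b ->
  {ae P, forall w, orthant (S b w - S a w)}.
Proof.
move=> a0 ab; have := subordinator_increasing S_sub.
apply: filterS => w H j; rewrite !mxE subr_ge0.
exact: H.
Qed.

Lemma Rintegral_increment a b (g : W -> R) (C : R) : 0 <= a -> a <= b ->
  {within orthant, continuous g} -> (forall s, orthant s -> `|g s| <= C) ->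
  \int[pi a b]_(s in orthant) g s =
  \int[P]_(w in (fun w => S b w - S a w) @^-1` orthant) g (S b w - S a w).
Proof.
move=> a0 ab cg gC; have b0 := le_trans a0 ab.
apply: (Rintegral_law (measurable_increment a0 b0) _ cg gC).
by move=> U mU; exact: pi_law.
Qed.

Lemma RintegralT_increment a b (g : W -> R) (C : R) : 0 <= a -> a <= b ->
  measurable_fun setT (g : E -> R) -> continuous g -> (forall s, `|g s| <= C) ->
  \int[pi a b]_(s in orthant) g s = \int[P]_w g (S b w - S a w).
Proof.
move=> a0 ab mg cg gC; have b0 := le_trans a0 ab.
rewrite (@Rintegral_increment a b g C)//; last exact: continuous_subspaceT.
have mD := measurable_increment a0 b0.
apply: Rintegral_ae_sub => //.
- by rewrite -[X in measurable X]setTI; exact: mD.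
- exact: (measurableT_comp mg mD).
- exact: increment_ge0.
Qed.

Lemma pi_orthant a b : 0 <= a -> a <= b -> pi a b orthant = 1%E.
Proof.
move=> a0 ab; have b0 := le_trans a0 ab; rewrite pi_law//.
have mD := measurable_increment a0 b0.
have mA : measurable [set w | orthant (S b w - S a w)].
  by rewrite -[X in measurable X]setTI; exact: mD.
have [B [mB B0 BD]] := increment_ge0 a0 ab.
have AC0 : P (~` [set w | orthant (S b w - S a w)]) = 0%E.
  by apply: (subset_measure0 (mu := P)) B0 => //; exact: measurableC.
by have := probability_setC P mA; rewrite AC0 => /esym/eqP; rewrite sube_eq ?fin_num_measure// add0e => /eqP.
Qed.

Lemma increments_independent a b e (U U' : set E) : 0 <= a -> a <= b -> b <= e ->
  measurable U -> measurable U' ->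
  P (((fun w => S b w - S a w) @^-1` U) `&` ((fun w => S e w - S b w) @^-1` U')) =
  (pi a b U * pi b e U')%E.
Proof.
move=> a0 ab be mU mU'; have b0 := le_trans a0 ab.
(* Independence is stated along a whole sequence of times, so the sequence a, b, e is continued by
   the constant e. *)
pose t (i : nat) := if i is i'.+1 then (if i' is _.+1 then e else b) else a.
pose B (i : 'I_2) := if val i == 0%N then U else U'.
have := @subordinator_increments _ _ _ _ _ _ S_sub 2 t B a0.
rewrite big_ord_recl big_ord1 /= -!pi_law//.
move=> H; rewrite -H.
- congr (P _); apply/seteqP; split => w /=.
    by move=> [w1 w2] [[|[|i]] //= i2] _.
  by move=> h; split; [exact: (h (Ordinal (isT : 0 < 2)%N))|exact: (h (Ordinal (isT : 1 < 2)%N))].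
- by case=> [|[|i]] //=.
- by move=> [[|[|i]] //= i2].
Qed.

Section characteristic_function.
Variable xi : W.
Local Notation IC a b := (\int[pi a b]_(s in orthant) cos (dot xi s)).
Local Notation IS a b := (\int[pi a b]_(s in orthant) sin (dot xi s)).

Let ccos : continuous (fun s : W => cos (dot xi s)).
Proof.
by move=> s; apply: continuous_comp; [exact: continuous_dot|exact: continuous_cos].
Qed.

Let csin : continuous (fun s : W => sin (dot xi s)).
Proof.
by move=> s; apply: continuous_comp; [exact: continuous_dot|exact: continuous_sin].
Qed.

Let icos a b : (pi a b).-integrable orthant (EFin \o (fun s : E => cos (dot xi (s : W)))).
Proof.
apply: (@integrable_prob _ _ _ _ _ _ 1) => //.
  by apply: measurable_funTS; exact: measurable_cos_dot.
by move=> s _; exact: cos_max.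
Qed.

Let isin a b : (pi a b).-integrable orthant (EFin \o (fun s : E => sin (dot xi (s : W)))).
Proof.
apply: (@integrable_prob _ _ _ _ _ _ 1) => //.
  by apply: measurable_funTS; exact: measurable_sin_dot.
by move=> s _; exact: sin_max.
Qed.

Let dotDr (s r : W) : dot xi (s + r) = dot xi s + dot xi r.
Proof. by rewrite dotC dotDl !(dotC _ xi). Qed.

Let conv_law a b e (f : R -> R) : 0 <= a -> a <= b -> b <= e ->
  continuous f -> (forall y, `|f y| <= 1) ->
  \int[pi a e]_(s in orthant) f (dot xi s) =
  \int[pi a b]_(s in orthant) \int[pi b e]_(r in orthant) f (dot xi s + dot xi r).
Proof.
move=> a0 ab be cf f1; have b0 := le_trans a0 ab; have e0 := le_trans b0 be.
have cfx : continuous (fun s : W => f (dot xi s)).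
  by move=> s; apply: continuous_comp; [exact: continuous_dot|exact: cf].
have mfx : measurable_fun setT ((fun s : W => f (dot xi s)) : E -> R).
  exact: measurable_continuous_rV.
have cshift y : continuous (fun s : W => f (y + dot xi s)).
  move=> s; apply: continuous_comp; last exact: cf.
  by apply: (@cvgD _ _ _ (nbhs s)); [exact: cvg_cst|exact: continuous_dot].
rewrite (@RintegralT_increment a e _ 1) ?(le_trans ab)//.
have mA := measurable_increment a0 b0; have mB := measurable_increment b0 e0.
rewrite -(@Rintegral_independent _ _ _ _ P (fun w => S b w - S a w)
  (fun w => S e w - S b w) (pi a b) (pi b e)
  (fun s r => f (dot xi s + dot xi r)) 1)//.
- apply/esym.
  rewrite (@eq_Rintegral _ _ _ _ _ (fun w => f (dot xi (S e w - S a w)))); last first.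
    move=> w _; rewrite -dotDr; congr (f (dot xi _)).
    by rewrite addrC addrA subrK.
  apply: Rintegral_ae_sub => //.
  + by apply: measurableI; rewrite -[X in measurable X]setTI; [exact: mA|exact: mB].
  + exact: (measurableT_comp mfx (measurable_increment a0 e0)).
  + by apply: filterS2 (increment_ge0 a0 ab) (increment_ge0 b0 be) => w Aw Bw; split.
- by move=> U U' mU mU'; exact: increments_independent.
- move=> r _; apply: continuous_subspaceT => s.
  have := cshift (dot xi r) s; rewrite /continuous_at.
  by under eq_fun do rewrite addrC; rewrite addrC.
- by move=> s _; apply: continuous_subspaceT; exact: cshift.
Qed.

(** Real part of the multiplicativity of characteristic functions over adjacent independent
    increments; [increment_sinD] is the imaginary part. *)
Lemma increment_cosD a b e : 0 <= a -> a <= b -> b <= e ->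
  IC a e = IC a b * IC b e - IS a b * IS b e.
Proof.
move=> a0 ab be; rewrite (@conv_law a b e cos)//.
- rewrite (@eq_Rintegral _ _ _ _ _ (fun s : E => cos (dot xi (s : W)) * IC b e -
    sin (dot xi (s : W)) * IS b e)).
    rewrite RintegralB//; last 2 first.
    + apply: (@integrable_prob _ _ _ _ _ _ `|IC b e|) => //.
        apply: measurable_funTS; apply: measurable_funM => //; exact: measurable_cos_dot.
      by move=> s _; rewrite normrM ler_piMl// cos_max.
    + apply: (@integrable_prob _ _ _ _ _ _ `|IS b e|) => //.
        apply: measurable_funTS; apply: measurable_funM => //; exact: measurable_sin_dot.
      by move=> s _; rewrite normrM ler_piMl// sin_max.
    by rewrite (RintegralZr _ mO (icos a b)) (RintegralZr _ mO (isin a b)).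
  move=> s _; under eq_Rintegral do rewrite cosD.
  rewrite RintegralB//; last 2 first.
  + exact: (integrableZl mO _ (icos b e)).
  + exact: (integrableZl mO _ (isin b e)).
  by rewrite (RintegralZl _ mO (icos b e)) (RintegralZl _ mO (isin b e)).
- exact: continuous_cos.
- exact: cos_max.
Qed.

Lemma increment_sinD a b e : 0 <= a -> a <= b -> b <= e ->
  IS a e = IS a b * IC b e + IC a b * IS b e.
Proof.
move=> a0 ab be; rewrite (@conv_law a b e sin)//.
- rewrite (@eq_Rintegral _ _ _ _ _ (fun s : E => sin (dot xi (s : W)) * IC b e +
    cos (dot xi (s : W)) * IS b e)).
    rewrite RintegralD//; last 2 first.
    + apply: (@integrable_prob _ _ _ _ _ _ `|IC b e|) => //.
        apply: measurable_funTS; apply: measurable_funM => //; exact: measurable_sin_dot.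
      by move=> s _; rewrite normrM ler_piMl// sin_max.
    + apply: (@integrable_prob _ _ _ _ _ _ `|IS b e|) => //.
        apply: measurable_funTS; apply: measurable_funM => //; exact: measurable_cos_dot.
      by move=> s _; rewrite normrM ler_piMl// cos_max.
    by rewrite (RintegralZr _ mO (isin a b)) (RintegralZr _ mO (icos a b)).
  move=> s _; under eq_Rintegral do rewrite sinD.
  rewrite RintegralD//; last 2 first.
  + exact: (integrableZl mO _ (icos b e)).
  + exact: (integrableZl mO _ (isin b e)).
  by rewrite (RintegralZl _ mO (icos b e)) (RintegralZl _ mO (isin b e)).
- exact: continuous_sin.
- exact: sin_max.
Qed.

Lemma increment_from0 t (f : R -> R) : 0 <= t -> continuous f ->
  (forall y, `|f y| <= 1) ->
  \int[pi 0 t]_(s in orthant) f (dot xi s) = \int[P]_w f (dot xi (S t w)).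
Proof.
move=> t0 cf f1.
have cfx : continuous (fun s : W => f (dot xi s)).
  by move=> s; apply: continuous_comp; [exact: continuous_dot|exact: cf].
have mfx : measurable_fun setT ((fun s : W => f (dot xi s)) : E -> R).
  exact: measurable_continuous_rV.
rewrite (@RintegralT_increment 0 t _ 1)//; congr fine.
apply: ae_eq_integral => //.
- apply/measurable_EFinP; exact: (measurableT_comp mfx (measurable_increment (lexx 0) t0)).
- apply/measurable_EFinP; apply: (measurableT_comp mfx).
  exact: subordinator_measurable S_sub _ t0.
have := subordinator_start S_sub; apply: filterS => w -> _.
by rewrite subr0.
Qed.

End characteristic_function.

End increments.

(** * Difference quotients of time integrals and of exponentials *)

Section difference_quotients.
Context {R : realType}.
Local Notation leb := (@lebesgue_measure R).

Lemma integral_itv_diff_le (f : R -> R) (t h y M : R) : 0 <= t -> 0 < h ->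
  leb.-integrable `[0, t + h] (EFin \o f) ->
  (forall v, t < v <= t + h -> `|f v - y| <= M) ->
  `|\int[leb]_(v in `[0, t + h]) f v - \int[leb]_(v in `[0, t]) f v - y * h| <= M * h.
Proof.
move=> t0 h0 fi fM.
have tth : t <= t + h by rewrite lerDl ltW.
rewrite (@Rintegral_itvB _ f (BLeft 0) (BRight (t + h)) t)//.
have mD : measurable (`]t, t + h]%classic : set (measurableTypeR R)) by [].
have hE : fine (leb `]t, t + h]) = h.
  rewrite lebesgue_measure_itv /= lte_fin ltrDl h0 /=.
  by rewrite addrAC subrr add0r.
have Dlty : (leb `]t, (t + h)%R] < +oo)%E.
  by rewrite lebesgue_measure_itv /= lte_fin ltrDl h0 -EFinD ltry.
have fi' : leb.-integrable `]t, t + h] (EFin \o f).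
  apply: integrableS fi => //; apply: subset_itvr => //.
have yi z : leb.-integrable `]t, t + h] (EFin \o (cst z : R -> R)).
  apply: (@integrable_bounded _ _ _ _ _ _ `|z|) => //.
have -> : y * h = \int[leb]_(v in `]t, t + h]) (cst y v).
  by rewrite Rintegral_cst// hE.
have -> : M * h = \int[leb]_(v in `]t, t + h]) (cst M v).
  by rewrite Rintegral_cst// hE.
rewrite -RintegralB//.
have mf : measurable_fun (`]t, t + h]%classic : set (measurableTypeR R)) (fun v => f v - cst y v).
  apply: measurable_funB => //.
  by apply/measurable_EFinP; have /integrableP[] := fi'.
have bnd v : `]t, t + h]%classic v -> `|f v - cst y v| <= cst M v.
  by rewrite /= in_itv/=; exact: fM.
by have [] := Rintegral_norm_le mD mf (yi M) bnd.
Qed.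

Lemma cvg_near_dist (T : Type) (F : set_system T) (FF : ProperFilter F)
    (X Y err : T -> R) (a : R) :
  Y x @[x --> F] --> a -> err x @[x --> F] --> 0 ->
  (\forall x \near F, `|X x - Y x| <= err x) -> X x @[x --> F] --> a.
Proof.
move=> Ya err0 XY; apply/cvgrPdist_le => e e0.
have e20 : 0 < e / 2 by rewrite divr_gt0.
move/cvgrPdist_le : Ya => /(_ _ e20) Ya.
move/cvgrPdist_le : err0 => /(_ _ e20) err0.
near=> x.
have h1 : `|a - Y x| <= e / 2 by near: x.
have h2 : `|0 - err x| <= e / 2 by near: x.
have h3 : `|X x - Y x| <= err x by near: x.
move: h1 h2 h3; rewrite !ler_norml => /andP[? ?] /andP[? ?] /andP[? ?].
by apply/andP; split; lra.
Unshelve. all: by end_near. Qed.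

(** Both bounds come from 1 + x <= exp x, at a and at -a; then (1 + a + a^2)(1 - a) = 1 - a^3 >=
    1. *)
Lemma expR_sub1_le0 (a : R) : a <= 0 -> `|expR a - 1 - a| <= a ^+ 2.
Proof.
move=> a0.
have h1 : 1 + a <= expR a by exact: expR_ge1Dx.
have h2 : expR a <= (1 - a)^-1.
  have p : 0 < 1 - a by lra.
  rewrite -[a in leLHS]opprK expRN lef_pV2 ?posrE ?expR_gt0//.
  exact: expR_ge1Dx.
have h3 : (1 - a)^-1 <= 1 + a + a ^+ 2.
  rewrite -[leLHS]mul1r ler_pdivrMr; last lra.
  rewrite (_ : _ * _ = 1 - a ^+ 3); last ring.
  have : a ^+ 3 <= 0 by rewrite exprS mulr_le0_ge0// sqr_ge0.
  lra.
by rewrite ger0_norm; lra.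
Qed.

Lemma expR_cos_sub1 (a b : R) : a <= 0 ->
  `|expR a * cos b - 1 - a| <= a ^+ 2 + b ^+ 2.
Proof.
move=> a0.
have -> : expR a * cos b - 1 - a = (expR a - 1 - a) - expR a * (1 - cos b) by ring.
apply: (le_trans (ler_normB _ _)); apply: lerD; first exact: expR_sub1_le0.
rewrite normrM !ger0_norm ?subr1_cos_ge0 ?expR_ge0//.
apply: (@le_trans _ _ (1 * (b ^+ 2 / 2))).
  by rewrite ler_pM ?subr1_cos_ge0 ?expR_ge0 ?subr1_cos_le// -expR0 ler_expR.
have := sqr_ge0 b; lra.
Qed.

Lemma sub_sin_norm (b : R) : `|sin b - b| <= `|b| * b ^+ 2.
Proof.
wlog b0 : b / 0 <= b.
  move=> H; have [/H//|/ltW b0] := leP 0 b.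
  have := H (- b); rewrite sinN -opprD normrN normrN sqrrN.
  by rewrite oppr_ge0; exact.
rewrite distrC (le_trans (subr_sin_le b0))// ger0_norm//.
by rewrite ler_wpM2l//; have := sqr_ge0 b; lra.
Qed.

Lemma expR_sin_sub (a b : R) : a <= 0 ->
  `|expR a * sin b - b| <= `|a| * `|b| + `|b| * b ^+ 2.
Proof.
move=> a0.
have -> : expR a * sin b - b = (expR a - 1) * sin b + (sin b - b) by ring.
apply: (le_trans (ler_normD _ _)); apply: lerD; last exact: sub_sin_norm.
rewrite normrM ler_pM// ?sin_le//.
rewrite ler0_norm; last by rewrite subr_le0 -expR0 ler_expR.
by rewrite ler0_norm//; have := expR_ge1Dx a; lra.
Qed.

Lemma subr1_expR_cos_le (a b : R) : a <= 0 -> 1 - expR a * cos b <= `|a| + `|b|.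
Proof.
move=> a0; have e1 : expR a <= 1 by rewrite -expR0 ler_expR.
have h1 : 1 + a <= expR a := expR_ge1Dx a.
have -> : 1 - expR a * cos b = (1 - expR a) + expR a * (1 - cos b) by ring.
apply: lerD; first by rewrite ler0_norm//; lra.
apply: (@le_trans _ _ (1 * (1 - cos b))); first by rewrite ler_wpM2r ?subr1_cos_ge0.
rewrite mul1r; have := cos_lip 0 b; rewrite cos0 sub0r normrN.
by rewrite ger0_norm ?subr1_cos_ge0.
Qed.

Section exponential_limit.
Variables (al be : R -> R) (a b : R).
Hypothesis al0 : \forall h \near 0^'+, al h <= 0.
Hypothesis al_cvg : h^-1 * al h @[h --> 0^'+] --> a.
Hypothesis be_cvg : h^-1 * be h @[h --> 0^'+] --> b.

Let cvgh : (h : R) @[h --> 0^'+] --> (0 : R).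
Proof. exact: (cvg_at_right_filter (f := id) cvg_id). Qed.

(** As [al] and [be] are O(h), the quadratic error al^2 + be^2 is still O(h) after division by h. *)
Lemma expR_cos_cvg : h^-1 * (expR (al h) * cos (be h) - 1) @[h --> 0^'+] --> a.
Proof.
apply: (@cvg_near_dist _ _ _ _ (fun h => h^-1 * al h)
  (fun h => h * ((h^-1 * al h) ^+ 2 + (h^-1 * be h) ^+ 2))) => //.
  rewrite -[X in _ --> X](mul0r (a * a + b * b)).
  apply: cvgM => //; apply: cvgD.
    by under eq_fun do rewrite expr2; apply: cvgM.
  by under eq_fun do rewrite expr2; apply: cvgM.
near=> h; have h0 : 0 < h by near: h; exact: nbhs_right_gt.
have a0 : al h <= 0 by near: h.
rewrite -mulrBr normrM (gtr0_norm (_ : 0 < h^-1)) ?invr_gt0//.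
rewrite -(ler_pM2l h0) mulrA divff ?gt_eqF// mul1r.
apply: (le_trans (expR_cos_sub1 _ a0)).
by rewrite le_eqVlt; apply/orP; left; apply/eqP; field; rewrite gt_eqF.
Unshelve. all: by end_near. Qed.

Lemma expR_sin_cvg : h^-1 * (expR (al h) * sin (be h)) @[h --> 0^'+] --> b.
Proof.
apply: (@cvg_near_dist _ _ _ _ (fun h => h^-1 * be h)
  (fun h => h * (`|h^-1 * al h| * `|h^-1 * be h|) +
            h * h * (`|h^-1 * be h| * (h^-1 * be h) ^+ 2))) => //.
  rewrite -[X in _ --> X](_ : 0 * (`|a| * `|b|) + 0 * 0 * (`|b| * (b * b)) = 0); last by ring.
  apply: cvgD; apply: cvgM => //.
  - by apply: cvgM; apply: cvg_norm.
  - by apply: cvgM.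
  - apply: cvgM; first exact: cvg_norm.
    by under eq_fun do rewrite expr2; apply: cvgM.
near=> h; have h0 : 0 < h by near: h; exact: nbhs_right_gt.
have a0 : al h <= 0 by near: h.
have hV : 0 < h^-1 by rewrite invr_gt0.
rewrite -mulrBr normrM (gtr0_norm hV).
rewrite -(ler_pM2l h0) mulrA divff ?gt_eqF// mul1r.
apply: (le_trans (expR_sin_sub _ a0)).
rewrite !normrM (gtr0_norm hV).
by rewrite le_eqVlt; apply/orP; left; apply/eqP; field; rewrite gt_eqF.
Unshelve. all: by end_near. Qed.

End exponential_limit.

End difference_quotients.

(** * From the characteristics of the subordinator to its small-time behaviour *)

Section additive_characteristics.
Context {R : realType} {k : nat} {dO : measure_display} {Omega : measurableType dO}.
Local Notation W := 'rV[R]_k.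
Local Notation E := (borel_rV R k).
Local Notation leb := (@lebesgue_measure R).
Variables (P : probability Omega R) (S : R -> Omega -> W).
Variables (c : R -> W) (nu : R -> {measure set E -> \bar R}).
Variable (pi : R -> R -> probability E R).
Hypothesis S_sub : additive_subordinator P S.
Hypothesis c_ge0 : forall t : R, 0 <= t -> orthant (c t).
Hypothesis nu_levy : forall t : R, 0 <= t -> levy_measure (nu t).
Hypothesis S_char_fun : forall (t : R) xi, 0 <= t ->
  char_fun P (S t) xi = cexp (additive_exponent c nu t xi).
Hypothesis pi_law : forall t1 t2 A, 0 <= t1 -> t1 <= t2 -> measurable A ->
  pi t1 t2 A = P [set w | A (S t2 w - S t1 w)].
Hypothesis c_right_limit : forall (t : R) (j : 'I_k), 0 <= t ->
  cvg (c u 0 j @[u --> t^'+]).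
Hypothesis c_left_limit : forall (t : R) (j : 'I_k), 0 < t ->
  cvg (c u 0 j @[u --> t^'-]).
Hypothesis nuF_right_limit : forall t : R, 0 <= t ->
  exists m : {finite_measure set (borel_rV R k) -> \bar R},
    weak_cvg (fun u => truncated_measure (nu u)) t^'+ m.
Hypothesis nuF_left_limit : forall t : R, 0 < t ->
  exists m : {finite_measure set (borel_rV R k) -> \bar R},
    weak_cvg (fun u => truncated_measure (nu u)) t^'- m.
Hypothesis c_right_continuous : forall (t : R) (j : 'I_k), 0 <= t ->
  c u 0 j @[u --> t^'+] --> c t 0 j.
Hypothesis c_discontinuities : forall j : 'I_k, finite_set [set t : R | 0 <= t /\
  ~ (c u 0 j @[u --> within [set u : R | 0 <= u] (nbhs t)] --> c t 0 j)].
Hypothesis nuF_right_continuous : forall t : R, 0 <= t ->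
  weak_cvg (fun u => truncated_measure (nu u)) t^'+ (truncated_measure (nu t)).
Hypothesis nuF_discontinuities : finite_set [set t : R | 0 <= t /\
  ~ weak_cvg (fun u => truncated_measure (nu u))
      (within [set u : R | 0 <= u] (nbhs t)) (truncated_measure (nu t))].

Let cos1_cont (xi : W) : continuous (fun s : W => cos (dot xi s) - 1).
Proof.
move=> s; apply: (@cvgB _ _ _ (nbhs s)); last exact: cvg_cst.
by apply: continuous_comp; [exact: continuous_dot|exact: continuous_cos].
Qed.

Let sin_cont (xi : W) : continuous (fun s : W => sin (dot xi s)).
Proof.
by move=> s; apply: continuous_comp; [exact: continuous_dot|exact: continuous_sin].
Qed.

Let levy_right t : 0 <= t -> \forall u \near t^'+, levy_measure (nu u).
Proof.
move=> t0; near=> u; apply: nu_levy; apply: (le_trans t0); apply: ltW.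
by near: u; exact: nbhs_right_gt.
Unshelve. all: by end_near. Qed.

Let levy_right_cvg (t : R) (phi : W -> R) (C : R) : 0 <= t -> continuous phi ->
  (forall s, `|phi s| <= C * tnorm s) ->
  \int[nu u]_(s in orthant0) phi s @[u --> t^'+] --> \int[nu t]_(s in orthant0) phi s.
Proof.
move=> t0 cphi phiC.
exact: (levy_cvg _ (levy_right t0) (nu_levy t0) (nuF_right_continuous t0) cphi phiC).
Qed.

Let dot_right_cvg t xi : 0 <= t -> dot (c u) xi @[u --> t^'+] --> dot (c t) xi.
Proof.
move=> t0; apply: cvg_big => [|j _]; first exact: add_continuous.
apply: cvgM; last exact: cvg_cst.
exact: c_right_continuous.
Qed.

Let psi_re_right t xi : 0 <= t ->
  psi_re (nu u) xi @[u --> t^'+] --> psi_re (nu t) xi.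
Proof.
by move=> t0; exact: (levy_right_cvg t0 (@cos1_cont xi) (cos_dot_tnorm xi)).
Qed.

Let psi_im_right t xi : 0 <= t ->
  psi_im (c u) (nu u) xi @[u --> t^'+] --> psi_im (c t) (nu t) xi.
Proof.
move=> t0; apply: cvgD; first exact: dot_right_cvg.
exact: (levy_right_cvg t0 (@sin_cont xi) (sin_dot_tnorm xi)).
Qed.

(** The times outside which all coefficients are continuous, so that the exponent is measurable in
    time. *)
Let N := (\bigcup_(j in [set: 'I_k]) [set t : R | 0 <= t /\
  ~ (c u 0 j @[u --> within [set u : R | 0 <= u] (nbhs t)] --> c t 0 j)]) `|`
  [set t : R | 0 <= t /\
  ~ weak_cvg (fun u => truncated_measure (nu u))
      (within [set u : R | 0 <= u] (nbhs t)) (truncated_measure (nu t))].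

Let finN : finite_set N.
Proof.
rewrite finite_setU; split => //.
by apply: bigcup_finite; [exact: finite_finset|move=> j _; exact: c_discontinuities].
Qed.

Let within_proper (t : R) : 0 <= t -> ProperFilter (within [set u : R | 0 <= u] (nbhs t)).
Proof.
move=> t0; apply: within_nbhs_proper; apply: subset_closure.
by [].
Qed.

Let levy_within (t : R) : \forall u \near within [set u : R | 0 <= u] (nbhs t),
  levy_measure (nu u).
Proof. by rewrite near_withinE; apply: nearW => u; exact: nu_levy. Qed.

Let psi_re_within (t : R) xi : 0 <= t -> ~ N t ->
  psi_re (nu u) xi @[u --> within [set u : R | 0 <= u] (nbhs t)] --> psi_re (nu t) xi.
Proof.
move=> t0 Nt; have FF := within_proper t0.
have wc : weak_cvg (fun u => truncated_measure (nu u))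
    (within [set u : R | 0 <= u] (nbhs t)) (truncated_measure (nu t)).
  by apply: contrapT => H; apply: Nt; right.
apply: (levy_cvg FF (levy_within t) (nu_levy t0) wc); first exact: cos1_cont.
exact: cos_dot_tnorm.
Qed.

Let psi_im_within (t : R) xi : 0 <= t -> ~ N t ->
  psi_im (c u) (nu u) xi @[u --> within [set u : R | 0 <= u] (nbhs t)] -->
  psi_im (c t) (nu t) xi.
Proof.
move=> t0 Nt; have FF := within_proper t0.
have wc : weak_cvg (fun u => truncated_measure (nu u))
    (within [set u : R | 0 <= u] (nbhs t)) (truncated_measure (nu t)).
  by apply: contrapT => H; apply: Nt; right.
apply: cvgD; last first.
  apply: (levy_cvg FF (levy_within t) (nu_levy t0) wc); first exact: sin_cont.
  exact: sin_dot_tnorm.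
apply: cvg_big => [|j _]; first exact: add_continuous.
apply: cvgM; last exact: cvg_cst.
by apply: contrapT => H; apply: Nt; left; exists j.
Qed.

Let mass u : R := \int[truncated_measure (nu u)]_(s in orthant) (cst 1 : E -> R) s.

Let massE u : 0 <= u -> mass u = \int[nu u]_(s in orthant0) tnorm s.
Proof.
move=> u0; rewrite /mass (truncated_integral (nu_levy u0) (C := 1))//.
  by apply: eq_Rintegral => s _; rewrite mul1r.
by move=> s; rewrite normr1.
Qed.

(** Testing weak convergence against the constant 1 turns the one-sided limits of the measures into
    one-sided limits of their masses. *)
Let mass_bounded T : exists M, forall t, 0 <= t <= T -> `|mass t| <= M.
Proof.
apply: regulated_bounded => t t0.
  have [m mP] := nuF_right_limit t0; apply/cvg_ex.
  exists (\int[m]_(s in orthant) (cst 1 : E -> R) s); apply: mP.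
    by apply: continuous_subspaceT => s; exact: cst_continuous.
  by exists 1 => s _; rewrite normr1.
have [m mP] := nuF_left_limit t0; apply/cvg_ex.
exists (\int[m]_(s in orthant) (cst 1 : E -> R) s); apply: mP.
  by apply: continuous_subspaceT => s; exact: cst_continuous.
by exists 1 => s _; rewrite normr1.
Qed.

Let integral_le_mass u (phi : W -> R) (C : R) : 0 <= u -> continuous phi ->
  (forall s, `|phi s| <= C * tnorm s) ->
  `|\int[nu u]_(s in orthant0) phi s| <= C * mass u.
Proof.
move=> u0 cphi phiC; rewrite massE// -RintegralZl; last 2 first.
- exact: measurable_orthant0.
- exact: levy_integrable_tnorm (nu_levy u0).
have iC := integrableZl (measurable_orthant0 : measurable (orthant0 : set E)) C
  (levy_integrable_tnorm (nu_levy u0)).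
have mphi : measurable_fun (orthant0 : set E) (phi : E -> R).
  by apply: measurable_funTS; exact: measurable_continuous_rV.
by have [] := Rintegral_norm_le measurable_orthant0 mphi iC (fun s _ => phiC s).
Qed.

Let itv_lty (T : R) : (leb `[0%R, T] < +oo)%E.
Proof. by rewrite lebesgue_measure_itv /=; case: ifP => _; rewrite ?ltry// -EFinD ltry. Qed.

Let psi_re_integrable xi T :
  leb.-integrable `[0, T] (EFin \o (fun u => psi_re (nu u) xi)).
Proof.
have [M MP] := mass_bounded T; have Tlty := @itv_lty T.
have mf : measurable_fun (`[0, T]%classic : set (measurableTypeR R)) (fun u => psi_re (nu u) xi).
  apply: (@measurable_piecewise R (fun u => psi_re (nu u) xi) T N finN) => t t0 Nt.
  exact: psi_re_within.
apply: (@integrable_bounded _ _ _ _ _ _ ((\sum_j `|xi 0 j| + 2) * M)) => //.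
move=> u; rewrite /= in_itv/= => /andP[u0 uT].
  have H := integral_le_mass u0 (@cos1_cont xi) (cos_dot_tnorm xi).
  apply: (le_trans H); rewrite ler_wpM2l//.
    by rewrite addr_ge0// sumr_ge0.
  by apply: le_trans (MP u _); [exact: ler_norm|rewrite u0].
Qed.

Let psi_im_integrable xi T :
  leb.-integrable `[0, T] (EFin \o (fun u => psi_im (c u) (nu u) xi)).
Proof.
have [M MP] := mass_bounded T; have Tlty := @itv_lty T.
have /choice[B BP] : forall j, exists b, forall t, 0 <= t <= T -> `|c t 0 j| <= b.
  by move=> j; apply: regulated_bounded => t; [exact: c_right_limit|exact: c_left_limit].
have mf : measurable_fun (`[0, T]%classic : set (measurableTypeR R)) (fun u => psi_im (c u) (nu u) xi).
  apply: (@measurable_piecewise R (fun u => psi_im (c u) (nu u) xi) T N finN) => t t0 Nt.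
  exact: psi_im_within.
apply: (@integrable_bounded _ _ _ _ _ _
    (\sum_j B j * `|xi 0 j| + (\sum_j `|xi 0 j| + 2) * M)) => //.
move=> u; rewrite /= in_itv/= => /andP[u0 uT].
  apply: (le_trans (ler_normD _ _)); apply: lerD.
    apply: (le_trans (ler_norm_sum _ _ _)); apply: ler_sum => j _.
    by rewrite normrM ler_wpM2r// BP// u0.
  have H := integral_le_mass u0 (@sin_cont xi) (sin_dot_tnorm xi).
  apply: (le_trans H); rewrite ler_wpM2l//.
    by rewrite addr_ge0// sumr_ge0.
  by apply: le_trans (MP u _); [exact: ler_norm|rewrite u0].
Qed.

Let A xi t : R := \int[leb]_(u in `[0, t]) psi_re (nu u) xi.
Let B xi t : R := \int[leb]_(u in `[0, t]) psi_im (c u) (nu u) xi.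

Let S_charE xi t : 0 <= t ->
  \int[pi 0 t]_(s in orthant) cos (dot xi s) = expR (A xi t) * cos (B xi t) /\
  \int[pi 0 t]_(s in orthant) sin (dot xi s) = expR (A xi t) * sin (B xi t).
Proof.
move=> t0; have := S_char_fun xi t0.
rewrite char_funE additive_exponentE /cexp /= => -[h1 h2].
rewrite (increment_from0 S_sub pi_law _ t0 (@continuous_cos R) (@cos_max R)) h1.
by rewrite (increment_from0 S_sub pi_law _ t0 (@continuous_sin R) (@sin_max R)) h2.
Qed.

(** The characteristic function of S(t) is an exponential, so it never vanishes and can be divided
    out of that of S(t + h). In real terms the division inverts a rotation by B(t), using cos^2 +
    sin^2 = 1. *)
Let incr_charE xi t h : 0 <= t -> 0 <= h ->
  let al := A xi (t + h) - A xi t in let be := B xi (t + h) - B xi t in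
  \int[pi t (t + h)]_(s in orthant) cos (dot xi s) = expR al * cos be /\
  \int[pi t (t + h)]_(s in orthant) sin (dot xi s) = expR al * sin be.
Proof.
move=> t0 h0 al be; have th : t <= t + h by rewrite lerDl.
have [c1 s1] := S_charE xi t0; have [c2 s2] := S_charE xi (le_trans t0 th).
have := increment_cosD S_sub pi_law xi (lexx 0) t0 th.
have := increment_sinD S_sub pi_law xi (lexx 0) t0 th.
rewrite c1 s1 c2 s2.
set IC := \int[pi t (t + h)]_(s in orthant) cos (dot xi s).
set IS := \int[pi t (t + h)]_(s in orthant) sin (dot xi s).
rewrite /al /be; move: (A xi (t + h)) (B xi (t + h)) (A xi t) (B xi t) => a' b' a b.
move=> es ec; have ea : expR a != 0 by rewrite gt_eqF// expR_gt0.
have cs := cos2Dsin2 b.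
rewrite expRD expRN cosB sinB; split; apply: (mulfI ea).
  rewrite [RHS](_ : _ = (expR a' * cos b') * cos b + (expR a' * sin b') * sin b); last by field.
  by rewrite ec es -[LHS]mulr1 -cs; ring.
rewrite [RHS](_ : _ = (expR a' * sin b') * cos b - (expR a' * cos b') * sin b); last by field.
by rewrite ec es -[LHS]mulr1 -cs; ring.
Qed.

(** One-sided fundamental theorem of calculus; right continuity at t alone is enough, because the
    increment is an integral over ]t, t + h]. *)
Let diff_cvg (f : R -> R) t : 0 <= t ->
  (forall T, leb.-integrable `[0, T] (EFin \o f)) ->
  f u @[u --> t^'+] --> f t ->
  h^-1 * (\int[leb]_(u in `[0, t + h]) f u - \int[leb]_(u in `[0, t]) f u)
    @[h --> 0^'+] --> f t.
Proof.
move=> t0 fi cf; apply/cvgrPdist_le => e e0.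
move/cvgrPdist_le : cf => /(_ _ e0); rewrite near_withinE => /nbhs_ballP[d /= d0 dP].
near=> h; have h0 : 0 < h by near: h; exact: nbhs_right_gt.
have hd : h < d by near: h; exact: nbhs_right_lt.
have := @integral_itv_diff_le R f t h (f t) e t0 h0 (fi _).
set D := (\int[leb]_(u in `[0, t + h]) f u - \int[leb]_(u in `[0, t]) f u) => H.
have {}H : `|D - f t * h| <= e * h.
  apply: H => v /andP[tv vth]; rewrite distrC; apply: dP => //=.
  by rewrite /ball/= ltr0_norm ?subr_lt0//; lra.
rewrite -(ler_pM2r h0); apply: le_trans H.
have -> : D - f t * h = - ((f t - h^-1 * D) * h) by field; rewrite gt_eqF.
by rewrite normrN normrM (gtr0_norm h0).
Unshelve. all: by end_near. Qed.

Let A_cvg xi t : 0 <= t ->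
  h^-1 * (A xi (t + h) - A xi t) @[h --> 0^'+] --> psi_re (nu t) xi.
Proof.
move=> t0.
exact: (@diff_cvg (fun u => psi_re (nu u) xi) t t0 (psi_re_integrable xi) (psi_re_right t0)).
Qed.

Let B_cvg xi t : 0 <= t ->
  h^-1 * (B xi (t + h) - B xi t) @[h --> 0^'+] --> psi_im (c t) (nu t) xi.
Proof.
move=> t0.
exact: (@diff_cvg (fun u => psi_im (c u) (nu u) xi) t t0 (psi_im_integrable xi)
  (psi_im_right t0)).
Qed.

Let psi_re_le0 u xi : 0 <= u -> psi_re (nu u) xi <= 0.
Proof.
move=> u0; rewrite -oppr_ge0.
rewrite (_ : - _ = \int[nu u]_(s in orthant0) (1 - cos (dot xi s))).
  by apply: Rintegral_ge0 => s _; exact: subr1_cos_ge0.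
have i : (nu u).-integrable orthant0 (EFin \o (fun s : E => cos (dot xi (s : W)) - 1)).
  apply: (levy_integrable (nu_levy u0)); last by move=> s _; exact: cos_dot_tnorm.
  by apply: measurable_funTS; apply: measurable_funB => //; exact: measurable_cos_dot.
rewrite -mulN1r -(RintegralZl _ measurable_orthant0 i).
by apply: eq_Rintegral => s _; rewrite mulN1r opprB.
Qed.

Let A_le0 xi t h : 0 <= t -> 0 < h -> A xi (t + h) - A xi t <= 0.
Proof.
move=> t0 h0; have tth : t <= t + h by rewrite lerDl ltW.
rewrite /A (@Rintegral_itvB _ (fun u => psi_re (nu u) xi) (BLeft 0) (BRight (t + h)) t)//.
have mD : measurable (`]t, t + h]%classic : set (measurableTypeR R)) by [].
have i : leb.-integrable `]t, t + h] (EFin \o (fun u => psi_re (nu u) xi)).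
  by apply: integrableS (psi_re_integrable xi (t + h)) => //; apply: subset_itvr.
rewrite -oppr_ge0 -mulN1r -(RintegralZl _ mD i).
apply: Rintegral_ge0 => u; rewrite /= in_itv/= => /andP[tu _].
by rewrite mulN1r oppr_ge0 psi_re_le0// (le_trans t0)// ltW.
Qed.

Let mu_int (phi : W -> R) (C : R) (a b : R) : continuous phi ->
  (forall s, `|phi s| <= C) -> (pi a b).-integrable orthant (EFin \o (phi : E -> R)).
Proof.
move=> cphi phiC; apply: (@integrable_prob _ _ _ _ _ _ C) => //.
  exact: measurable_orthant.
by apply: measurable_funTS; exact: measurable_continuous_rV.
Qed.

Let ccos (xi : W) : continuous (fun s : W => cos (dot xi s)).
Proof.
by move=> s; apply: continuous_comp; [exact: continuous_dot|exact: continuous_cos].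
Qed.

Let norm1_le : `|1 : R| <= 1.
Proof. by rewrite normr1. Qed.

Let Rintegral_1 a b : 0 <= a -> a <= b ->
  \int[pi a b]_(s in orthant) ((cst 1 : E -> R) s) = 1.
Proof.
move=> a0 ab; rewrite Rintegral_cst; last exact: measurable_orthant.
by rewrite mul1r -[RHS]/(fine 1%E); congr fine; exact: (pi_orthant S_sub pi_law).
Qed.

Let cos1_integral xi a b : 0 <= a -> a <= b ->
  \int[pi a b]_(s in orthant) (cos (dot xi s) - 1) =
  \int[pi a b]_(s in orthant) cos (dot xi s) - 1.
Proof.
move=> a0 ab; rewrite -[in RHS](Rintegral_1 a0 ab).
have ic := mu_int a b (@ccos xi) (fun s : W => cos_max _).
have i1 := mu_int a b (fun s => @cst_continuous W R 1 s) (fun=> norm1_le).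
exact: (RintegralB measurable_orthant ic i1).
Qed.

Let increment_cos_cvg t (xi : W) : 0 <= t ->
  h^-1 * \int[pi t (t + h)]_(s in orthant) (cos (dot xi s) - 1) @[h --> 0^'+] -->
  \int[nu t]_(s in orthant0) (cos (dot xi s) - 1).
Proof.
move=> t0.
have al0 : \forall h \near (0 : R)^'+, A xi (t + h) - A xi t <= 0.
  by near=> h; apply: A_le0 => //; near: h; exact: nbhs_right_gt.
have cv := expR_cos_cvg al0 (@A_cvg xi t t0) (@B_cvg xi t t0).
apply: cvg_trans cv; apply: near_eq_cvg; near=> h.
have h0 : 0 < h by near: h; exact: nbhs_right_gt.
rewrite cos1_integral ?lerDl ?(ltW h0)//.
by have [-> _] := incr_charE xi t0 (ltW h0).
Unshelve. all: by end_near. Qed.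

Let increment_sin_cvg t (xi : W) : 0 <= t ->
  h^-1 * \int[pi t (t + h)]_(s in orthant) sin (dot xi s) @[h --> 0^'+] -->
  dot (c t) xi + \int[nu t]_(s in orthant0) sin (dot xi s).
Proof.
move=> t0.
have al0 : \forall h \near (0 : R)^'+, A xi (t + h) - A xi t <= 0.
  by near=> h; apply: A_le0 => //; near: h; exact: nbhs_right_gt.
have cv := expR_sin_cvg al0 (@A_cvg xi t t0) (@B_cvg xi t t0).
apply: cvg_trans cv; apply: near_eq_cvg; near=> h.
have h0 : 0 < h by near: h; exact: nbhs_right_gt.
by have [_ ->] := incr_charE xi t0 (ltW h0).
Unshelve. all: by end_near. Qed.

(** A common majorant of |cos(xi s_j) - 1| and |sin(xi s_j)| for all 0 <= xi <= u. Adding the drift,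
    [Gam] bounds the real and imaginary parts of the Levy exponent for all these frequencies at
    once, and is right continuous in time. *)
Let Lam (u : R) (j : 'I_k) (s : W) : R := Num.min (u * `|s 0 j|) 2.
Let Gam (u : R) (j : 'I_k) (v : R) : R :=
  c v 0 j * u + \int[nu v]_(s in orthant0) Lam u j s.

Let Lam_cont u j : continuous (Lam u j).
Proof.
move=> s; apply: (@continuous_min R W (fun s : W => u * `|s 0 j|) (cst 2)) => //;
  last exact: cst_continuous.
apply: (@cvgM _ _ (nbhs s)); first exact: cvg_cst.
by apply: (@cvg_norm _ _ _ (nbhs s)); exact: coord_continuous.
Qed.

Let Lam_ge0 u j s : 0 <= u -> 0 <= Lam u j s.
Proof. by move=> u0; rewrite le_min mulr_ge0/=. Qed.

Let Lam_le u j s : 0 <= u -> `|Lam u j s| <= (u + 2) * tnorm s.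
Proof.
move=> u0; rewrite ger0_norm ?Lam_ge0// /Lam /tnorm.
have cj := coord_le_enorm s j.
case: (leP (enorm s) 1) => [s1|s1].
  rewrite ge_min; apply/orP; left; rewrite ler_pM// lerDl//.
by rewrite mulr1 ge_min; apply/orP; right; rewrite lerDr.
Qed.

Let phi_le_Lam (x u : R) j (s : W) : 0 <= x <= u ->
  `|cos (dot (x *: basis_vec j) s) - 1| <= Lam u j s /\
  `|sin (dot (x *: basis_vec j) s)| <= Lam u j s.
Proof.
move=> /andP[x0 xu]; rewrite dot_basis /Lam !le_min.
have xs : `|x * s 0 j| <= u * `|s 0 j| by rewrite normrM ger0_norm// ler_wpM2r.
split.
  have := cos_lip (x * s 0 j) 0; rewrite cos0 subr0 => h.
  rewrite (le_trans h)//= (le_trans (ler_normB _ _))// normr1.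
  by have := cos_max (x * s 0 j); lra.
by rewrite (le_trans (sin_le _))//= (le_trans (sin_max _))// ler1n.
Qed.

Let nu_le_Lam (phi : W -> R) u j v : 0 <= u -> 0 <= v -> continuous phi ->
  (forall s, `|phi s| <= Lam u j s) ->
  `|\int[nu v]_(s in orthant0) phi s| <= \int[nu v]_(s in orthant0) Lam u j s.
Proof.
move=> u0 v0 cphi phiL.
have mphi (f : W -> R) : continuous f -> measurable_fun (orthant0 : set E) (f : E -> R).
  by move=> cf; apply: measurable_funTS; exact: measurable_continuous_rV.
have iL : (nu v).-integrable orthant0 (EFin \o (Lam u j : E -> R)).
  apply: (levy_integrable (nu_levy v0) (C := u + 2)).
    by apply: mphi; exact: Lam_cont.
  by move=> s _; exact: Lam_le.
by have [] := Rintegral_norm_le measurable_orthant0 (mphi _ cphi) iL (fun s _ => phiL s).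
Qed.

Let Gam_right t u j : 0 <= t -> 0 <= u -> Gam u j v @[v --> t^'+] --> Gam u j t.
Proof.
move=> t0 u0; apply: cvgD.
  by apply: cvgM; [exact: c_right_continuous|exact: cvg_cst].
exact: (levy_right_cvg t0 (@Lam_cont u j) (fun s => Lam_le j s u0)).
Qed.

(** The convergence of characteristic functions is only pointwise in the frequency, whereas
    tightness needs a range of frequencies. With al + i be the increment of the exponent, 1 -
    exp(al) cos(be) <= |al| + |be|, and both terms are at most (Gam + e) h; hence the factor 2. *)
Let increment_cos_bound t (u e : R) : 0 <= t -> 0 <= u -> 0 < e ->
  \forall h \near 0^'+, forall (j : 'I_k) xi, 0 <= xi <= u ->
  h^-1 * \int[pi t (t + h)]_(s in orthant) (1 - cos (xi * s 0 j)) <=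
  2 * (Gam u j t + e).
Proof.
move=> t0 u0 e0.
have [d d0 dP] : exists2 d, 0 < d & forall v, t < v -> v < t + d -> forall j,
    Gam u j v <= Gam u j t + e.
  have H : \forall v \near t^'+, forall j, Gam u j v <= Gam u j t + e.
    apply: filter_forall => j.
    have lt_e : Gam u j t < Gam u j t + e by rewrite ltrDl.
    exact: (cvgr_le _ (@Gam_right t u j t0 u0) _ lt_e).
  move: H; rewrite near_withinE => /nbhs_ballP[d /= d0 dP]; exists d => // v tv vd.
  by apply: dP => //; rewrite /ball/= ltr0_norm ?subr_lt0//; lra.
near=> h => j x xu; have h0 : 0 < h by near: h; exact: nbhs_right_gt.
have hd : h < d by near: h; exact: nbhs_right_lt.
have [x0 x_u] := andP xu.
pose xi : W := x *: basis_vec j.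
have th : t <= t + h by rewrite lerDl ltW.
have -> : \int[pi t (t + h)]_(s in orthant) (1 - cos (x * (s : W) 0 j)) =
    1 - \int[pi t (t + h)]_(s in orthant) cos (dot xi s).
  have ic := mu_int t (t + h) (@ccos xi) (fun s : W => cos_max _).
  have i1 := mu_int t (t + h) (fun s => @cst_continuous W R 1 s) (fun=> norm1_le).
  rewrite -[in RHS](Rintegral_1 t0 th) -(RintegralB measurable_orthant i1 ic).
  by apply: eq_Rintegral => s _; rewrite dot_basis.
have [-> _] := incr_charE xi t0 (ltW h0).
rewrite ler_pdivrMl//.
apply: (le_trans (subr1_expR_cos_le _ (A_le0 xi t0 h0))).
have vP v : t < v <= t + h -> [/\ 0 <= v, 0 <= c v 0 j & Gam u j v <= Gam u j t + e].
  move=> /andP[tv vth]; have v0 : 0 <= v by rewrite (le_trans t0)// ltW.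
  split => //; first by apply: orthant_ge0; exact: c_ge0.
  by apply: dP => //; lra.
have hA : `|A xi (t + h) - A xi t| <= (Gam u j t + e) * h.
  have := @integral_itv_diff_le R (fun v => psi_re (nu v) xi) t h 0
    (Gam u j t + e) t0 h0 (psi_re_integrable xi _).
  rewrite mul0r subr0; apply => v /vP[v0 c0 Gv]; rewrite subr0.
  have H := nu_le_Lam u0 v0 (@cos1_cont xi) (fun s => (phi_le_Lam j s xu).1).
  apply: (le_trans H); apply: le_trans Gv.
  by rewrite /Gam lerDr mulr_ge0.
have hB : `|B xi (t + h) - B xi t| <= (Gam u j t + e) * h.
  have := @integral_itv_diff_le R (fun v => psi_im (c v) (nu v) xi) t h 0
    (Gam u j t + e) t0 h0 (psi_im_integrable xi _).
  rewrite mul0r subr0; apply => v /vP[v0 c0 Gv]; rewrite subr0.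
  have H := nu_le_Lam u0 v0 (@sin_cont xi) (fun s => (phi_le_Lam j s xu).2).
  apply: le_trans Gv; apply: (le_trans (ler_normD _ _)); apply: lerD => //.
  by rewrite dotC dot_basis normrM !ger0_norm// mulrC ler_wpM2l.
by apply: le_trans (lerD hA hB) _; lra.
Unshelve. all: by end_near. Qed.

(** [Gam u] tends to 0 with u: the drift part is linear, the other part converges by domination. For
    u <= 1 the majorant of [Lam_le] is at most 3 tnorm. *)
Let increment_tail t : 0 <= t -> forall e, 0 < e -> exists2 u, 0 < u &
  \forall h \near 0^'+, forall (j : 'I_k) xi, 0 <= xi <= u ->
  h^-1 * \int[pi t (t + h)]_(s in orthant) (1 - cos (xi * s 0 j)) <= e.
Proof.
move=> t0 e e0.
have e4 : 0 < e / 4 by rewrite divr_gt0.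
have cv j : Gam n.+1%:R^-1 j t @[n --> \oo] --> 0.
  rewrite -[X in _ --> X](_ : c t 0 j * 0 +
      \int[nu t]_(s in orthant0) ((cst 0 : E -> R) s) = 0); last first.
    by rewrite mulr0 add0r Rintegral_cst ?mul0r//; exact: measurable_orthant0.
  apply: cvgD; first by apply: cvgM; [exact: cvg_cst|exact: cvg_harmonic].
  apply: (@Rintegral_dominated_cvg _ E _ (nu t) orthant0
    (fun n (s : E) => Lam n.+1%:R^-1 j (s : W)) (cst 0) (fun s => 3 * tnorm (s : W))).
  - exact: measurable_orthant0.
  - move=> n; apply: measurable_funTS; apply: measurable_continuous_rV.
    exact: Lam_cont.
  - move=> s _; apply: (@squeeze_cvgr _ _ _ _ (cst 0) (fun n => n.+1%:R^-1 * `|(s : W) 0 j|)).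
    + apply: nearW => n; rewrite Lam_ge0 ?invr_ge0//=.
      by rewrite /Lam ge_min lexx.
    + exact: cvg_cst.
    + rewrite -[X in _ --> X](mul0r `|(s : W) 0 j|).
      by apply: cvgM; [exact: cvg_harmonic|exact: cvg_cst].
  - exact: (integrableZl measurable_orthant0 3 (levy_integrable_tnorm (nu_levy t0))).
  - move=> n s _; apply: (le_trans (Lam_le _ _ _)); first by rewrite invr_ge0.
    rewrite ler_wpM2r ?tnorm_ge0//.
    have n1 : n.+1%:R^-1 <= 1 :> R by rewrite invf_le1 ?ltr0n// ler1n.
    by apply: (le_trans (lerD n1 (lexx _))); rewrite nat1r.
have H : \forall n \near \oo, forall j, Gam n.+1%:R^-1 j t <= e / 4.
  by apply: filter_forall => j; exact: (cvgr_le _ (@cv j) _ e4).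
have [n _ /(_ n (leqnn n)) Hn] := H.
exists n.+1%:R^-1; first by rewrite invr_gt0.
have u0 : 0 <= n.+1%:R^-1 :> R by rewrite invr_ge0.
apply: filterS (increment_cos_bound t0 u0 e4) => h Hh j x xu.
by apply: (le_trans (Hh j x xu)); have := Hn j; lra.
Qed.

Let increment_bound t : 0 <= t -> exists M,
  \forall h \near 0^'+, forall (j : 'I_k) xi, 0 <= xi <= 4 ->
  h^-1 * \int[pi t (t + h)]_(s in orthant) (1 - cos (xi * s 0 j)) <= M.
Proof.
move=> t0; exists (\sum_j `|2 * (Gam 4 j t + 1)|).
apply: filterS (increment_cos_bound t0 (ler0n _ 4) ltr01) => h Hh j x xu.
apply: (le_trans (Hh j x xu)); apply: (le_trans (ler_norm _)).
by rewrite (bigD1 j)//= lerDl sumr_ge0.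
Qed.

Lemma increment_small_time_limit t : 0 <= t ->
  small_time_limit (fun h => pi t (t + h)) (nu t) (c t).
Proof.
move=> t0; split.
- by move=> xi; exact: increment_cos_cvg.
- by move=> xi; exact: increment_sin_cvg.
- exact: increment_tail.
- exact: increment_bound.
Qed.

End additive_characteristics.

(** * The evolution system *)

Section evolution_system.
Context {R : realType} {d k : nat}.
Context {dO : measure_display} {Omega : measurableType dO}.
Local Notation V := 'rV[R]_d.
Local Notation W := 'rV[R]_k.
Local Notation E := (borel_rV R k).
Variables (T : W -> (V -> R) -> (V -> R)) (P : V -> probability Omega R).
Variable (X : W -> Omega -> V).
Hypothesis X_meas : forall s, orthant s ->
  measurable_fun setT (X s : Omega -> borel_rV R d).
Hypothesis T_sc : sc_semigroup T.
Hypothesis T_assoc : associated_semigroup P X T.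

Section average_generator.
Variables (mu : R -> probability E R) (nu : {measure set E -> \bar R}) (c : W).
Hypothesis mu1 : forall h, 0 < h -> mu h orthant = 1%E.
Hypothesis nu_csum : nu.-integrable orthant0 (EFin \o csum).
Hypothesis mu_nu : small_time_limit mu nu c.

Lemma average_sub_id h f x : 0 < h -> Bb f ->
  average T (mu h) f x - f x = \int[mu h]_(s in orthant) (T s f x - f x).
Proof.
move=> h0 bf; have mO : measurable (orthant : set E) := measurable_orthant.
have i1 := integrable_T X_meas T_sc T_assoc (mu h) x bf.
have i2 : (mu h).-integrable orthant (EFin \o ((cst (f x)) : E -> R)).
  by apply: (@integrable_prob _ _ _ _ _ _ `|f x|).
rewrite (RintegralB mO i1 i2) Rintegral_cst//.
have -> : fine (mu h (orthant : set E)) = 1 by rewrite mu1.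
by rewrite mulr1.
Qed.

Lemma average_generator f (g : 'I_k -> V -> R) : Bb f ->
  (forall j, is_generator (marginal T j) f (g j)) ->
  (forall x, nu.-integrable orthant0 (EFin \o (fun s : E => T s f x - f x))) /\
  is_generator (fun h => average T (mu h)) f
    (fun x => \sum_j c 0 j * g j x + \int[nu]_(s in orthant0) (T s f x - f x)).
Proof.
move=> bf fg; have [C C0 fC] := Bb_bound bf.
have bg j : Bb (g j) by case: (fg j).
have [K K0 gK] : exists2 K, 0 <= K & forall x j, `|g j x| <= K.
  exists (\sum_j supnorm (g j)); first by apply: sumr_ge0 => j _; exact: supnorm_ge0.
  move=> x j; apply: (le_trans (supnorm_ge (bg j) x)).
  by rewrite (bigD1 j)//= lerDl sumr_ge0// => i _; exact: supnorm_ge0.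
have TC s x : orthant s -> `|T s f x - f x| <= C + C.
  move=> s0; apply: (le_trans (ler_normB _ _)); apply: lerD => //.
  exact: (T_le X_meas T_assoc s0 C0 bf fC).
have Tu e : 0 < e -> exists2 dl, 0 < dl & forall x s t, orthant s -> orthant t ->
    (forall j, `|s 0 j - t 0 j| < dl) -> `|(T s f x - f x) - (T t f x - f x)| <= e.
  move=> e0; have [dl dl0 dlP] := T_unif X_meas T_sc T_assoc bf e0.
  exists dl => // x s t s0 t0 st.
  by rewrite opprB addrA subrK; exact: dlP.
have Te e : 0 < e -> exists2 dl, 0 < dl & forall x s, orthant s ->
    (forall j, s 0 j < dl) ->
    `|T s f x - f x - \sum_j s 0 j * g j x| <= e * \sum_j s 0 j.
  move=> e0; have [dl dl0 dlP] := T_expand X_meas T_sc T_assoc bf fg e0.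
  by exists dl => // x s s0 sdl; exact: dlP.
(* The index set is the state space, so uniformity over the family is convergence in the sup
   norm. *)
have [int lim] := uniform_limit nu_csum mu_nu
  (g := fun x s => T s f x - f x) (b := fun x j => g j x)
  (fun x s => @TC s x) gK (addr_ge0 C0 C0) K0 Tu Te.
split=> //.
have cv : norm_cvg ((fun h : R => fun x =>
    h^-1 * (average T (mu h) f x - f x)) @ 0^'+)
    (fun x => \sum_j c 0 j * g j x + \int[nu]_(s in orthant0) (T s f x - f x)).
  apply/norm_cvgP => e e0; near=> h => x.
  have h0 : 0 < h by near: h; exact: nbhs_right_gt.
  rewrite average_sub_id//; move: x; near: h; exact: lim.
split => //.
(* That the limit is bounded and Borel is read off along h = 1/(n+1). *)
apply: (@norm_cvg_Bb _ _ _ _ _ _ _ (@harmonic R) _ _ cv).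
  by move=> n; apply: Bb_scale; apply: BbB => //; apply: (average_Bb X_meas T_sc T_assoc).
move=> B nB; have H : \forall n \near \oo, 0 < @harmonic R n -> B (harmonic n) :=
  @cvg_harmonic R (fun x : R => 0 < x -> B x) nB.
by move: H; apply: filterS => n; apply; exact: harmonic_gt0.
Unshelve. all: by end_near. Qed.

End average_generator.
(** Linearity is available for combinations a f + g, so a f is written (a - 1) f + f. *)
Lemma averageZ m a f : Bb f ->
  average T m (fun x => a * f x) = (fun x => a * average T m f x).
Proof.
move=> bf; have := average_lin X_meas T_sc T_assoc m (a - 1) bf bf.
rewrite (_ : (fun x => (a - 1) * f x + f x) = (fun x => a * f x)).
  by move=> ->; apply/funext => x; ring.
by apply/funext => x; ring.
Qed.

(** * Propagator identities, right derivatives and strong continuity *)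

Section subordination.
Variables (Q : probability Omega R) (S : R -> Omega -> W).
Variable (pi : R -> R -> probability E R).
Hypothesis S_sub : additive_subordinator Q S.
Hypothesis pi_law : forall t1 t2 A, 0 <= t1 -> t1 <= t2 -> measurable A ->
  pi t1 t2 A = Q [set w | A (S t2 w - S t1 w)].
Local Notation U := (evolution T pi).

Lemma evolution_id t f : 0 <= t -> Bb f -> U t t f = f.
Proof.
move=> t0 bf; apply/funext => x; have [C C0 fC] := Bb_bound bf.
rewrite /evolution (Rintegral_increment S_sub pi_law t0 (lexx t) (C := C)).
- rewrite (_ : _ @^-1` _ = setT); last first.
    by apply/seteqP; split=> w //= _; rewrite subrr; exact: orthant_0.
  under eq_Rintegral do rewrite subrr.
  have [_ T0 _ _] := T_sc.
  rewrite T0// Rintegral_cst//.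
  have -> : fine (Q setT) = 1 by rewrite probability_setT.
  by rewrite mulr1.
- exact: (T_cont X_meas T_sc T_assoc).
- by move=> s s0; exact: (T_le X_meas T_assoc s0 C0 bf fC).
Qed.

Lemma evolution_backward t1 t2 t3 f : 0 <= t1 -> t1 <= t2 -> t2 <= t3 -> Bb f ->
  U t1 t2 (U t2 t3 f) = U t1 t3 f.
Proof.
move=> t10 t12 t23 bf; have t20 := le_trans t10 t12; have t30 := le_trans t20 t23.
apply: (average_conv X_meas T_sc T_assoc
  (measurable_increment S_sub t10 t20) (measurable_increment S_sub t20 t30)) => //.
- by move=> A B mA mB; exact: (increments_independent S_sub pi_law t10 t12 t23).
- exact: (increment_ge0 S_sub).
- exact: (increment_ge0 S_sub).
- move=> A mA; rewrite pi_law// ?(le_trans t12)//; congr (Q _).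
  have e w : S t2 w - S t1 w + (S t3 w - S t2 w) = S t3 w - S t1 w.
    by rewrite addrC addrA subrK.
  by apply/seteqP; split=> w /=; rewrite e.
Qed.

(** The same two independent increments are added in the opposite order, so the two averages
    commute. *)
Lemma evolution_forward t1 t2 t3 f : 0 <= t1 -> t1 <= t2 -> t2 <= t3 -> Bb f ->
  U t2 t3 (U t1 t2 f) = U t1 t3 f.
Proof.
move=> t10 t12 t23 bf; have t20 := le_trans t10 t12; have t30 := le_trans t20 t23.
apply: (average_conv X_meas T_sc T_assoc
  (measurable_increment S_sub t20 t30) (measurable_increment S_sub t10 t20)) => //.
- move=> A B mA mB; rewrite setIC muleC.
  exact: (increments_independent S_sub pi_law t10 t12 t23).
- exact: (increment_ge0 S_sub).
- exact: (increment_ge0 S_sub).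
- move=> A mA; rewrite pi_law// ?(le_trans t12)//; congr (Q _).
  have e w : S t3 w - S t2 w + (S t2 w - S t1 w) = S t3 w - S t1 w.
    by rewrite addrA subrK.
  by apply/seteqP; split=> w /=; rewrite e.
Qed.

(** The backward identity pulls the contraction [U t1 t2] out of the difference quotient at t2, and
    a contraction preserves the uniform limit. *)
Lemma evolution_right_derivative t1 t2 f g : 0 <= t1 -> t1 <= t2 ->
  is_generator (right_increments U t2) f g ->
  norm_cvg ((fun h : R => fun x => h^-1 * (U t1 (t2 + h) f x - U t1 t2 f x)) @ 0^'+)
    (U t1 t2 g).
Proof.
move=> t10 t12 [bf bg /norm_cvgP cv]; apply/norm_cvgP => e e0.
near=> h => x; have h0 : 0 < h by near: h; exact: nbhs_right_gt.
have t2h : t2 <= t2 + h by rewrite lerDl ltW.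
have bU : Bb (U t2 (t2 + h) f) by exact: (average_Bb X_meas T_sc T_assoc).
rewrite -(evolution_backward t10 t12 t2h bf).
have := averageB X_meas T_sc T_assoc (pi t1 t2) bU bf.
move=> /(congr1 (fun u => u x)) /= <-.
have bd := BbB bU bf; have bq := Bb_scale h^-1 bd.
have := averageZ (pi t1 t2) h^-1 bd.
move=> /(congr1 (fun u => u x)) /= <-.
have := averageB X_meas T_sc T_assoc (pi t1 t2) bg bq.
move=> /(congr1 (fun u => u x)) /= <-.
apply: (average_le X_meas T_sc T_assoc) => //; first exact: ltW.
  exact: BbB.
near: h; exact: cv.
Unshelve. all: by end_near. Qed.

(** The forward identity reads the same quotient as the generator quotient at time t2 of the
    function [U t1 t2 f]. *)
Lemma evolution_generator_comm t1 t2 f g : 0 <= t1 -> t1 <= t2 ->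
  is_generator (right_increments U t2) f g ->
  is_generator (right_increments U t2) (U t1 t2 f) (U t1 t2 g).
Proof.
move=> t10 t12 fg; have [bf bg _] := fg; have t20 := le_trans t10 t12.
have bU h : Bb h -> Bb (U t1 t2 h) by exact: (average_Bb X_meas T_sc T_assoc).
split; [exact: bU|exact: bU|].
have /norm_cvgP cv := evolution_right_derivative t10 t12 fg.
apply/norm_cvgP => e e0; near=> h => x; have h0 : 0 < h by near: h; exact: nbhs_right_gt.
rewrite /right_increments evolution_forward ?lerDl ?(ltW h0)//.
by move: x; near: h; exact: cv.
Unshelve. all: by end_near. Qed.

Lemma evolution_propagator : propagator U.
Proof.
split; last exact: evolution_id.
by move=> t1 t2 _ _; exact: (average_bounded X_meas T_sc T_assoc).
Qed.

Let far (eta u v : R) : set Omega := [set w | eta < enorm (S u w - S v w)].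

Let measurable_far eta u v : 0 <= u -> 0 <= v -> measurable (far eta u v).
Proof.
move=> u0 v0; rewrite -[far _ _ _]setTI.
have mf : measurable_fun setT (fun w => enorm (S u w - S v w)).
  apply: (measurableT_comp (f := (@enorm R k : E -> R))).
    by apply: measurable_continuous_rV; exact: continuous_enorm.
  exact: (measurable_increment S_sub v0 u0).
have := mf measurableT `]eta, +oo[%classic (measurable_itv _).
by congr measurable; apply/seteqP; split => w /=; rewrite in_itv/= andbT.
Qed.

Let far_small (eta e t : R) : 0 <= t -> 0 < eta -> 0 < e ->
  \forall u \near nbhs t, 0 <= u -> (Q (far eta u t) <= e%:E)%E.
Proof.
move=> t0 eta0 e0; have := subordinator_continuous S_sub t0 eta0.
move=> /fine_cvgP[_ /cvgrPdist_le /(_ e e0)]; rewrite near_withinE.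
apply: filterS => u H u0; have := H u0; rewrite sub0r normrN ger0_norm; last first.
  by rewrite fine_ge0.
by rewrite -lee_fin fineK// fin_num_measure//; exact: measurable_far.
Qed.

(** Both operators are expectations over the same paths of S. If both endpoints move by at most eta,
    the increment moves by at most 2 eta and the integrand by e; the exceptional event has
    probability at most 2 p and costs 2 C. *)
Let evolution_le a b a' b' f C e eta p x : Bb f -> 0 <= C -> (forall x, `|f x| <= C) ->
  0 <= a -> a <= b -> 0 <= a' -> a' <= b' -> 0 <= e -> 0 <= p ->
  (forall s t, orthant s -> orthant t -> (forall j, `|s 0 j - t 0 j| <= eta + eta) ->
     forall x, `|T s f x - T t f x| <= e) ->
  (Q (far eta a a') <= p%:E)%E -> (Q (far eta b b') <= p%:E)%E ->
  `|U a b f x - U a' b' f x| <= e + (C + C) * (p + p).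
Proof.
move=> bf C0 fC a0 ab a'0 ab' e0 p0 Te Qa Qb.
have b0 := le_trans a0 ab; have b'0 := le_trans a'0 ab'.
pose O u v := (fun w => S v w - S u w) @^-1` orthant.
have mO u v : 0 <= u -> 0 <= v -> measurable (O u v).
  move=> u0 v0; rewrite -[X in measurable X]setTI.
  exact: (measurable_increment S_sub u0 v0 measurableT measurable_orthant).
pose D := O a b `&` O a' b'.
have mD : measurable D by apply: measurableI; exact: mO.
have cT := T_cont X_meas T_sc T_assoc (x := x) bf.
have TC s : orthant s -> `|T s f x| <= C.
  by move=> s0; exact: (T_le X_meas T_assoc s0 C0 bf fC).
have aD : {ae Q, forall w, D w}.
  by apply: filterS2 (increment_ge0 S_sub a0 ab) (increment_ge0 S_sub a'0 ab').
have mT u v : 0 <= u -> 0 <= v ->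
    measurable_fun (O u v) (fun w => T (S v w - S u w) f x).
  move=> u0 v0; apply: (@measurable_comp _ _ _ _ E _ (orthant : set E)
    (fun s => T s f x) (O u v) (fun w => S v w - S u w)).
  - exact: measurable_orthant.
  - by move=> _ [w ? <-].
  - exact: measurable_orthant_continuous.
  - by apply: measurable_funTS; apply: (measurable_increment S_sub).
have UE u v : 0 <= u -> u <= v -> D `<=` O u v ->
    U u v f x = \int[Q]_(w in D) T (S v w - S u w) f x.
  move=> u0 uv DO; have v0 := le_trans u0 uv.
  rewrite /evolution (Rintegral_increment S_sub pi_law u0 uv cT TC).
  by apply/esym; apply: Rintegral_ae_sub => //; [exact: mO|exact: mT].
have D1 : D `<=` O a b by exact: subIsetl.
have D2 : D `<=` O a' b' by exact: subIsetr.
have iT u v : 0 <= u -> 0 <= v -> D `<=` O u v ->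
    Q.-integrable D (EFin \o (fun w => T (S v w - S u w) f x)).
  move=> u0 v0 DO; apply: (@integrable_prob _ _ _ _ _ _ C) => //.
    by apply: measurable_funS (mT u v u0 v0) => //; exact: mO.
  by move=> w /DO; exact: TC.
rewrite !UE// -(RintegralB mD (iT _ _ a0 b0 D1) (iT _ _ a'0 b'0 D2)).
pose F := far eta a a' `|` far eta b b'.
have mF : measurable F by apply: measurableU; exact: measurable_far.
have F_le w : `|(C + C) * \1_F w| <= C + C.
  rewrite normrM indicE (ger0_norm (addr_ge0 C0 C0)).
  by case: (w \in F); rewrite ?normr1 ?normr0 ?mulr1// mulr0 addr_ge0.
have mi : measurable_fun setT (fun w => e + (C + C) * \1_F w : R).
  by apply: measurable_funD => //; apply: measurable_funM => //; exact: measurable_indic.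
have ig : Q.-integrable setT (EFin \o (fun w => e + (C + C) * \1_F w : R)).
  apply: (@integrable_prob _ _ _ _ _ _ (e + (C + C))) => //.
  move=> w _; rewrite (le_trans (ler_normD _ _))// ger0_norm// lerD2l.
  exact: F_le.
have igD : Q.-integrable D (EFin \o (fun w => e + (C + C) * \1_F w : R)).
  exact: integrableS ig.
have [| |_ H] := @Rintegral_norm_le _ _ _ Q D
  (fun w => T (S b w - S a w) f x - T (S b' w - S a' w) f x) _ mD _ igD.
- apply: measurable_funB; [apply: measurable_funS (mT a b _ _)|
    apply: measurable_funS (mT a' b' _ _)] => //; exact: mO.
- move=> w [wa wb]; rewrite indicE; case: (boolP (w \in F)) => [_|wF].
    rewrite mulr1; apply: le_trans (ler_normB _ _) _.
    by rewrite ler_wpDl// lerD// TC.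
  rewrite mulr0 addr0; apply: Te => // j.
  have [Fa Fb] : enorm (S a w - S a' w) <= eta /\ enorm (S b w - S b' w) <= eta.
    move: wF; rewrite notin_setE => /not_orP[].
    by rewrite /far/= => /negP; rewrite -leNgt => ? /negP; rewrite -leNgt.
  have ha := le_trans (coord_le_enorm (S a w - S a' w) j) Fa.
  have hb := le_trans (coord_le_enorm (S b w - S b' w) j) Fb.
  rewrite (_ : _ - _ = (S b w - S b' w) 0 j - (S a w - S a' w) 0 j).
    by apply: le_trans (ler_normB _ _) _; rewrite lerD.
  by rewrite !mxE; ring.
apply: (le_trans H).
rewrite (Rintegral_ae_sub mD measurableT _ _ aD)//.
have i1 : Q.-integrable setT (EFin \o (cst e : Omega -> R)).
  by apply: (@integrable_prob _ _ _ _ _ _ `|e|).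
have i2 : Q.-integrable setT (EFin \o (fun w => (C + C) * \1_F w : R)).
  apply: (@integrable_prob _ _ _ _ _ _ (C + C)) => //.
    by apply: measurable_funM => //; exact: measurable_indic.
rewrite (RintegralD measurableT i1 i2) Rintegral_indic !Rintegral_cst//.
have -> : fine (Q setT) = 1 by rewrite probability_setT.
rewrite mulr1 lerD2l ler_wpM2l ?addr_ge0//.
have QF : (Q F <= (p + p)%:E)%E.
  rewrite EFinD; apply: le_trans (leeD Qa Qb).
  by apply: measureU2; exact: measurable_far.
by rewrite -lee_fin fineK// fin_num_measure.
Qed.

Lemma evolution_strongly_continuous : strongly_continuous U.
Proof.
move=> [a b] f [/= a0 ab] bf; apply/norm_cvgP => e e0.
have b0 := le_trans a0 ab.
have [C C0 fC] := Bb_bound bf.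
have e20 : 0 < e / 2 by rewrite divr_gt0.
have [dl dl0 dlP] := T_unif X_meas T_sc T_assoc bf e20.
(* Twice dl / 3 is still strictly below the modulus dl. *)
have eta0 : 0 < dl / 3 by rewrite divr_gt0.
(* Makes the exceptional cost 2 C * 2 p equal to (e / 2) C / (C + 1). *)
pose p := e / (8 * (C + 1)).
have p0 : 0 < p by rewrite divr_gt0// mulr_gt0// ltr_wpDl.
have Ha := far_small a0 eta0 p0; have Hb := far_small b0 eta0 p0.
have H : \forall q \near nbhs (a, b), (0 <= q.1 -> (Q (far (dl / 3) q.1 a) <= p%:E)%E) /\
    (0 <= q.2 -> (Q (far (dl / 3) q.2 b) <= p%:E)%E).
  by exists ([set u | 0 <= u -> (Q (far (dl / 3) u a) <= p%:E)%E],
    [set u | 0 <= u -> (Q (far (dl / 3) u b) <= p%:E)%E]) => //= q [].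
rewrite near_withinE; apply: filterS H => -[a' b'] /= [Ha' Hb'] [/= a'0 ab'] x.
rewrite distrC.
have b'0 := le_trans a'0 ab'.
have := @evolution_le a' b' a b f C (e / 2) (dl / 3) p x bf C0 fC a'0 ab' a0 ab
  (ltW e20) (ltW p0) _ (Ha' a'0) (Hb' b'0).
move=> /(_ _)/le_trans; apply.
  by move=> s t s0 t0 st; apply: dlP => // j; apply: le_lt_trans (st j) _; lra.
have -> : (C + C) * (p + p) = (e / 2) * (C / (C + 1)).
  by rewrite /p; field; lra.
have : C / (C + 1) <= 1 by rewrite ler_pdivrMr ?mul1r ?lerDl// ltr_wpDl.
by move=> /(ler_wpM2l (ltW e20)); rewrite mulr1; lra.
Qed.

End subordination.
End evolution_system.

Theorem theorem3p2 (R : realType) (d k : nat) (d_gt0 : (0 < d)%N)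
    (k_gt0 : (0 < k)%N) (dO : measure_display) (Omega : measurableType dO)
    (F : 'rV[R]_k -> set (set Omega))
    (T : 'rV[R]_k -> ('rV[R]_d -> R) -> ('rV[R]_d -> R))
    (P : 'rV[R]_d -> probability Omega R)
    (X : 'rV[R]_k -> Omega -> 'rV[R]_d)
    (X_markov : markov_process F T P X)
    (T_semigroup : sc_semigroup T)
    (T_associated : associated_semigroup P X T)
    (S : R -> Omega -> 'rV[R]_k)
    (c : R -> 'rV[R]_k)
    (nu : R -> {measure set (borel_rV R k) -> \bar R})
    (S_subordinator : forall x, additive_subordinator (P x) S)
    (S_indep_X : forall x, independent_sigma (P x)
       (generated_sigma orthant X) (generated_sigma [set t : R | 0 <= t] S))
    (c_ge0 : forall t : R, 0 <= t -> orthant (c t))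
    (nu_levy : forall t : R, 0 <= t -> levy_measure (nu t))
    (S_char_fun : forall x (t : R) xi, 0 <= t ->
       char_fun (P x) (S t) xi = cexp (additive_exponent c nu t xi))
    (pi : R -> R -> probability (borel_rV R k) R)
    (pi_law : forall x (t1 t2 : R) A, 0 <= t1 -> t1 <= t2 -> measurable A ->
       pi t1 t2 A = P x [set w | A (S t2 w - S t1 w)])
    (c_right_limit : forall (t : R) (j : 'I_k), 0 <= t ->
       cvg (c u 0 j @[u --> t^'+]))
    (c_left_limit : forall (t : R) (j : 'I_k), 0 < t ->
       cvg (c u 0 j @[u --> t^'-]))
    (nuF_right_limit : forall t : R, 0 <= t ->
       exists m : {finite_measure set (borel_rV R k) -> \bar R},
         weak_cvg (fun u => truncated_measure (nu u)) t^'+ m)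
    (nuF_left_limit : forall t : R, 0 < t ->
       exists m : {finite_measure set (borel_rV R k) -> \bar R},
         weak_cvg (fun u => truncated_measure (nu u)) t^'- m)
    (c_right_continuous : forall (t : R) (j : 'I_k), 0 <= t ->
       c u 0 j @[u --> t^'+] --> c t 0 j)
    (c_discontinuities : forall j : 'I_k, finite_set [set t : R | 0 <= t /\
       ~ (c u 0 j @[u --> within [set u : R | 0 <= u] (nbhs t)] --> c t 0 j)])
    (nuF_right_continuous : forall t : R, 0 <= t ->
       weak_cvg (fun u => truncated_measure (nu u)) t^'+
         (truncated_measure (nu t)))
    (nuF_discontinuities : finite_set [set t : R | 0 <= t /\
       ~ weak_cvg (fun u => truncated_measure (nu u))
           (within [set u : R | 0 <= u] (nbhs t)) (truncated_measure (nu t))]) :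
  let U := evolution T pi in
  let D := \bigcap_(j in [set: 'I_k]) gen_domain (marginal T j) in
  let G (t : R) := generator (right_increments U t) in
  [/\ [/\ strongly_continuous U, backward_propagator U & forward_propagator U],
      forall t : R, 0 <= t -> D `<=` gen_domain (right_increments U t),
      forall (t : R) f x, 0 <= t -> D f ->
        (nu t).-integrable orthant0 (fun s => (T s f x - f x)%:E) /\
        G t f x = \sum_j c t 0 j * generator (marginal T j) f x +
                  \int[nu t]_(s in orthant0) (T s f x - f x) &
      forall (t1 t2 : R) f, 0 <= t1 -> t1 < t2 -> D f ->
        [/\ norm_cvg ((fun h : R => fun x =>
                h^-1 * (U t1 (t2 + h) f x - U t1 t2 f x)) @ 0^'+)
              (U t1 t2 (G t2 f)),
            gen_domain (right_increments U t2) (U t1 t2 f) &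
            U t1 t2 (G t2 f) = G t2 (U t1 t2 f)]].
Proof.
have X_meas s : orthant s -> measurable_fun setT (X s : Omega -> borel_rV R d).
  move=> s0 _ B mB; rewrite setTI.
  have [_ Fm _] := markov_filtration X_markov.
  exact: (Fm s s0 _ (markov_adapted X_markov s0 mB)).
(* The laws [pi] are the same under every P_x, so the starting point 0 can represent all of them. *)
have pi_law0 := pi_law 0; have S_sub := S_subordinator 0.
have S_char := S_char_fun 0.
move=> U D G.
have DP f : D f -> forall j, is_generator (marginal T j) f (generator (marginal T j) f).
  by move=> Df j; apply: gen_domainP; exact: (Df j I).
(* Membership in one marginal domain yields [Bb f]; for k = 0 the intersection would contain every
   function. *)
have bD f : D f -> Bb f by move=> /DP/(_ (Ordinal k_gt0))[].
have gen t f : 0 <= t -> D f ->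
    (forall x, (nu t).-integrable orthant0
      (EFin \o (fun s : borel_rV R k => T s f x - f x))) /\
    is_generator (right_increments U t) f (fun x =>
      \sum_j c t 0 j * generator (marginal T j) f x +
      \int[nu t]_(s in orthant0) (T s f x - f x)).
  move=> t0 Df.
  apply: (@average_generator _ _ _ _ _ T P X X_meas T_semigroup T_associated
    (fun h => pi t (t + h)) (nu t) (c t)).
  - by move=> h h0; apply: (pi_orthant S_sub pi_law0); rewrite ?lerDl ?(ltW h0).
  - exact: (levy_integrable_csum (nu_levy t t0)).
  - exact: (increment_small_time_limit S_sub c_ge0 nu_levy S_char pi_law0
      c_right_limit c_left_limit nuF_right_limit nuF_left_limit
      c_right_continuous c_discontinuities nuF_right_continuous
      nuF_discontinuities t0).
  - exact: bD.
  - exact: DP.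
have G_gen t f : 0 <= t -> D f -> is_generator (right_increments U t) f (G t f).
  by move=> t0 Df; apply: gen_domainP; eexists; exact: (gen t f t0 Df).2.
split.
- split.
  + exact: (evolution_strongly_continuous X_meas T_semigroup T_associated S_sub pi_law0).
  + split; first exact: (evolution_propagator X_meas T_semigroup T_associated S_sub pi_law0).
    exact: (evolution_backward X_meas T_semigroup T_associated S_sub pi_law0).
  + split; first exact: (evolution_propagator X_meas T_semigroup T_associated S_sub pi_law0).
    exact: (evolution_forward X_meas T_semigroup T_associated S_sub pi_law0).
- by move=> t t0 f Df; exists (G t f); exact: G_gen.
- move=> t f x t0 Df; have [i fG] := gen t f t0 Df; split; first exact: i.
  by rewrite /G (generatorE fG).
- move=> t1 t2 f t10 t12 Df; have t20 := le_trans t10 (ltW t12).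
  have fG := G_gen t2 f t20 Df.
  have UG := evolution_generator_comm X_meas T_semigroup T_associated S_sub pi_law0
    t10 (ltW t12) fG.
  split.
  + exact: (evolution_right_derivative X_meas T_semigroup T_associated S_sub pi_law0
      t10 (ltW t12) fG).
  + by exists (U t1 t2 (G t2 f)).
  + by rewrite /G (generatorE UG).
Qed.
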